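(* Let $\mathcal A$ be a unital C$^*$-algebra. Both $(\mathcal H,d_H)$ and $(\mathcal D,d_D)$ are non positively curved metric length spaces. In other words, if $\delta_1,\delta_2$ are two geodesics in $\mathcal H$ (resp. $\mathcal D$), the function $f(t)=d_H(\delta_1(t),\delta_2(t))$ (resp. $f(t)=d_D(\delta_1(t),\delta_2(t))$) is convex. If, additionally, $\delta_1(0)=\delta_2(0)$, then, for $t\in[0,1]$, $$d_H(\delta_1(t),\delta_2(t))\le t\,d_H(\delta_1(1),\delta_2(1))\quad\left(\text{resp. } d_D(\delta_1(t),\delta_2(t))\le t\,d_D(\delta_1(1),\delta_2(1))\right).$$ The diffeomorphism $\Gamma:\mathcal H\to\mathcal D$, $\Gamma(h)=(1+ih)(1-ih)^{-1}$, is an isometry, i.e. $d_D(\Gamma(h_1),\Gamma(h_2))=d_H(h_1,h_2)$ for all $h_1,h_2\in\mathcal H$.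
   Context: $G$ is the group of invertible elements of $\mathcal A$, $Im(h)=\frac1{2i}(h-h^* )$, $\mathcal H=\{h\in\mathcal A: Im(h)\text{ positive and invertible}\}$, $\mathcal D=\{z\in\mathcal A:\|z\|<1\}$. Put $\rho_H=\left(\begin{array}{cc}0&-i\\ i&0\end{array}\right)$ and $\rho_D=\left(\begin{array}{cc}1&0\\ 0&-1\end{array}\right)$ in $M_2(\mathcal A)$. For $L\in\{H,D\}$ let $\theta_L(\mathbf x,\mathbf y)=(\rho_L\mathbf x)^*\mathbf y$ on column vectors $\mathbf x,\mathbf y\in\mathcal A^2$ (so $\theta_H(\mathbf x,\mathbf y)=\frac1i(x_1^*y_2-x_2^*y_1)$, $\theta_D(\mathbf x,\mathbf y)=x_1^*y_1-x_2^*y_2$), let $\mathcal K_L=\{\mathbf x=(x_1,x_2)^T:\theta_L(\mathbf x,\mathbf x)=1,\ x_1\in G\}$, and for $\mathbf x\in\mathcal K_L$ let $p_{\mathbf x}=\mathbf x\mathbf x^*\rho_L\in M_2(\mathcal A)$. Define $\Phi_H$ on $\mathcal H$ (resp. $\Phi_D$ on $\mathcal D$) by $w\mapsto 2p_{\mathbf x}-1$, where $\mathbf x\in\mathcal K_H$ (resp. $\mathcal K_D$) is any element with $x_2x_1^{-1}=w$; these are well defined diffeomorphisms onto $\mathcal Q_{\rho_L}=\{\epsilon\in M_2(\mathcal A):\epsilon^2=1,\ \rho_L\epsilon\in Gl_2(\mathcal A)^+\}$, $L=H,D$ respectively, where $Gl_2(\mathcal A)^+$ is the set of positive invertible elements of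 $M_2(\mathcal A)$. On $Gl_2(\mathcal A)^+$ consider the Finsler metric $\|X\|_{\tilde a}=\|\tilde a^{-1/2}X\tilde a^{-1/2}\|$ ($X$ selfadjoint in $M_2(\mathcal A)$), whose distance (infimum of lengths of curves) is $d_g(\tilde a,\tilde b)=\|\log(\tilde a^{-1/2}\tilde b\tilde a^{-1/2})\|$, and whose geodesics are the curves $\gamma_{\tilde a,\tilde b}(t)=\tilde a^{1/2}(\tilde a^{-1/2}\tilde b\tilde a^{-1/2})^t\tilde a^{1/2}$; these are minimal for $d_g$. The unique geodesic joining two points of $\rho_L\mathcal Q_{\rho_L}=\{\rho_L\epsilon:\epsilon\in\mathcal Q_{\rho_L}\}$ stays in $\rho_L\mathcal Q_{\rho_L}$. Define $$d_H(h_1,h_2)=d_g(\rho_H\Phi_H(h_1),\rho_H\Phi_H(h_2)),\qquad d_D(z_1,z_2)=d_g(\rho_D\Phi_D(z_1),\rho_D\Phi_D(z_2)).$$ Geodesics in $\mathcal H$ (resp. $\mathcal D$) are the curves $\delta$ such that $t\mapsto\rho_H\Phi_H(\delta(t))$ (resp. $t\mapsto\rho_D\Phi_D(\delta(t))$) is a geodesic of $Gl_2(\mathcal A)^+$. A metric length space here is a metric space with a given family of short curves (the geodesics above); non positive curvature is the convexity property spelled out in the claim. *)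

(* Defs.v *)
From HB Require Import structures.
From mathcomp Require Import all_boot all_order all_algebra.
From mathcomp Require Import complex.
From mathcomp Require Import all_classical all_reals all_analysis.

Set Implicit Arguments.
Unset Strict Implicit.
Unset Printing Implicit Defensive.

Import Order.TTheory GRing.Theory Num.Theory.
Import numFieldNormedType.Exports.

Local Open Scope classical_set_scope.
Local Open Scope ring_scope.
Local Open Scope complex_scope.

(* Unital C*-algebras.  Algebras of the library are nontrivial rings, so       *)
(* 1 != 0.  The norm is a field of the structure, with values in R, because    *)
(* the library admits no common extension of its rings and normed modules      *)
(* other than numDomainType.  complex.Re `|c| is the modulus of c as an element of R.  *)
HB.mixin Record Algebra_isCStar (R : realType) A of GRing.Algebra R[i] A := {
  cnorm : A -> R;
  cnorm0_eq0 : forall x, cnorm x = 0 -> x = 0;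
  cnormD : forall x y, cnorm (x + y) <= cnorm x + cnorm y;
  cnormZ : forall (c : R[i]) x, cnorm (c *: x) = complex.Re `|c| * cnorm x;
  cnormM : forall x y, cnorm (x * y) <= cnorm x * cnorm y;
  cnorm_complete : forall u : nat -> A,
    (forall e : R, 0 < e -> exists N : nat, forall m n : nat,
       (N <= m)%N -> (N <= n)%N -> cnorm (u m - u n) < e) ->
    exists l : A, cnorm (u n - l) @[n --> \oo] --> (0 : R);
  star : A -> A;
  starK : involutive star;
  starD : {morph star : x y / x + y};
  starZ : forall (c : R[i]) x, star (c *: x) = c^* *: star x;
  starM : forall x y, star (x * y) = star y * star x;
  cnorm_starM : forall x, cnorm (star x * x) = cnorm x ^+ 2
}.

#[short(type="cstarAlgType")]
HB.structure Definition CStarAlgebra (R : realType) :=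
  {A of GRing.Algebra R[i] A & Algebra_isCStar R A}.

Section Invertible.
Variable T : pzRingType.

Definition invertible (x : T) := exists y, x * y = 1 /\ y * x = 1.

Definition inverse (x : T) : T := xget 0 [set y | x * y = 1 /\ y * x = 1].

End Invertible.

Section Algebra.
Variables (R : realType) (A : cstarAlgType R).

Definition spectrum (a : A) : set R[i] := [set l | ~ invertible (a - l%:A)].

Definition cpositive (a : A) :=
  star a = a /\ spectrum a `<=` [set l : R[i] | 0 <= l].

Definition imag (h : A) : A := (2%:R * 'i%C)^-1 *: (h - star h).

Definition half_space : set A :=
  [set h | cpositive (imag h) /\ invertible (imag h)].

Definition disk : set A := [set z | cnorm z < 1].

Definition cayley (h : A) : A :=
  (1 + 'i%C *: h) * inverse (1 - 'i%C *: h).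

(* Complex differentiability on an open set implies smoothness. *)
Definition differentiable_at (f : A -> A) (x : A) :=
  exists D : {linear A -> A},
    (exists c : R, forall v, cnorm (D v) <= c * cnorm v) /\
    forall e : R, 0 < e -> exists2 d : R, 0 < d &
      forall v, cnorm v < d -> cnorm (f (x + v) - f x - D v) <= e * cnorm v.

Definition diffeomorphism (U V : set A) (f : A -> A) :=
  exists g : A -> A,
    [/\ forall x, U x -> V (f x) /\ g (f x) = x,
        forall y, V y -> U (g y) /\ f (g y) = y,
        forall x, U x -> differentiable_at f x
      & forall y, V y -> differentiable_at g y].

End Algebra.

(* The C*-algebra M_2(A), with its norm as algebra of operators on the Hilbert *)
(* A-module A^2.  The library's scaling a *: M of M : 'M[A]_2 has a in A;      *)
(* complex scalars act entrywise by mxscale.                                   *)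
Section Matrices.
Variables (R : realType) (A : cstarAlgType R).
Implicit Types (M X Y : 'M[A]_2) (x y : 'cV[A]_2).

Definition mxstar m n (M : 'M[A]_(m, n)) : 'M[A]_(n, m) :=
  (map_mx (@star R A) M)^T.

Definition mxscale (c : R[i]) M : 'M[A]_2 := map_mx ( *:%R c) M.

Definition vnorm x : R := Num.sqrt (cnorm ((mxstar x *m x) 0 0)).

Definition mxnorm M : R := sup [set vnorm (M *m x) | x in [set x | vnorm x <= 1]].

Definition mxspectrum M : set R[i] := [set l | ~ invertible (M - mxscale l 1)].

Definition mxpositive M :=
  mxstar M = M /\ mxspectrum M `<=` [set l : R[i] | 0 <= l].

(* Gl_2(A)^+ *)
Definition glpos : set 'M[A]_2 := [set M | mxpositive M /\ invertible M].

Definition is_mxexp X Y :=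
  mxnorm (\sum_(k < n) mxscale (k`!%:R^-1) (X ^+ k) - Y) @[n --> \oo] --> (0 : R).

Definition mxexp X : 'M[A]_2 := xget 0 [set Y | is_mxexp X Y].

Definition mxlog M : 'M[A]_2 := xget 0 [set X | mxstar X = X /\ is_mxexp X M].

(* Meant for M positive and invertible, where mxlog M is the selfadjoint       *)
(* logarithm; in particular M^(1/2) is mxpow M 2^-1.                           *)
Definition mxpow M (t : R) : 'M[A]_2 := mxexp (mxscale t%:C (mxlog M)).

(* Finsler norm of the tangent vector X at the point M of Gl_2(A)^+ *)
Definition finsler M X : R :=
  mxnorm (mxpow M (- 2^-1) * X * mxpow M (- 2^-1)).

(* gamma is C^1 on [0, 1] with derivative dgamma (one-sided at 0 and 1). *)
Definition C1_curve (gamma dgamma : R -> 'M[A]_2) :=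
  forall t, t \in `[0, 1] ->
    mxnorm (mxscale ((s - t)^-1)%:C (gamma s - gamma t) - dgamma t)
      @[s --> within `[0, 1] t^'] --> (0 : R) /\
    mxnorm (dgamma s - dgamma t) @[s --> within `[0, 1] (nbhs t)] --> (0 : R).

Definition finsler_length (gamma dgamma : R -> 'M[A]_2) : R :=
  \int[lebesgue_measure]_(t in `[0, 1]) finsler (gamma t) (dgamma t).

(* The distance of the Finsler metric, defined as infimum of lengths. *)
Definition dist_g (M N : 'M[A]_2) : R :=
  inf [set l | exists gamma dgamma : R -> 'M[A]_2,
    [/\ C1_curve gamma dgamma,
        forall t, t \in `[0, 1] -> glpos (gamma t),
        gamma 0 = M, gamma 1 = N & l = finsler_length gamma dgamma]].

Definition geodesic_g (M N : 'M[A]_2) (t : R) : 'M[A]_2 :=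
  mxpow M 2^-1 * mxpow (mxpow M (- 2^-1) * N * mxpow M (- 2^-1)) t
    * mxpow M 2^-1.

Definition mx22 (a b c d : A) : 'M[A]_2 :=
  \matrix_(i, j) if i == 0 then (if j == 0 then a else b)
                 else (if j == 0 then c else d).

Definition rhoH : 'M[A]_2 := mx22 0 (- 'i%C%:A) 'i%C%:A 0.

Definition rhoD : 'M[A]_2 := mx22 1 0 0 (- 1).

Section Rho.
Variable rho : 'M[A]_2.

Definition theta x y : A := (mxstar (rho *m x) *m y) 0 0.

Definition Kset : set 'cV[A]_2 :=
  [set x | theta x x = 1 /\ invertible (x 0 0)].

Definition proj x : 'M[A]_2 := x *m mxstar x *m rho.

(* On the half-space (rho = rhoH) and on the disk (rho = rhoD), the value does *)
(* not depend on the chosen x.                                                 *)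
Definition Phi (w : A) : 'M[A]_2 :=
  let x := xget 0 [set x | Kset x /\ x 1 0 * inverse (x 0 0) = w] in
  mxscale 2%:R (proj x) - 1.

Definition dist (w1 w2 : A) : R := dist_g (rho *m Phi w1) (rho *m Phi w2).

Definition geodesic (U : set A) (I : interval R) (delta : R -> A) :=
  (forall t, t \in I -> U (delta t)) /\
  exists M N : 'M[A]_2,
    [/\ glpos M, glpos N
      & forall t, t \in I -> rho *m Phi (delta t) = geodesic_g M N t].

End Rho.

Definition distH : A -> A -> R := dist rhoH.
Definition distD : A -> A -> R := dist rhoD.
Definition geodesicH : interval R -> (R -> A) -> Prop :=
  geodesic rhoH (@half_space R A).
Definition geodesicD : interval R -> (R -> A) -> Prop :=
  geodesic rhoD (@disk R A).

End Matrices.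

Section LengthSpaces.
Variables (R : realType) (T : Type).
Implicit Types (U : set T) (d : T -> T -> R) (c : R -> T).

Definition is_metric_on U d :=
  [/\ forall x y, U x -> U y -> 0 <= d x y,
      forall x y, U x -> U y -> (d x y = 0 <-> x = y),
      forall x y, U x -> U y -> d x y = d y x
    & forall x y z, U x -> U y -> U z -> d x z <= d x y + d y z].

Definition curve_length d c (a b : R) : \bar R :=
  ereal_sup [set (\sum_(0 <= k < size s)
      d (c (nth b (a :: s) k)) (c (nth b (a :: s) k.+1)))%:E
    | s in itv_partition a b].

(* Every arc realizes the distance between its endpoints. *)
Definition short_curve d (I : interval R) c :=
  forall a b, a \in I -> b \in I -> a <= b ->
    curve_length d c a b = (d (c a) (c b))%:E.

(* The family G consists of curves parametrized by intervals. *)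
Definition metric_length_space U d (G : interval R -> (R -> T) -> Prop) :=
  [/\ is_metric_on U d,
      forall I c, G I c -> short_curve d I c
    & forall x y, U x -> U y ->
        exists c, [/\ G `[0, 1] c, c 0 = x & c 1 = y]].

Definition nonpositively_curved d (G : interval R -> (R -> T) -> Prop) :=
  (forall I c1 c2, G I c1 -> G I c2 ->
     convex_function [set` I] (fun t : R^o => d (c1 t) (c2 t) : R^o)) /\
  (forall c1 c2, G `[0, 1] c1 -> G `[0, 1] c2 -> c1 0 = c2 0 ->
     forall t, t \in `[0, 1] -> d (c1 t) (c2 t) <= t * d (c1 1) (c2 1)).

End LengthSpaces.

(* Main.v *)
(* The Finsler distance of two positive invertible elements a, b is their part
   (Thompson) metric, the least r with e^-r a <= b <= e^r a.  It bounds lengths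
   from below because a C^1 curve gam satisfies gam' <= |gam'|_gam gam, so that
   gam(t) <= exp(length) gam(0) by continuous induction, and the geodesic from a
   to b has constant speed and this length.  For two geodesics issuing from a
   common point, moved to 1 by a congruence, the part metric contracts by t at
   time t by the Loewner-Heinz inequality: a <= b implies a^t <= b^t for
   0 <= t <= 1.  Convexity for two arbitrary geodesics follows by inserting the
   diagonal geodesic and the triangle inequality.

   For x representing w the matrix E = x x* depends on w only, and
   E rho E = E, so Q = 2 E - rho satisfies Q rho Q = rho, while
   rho Phi(w) = rho Q rho.  For the disk these are exactly the positive M with
   (rho M)^2 = 1, a set closed under geodesics since conjugation by rho inverts
   its elements.  A constant unitary carries rho_H to rho_D and induces the
   Cayley transform on the ratios x_2 x_1^-1; it transfers everything to the
   half-space and is an isometry. *)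

From HB Require Import structures.
Require Import Defs.
From mathcomp Require Import all_boot all_order all_algebra.
From mathcomp Require Import complex.
From mathcomp Require Import all_classical all_reals all_analysis.
From mathcomp Require Import ring lra.
From Stdlib Require Import -(notations) Ncring Ncring_tac.

Set Implicit Arguments.
Unset Strict Implicit.
Unset Printing Implicit Defensive.

Import Order.TTheory GRing.Theory Num.Theory.
Import numFieldNormedType.Exports.

Local Open Scope classical_set_scope.
Local Open Scope ring_scope.
Local Open Scope complex_scope.

(** Positivity is defined through the spectrum, where closure under sums is not visible, and no
    functional calculus or Hilbert space representation is used. The order is therefore built on the
    norm condition |c - a| <= c, from which square roots come by a convergent iteration;
    exponential, logarithm and real powers then come from power series and iterated square roots.
    The spectrum serves where the norm does not suffice: to compare x* x with x x*, and to compare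
    similar elements. All of this is done in an arbitrary C*-algebra and used in M_2(A), which is
    shown to be one for its norm on the Hilbert module. The part metric is convenient because it
    refers to the order only, so every congruence by an invertible element preserves it, without
    polar decomposition. Geodesics are handled in the form t -> g exp(t x) g* with g merely
    invertible, so that shifting or reversing time is just a change of g and x. *)

Section NoncommutativeRing.
Variable T : pzRingType.

#[global] Instance ncring_ops : @Ring_ops T 0 1 +%R *%R (fun x y => x - y) -%R eq := {}.

#[global] Instance ncring_ring : Ring (Ro := ncring_ops).
Proof.
split=> //; try (by move=> ? ? -> ? ? ->); try (by move=> ? ? ->);
  rewrite /equality /=.
- exact: RelationClasses.eq_equivalence.
- exact: add0r.
- exact: addrC.
- exact: addrA.
- exact: mul1r.
- exact: mulr1.
- exact: mulrA.
- by move=> *; exact: mulrDl.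
- by move=> *; exact: mulrDr.
- exact: subrr.
Qed.

End NoncommutativeRing.

Ltac ncring := rewrite ?expr2; non_commutative_ring.

(** * Two-sided inverses in a ring *)

Section Invertible.
Variable T : pzRingType.
Implicit Types x y z : T.

Lemma inverseP x : invertible x -> x * inverse x = 1 /\ inverse x * x = 1.
Proof. by move=> [y xy]; rewrite /inverse; case: xgetP => [z -> //|/(_ y)]. Qed.

Lemma inverse_unique x y : x * y = 1 -> y * x = 1 -> inverse x = y.
Proof.
move=> xy yx; have [|xi ix] := @inverseP x; first by exists y.
by rewrite -[inverse x]mul1r -yx -mulrA xi mulr1.
Qed.

Lemma invertible1 : invertible (1 : T).
Proof. by exists 1; rewrite mulr1. Qed.

Lemma invertible_inverse x : invertible x -> invertible (inverse x).
Proof. by move=> /inverseP[]; exists x. Qed.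

Lemma invertibleM x y : invertible x -> invertible y -> invertible (x * y).
Proof.
move=> [x' [xx' x'x]] [y' [yy' y'y]]; exists (y' * x').
by rewrite !mulrA -(mulrA x) yy' mulr1 xx' -(mulrA y') x'x mulr1 y'y.
Qed.

Lemma inverseM x y : invertible x -> invertible y ->
  inverse (x * y) = inverse y * inverse x.
Proof.
move=> /inverseP[xx' x'x] /inverseP[yy' y'y]; apply: inverse_unique.
  by rewrite !mulrA -(mulrA x) yy' mulr1 xx'.
by rewrite !mulrA -(mulrA _ _ x) x'x mulr1 y'y.
Qed.

Lemma inverseK x : invertible x -> inverse (inverse x) = x.
Proof. by move=> /inverseP[xx' x'x]; apply: inverse_unique. Qed.

(** If [z] inverts [x * y], then [y * z] is a right inverse of [x] and, as the factors commute,
    [z * y] is a left one; the two agree. It extracts invertibility of a factor from products such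
    as [k * k] or (b - d)(b + d). *)
Lemma comm_invertible x y : x * y = y * x -> invertible (x * y) -> invertible x.
Proof.
move=> xy [z [xyz zxy]]; exists (y * z); rewrite mulrA; split => //.
have zy : z * y * x = 1 by rewrite -mulrA -xy.
suff -> : y * z = z * y by [].
by rewrite -[y * z]mul1r -{1}zy -mulrA [x * _]mulrA xyz mulr1.
Qed.

Lemma comm_inverse x y : invertible x -> x * y = y * x ->
  inverse x * y = y * inverse x.
Proof.
move=> /inverseP[xi ix] xy.
by rewrite -[LHS]mulr1 -xi !mulrA -(mulrA _ y) -xy !mulrA ix mul1r.
Qed.

(** Formally 1 + y x + y x y x + ... = 1 + y (1 + x y + ...) x, which suggests the inverse
    [1 + y * z * x]. Hence x y and y x have the same nonzero spectrum. *)
Lemma invertible_1subM x y : invertible (1 - x * y) -> invertible (1 - y * x).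
Proof.
move=> [z [h1 h2]]; exists (1 + y * z * x).
have h1' : x * y * z = z - 1.
  by apply/eqP; rewrite eq_sym subr_eq addrC -subr_eq -h1; apply/eqP; ncring.
have h2' : z * x * y = z - 1.
  by apply/eqP; rewrite eq_sym subr_eq addrC -subr_eq -h2; apply/eqP; ncring.
split.
  rewrite (_ : _ * _ = 1 - y * x + y * z * x - y * (x * y * z) * x); last by ncring.
  by rewrite h1'; ncring.
rewrite (_ : _ * _ = 1 - y * x + y * z * x - y * (z * x * y) * x); last by ncring.
by rewrite h2'; ncring.
Qed.

Lemma invertible_conj g x h : g * h = 1 -> h * g = 1 ->
  invertible x -> invertible (g * x * h).
Proof.
move=> gh hg ix; apply: invertibleM; last by exists g.
by apply: invertibleM => //; exists h.
Qed.

Lemma invertible_mulIr x y z : invertible z -> x * z = y * z -> x = y.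
Proof.
by move=> /inverseP[zi _] xy; rewrite -[x]mulr1 -[y]mulr1 -zi !mulrA xy.
Qed.

Lemma invertible_mulrI x y z : invertible z -> z * x = z * y -> x = y.
Proof.
by move=> /inverseP[_ iz] xy; rewrite -[x]mul1r -[y]mul1r -iz -!mulrA xy.
Qed.

End Invertible.

(** * Elements of a C*-algebra and convergence in norm *)

Section Norm.
Variables (R : realType) (A : cstarAlgType R).
Implicit Types (x y z : A) (r s : R) (u v : nat -> A).

(** Real scalars as central elements of the ring, so that scaled identities become identities
    between products. *)
Definition sc r : A := r%:C%:A.

Lemma scE r x : r%:C *: x = sc r * x.
Proof. by rewrite /sc -scalerAl mul1r. Qed.
Lemma scC r x : sc r * x = x * sc r.
Proof. by rewrite /sc -scalerAl mul1r -scalerAr mulr1. Qed.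
Lemma sc0 : sc 0 = 0. Proof. by rewrite /sc scale0r. Qed.
Lemma sc1 : sc 1 = 1. Proof. by rewrite /sc scale1r. Qed.
Lemma scD r s : sc (r + s) = sc r + sc s.
Proof. by rewrite /sc rmorphD scalerDl. Qed.
Lemma scN r : sc (- r) = - sc r.
Proof. by rewrite /sc rmorphN scaleNr. Qed.
Lemma scB r s : sc (r - s) = sc r - sc s.
Proof. by rewrite scD scN. Qed.
Lemma scM r s : sc (r * s) = sc r * sc s.
Proof. by rewrite -scE /sc rmorphM scalerA. Qed.
Lemma scX r n : sc (r ^+ n) = sc r ^+ n.
Proof. by elim: n => [|n IH]; rewrite ?sc1// !exprS scM IH. Qed.
Lemma sc2 : sc 2 = 1 + 1.
Proof. by rewrite -sc1 -scD. Qed.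
Lemma scV r : r != 0 -> sc r * sc r^-1 = 1.
Proof. by move=> r0; rewrite -scM divff// sc1. Qed.
Lemma scMM r s x y : (sc r * x) * (sc s * y) = sc (r * s) * (x * y).
Proof. by rewrite scM -!mulrA; congr (_ * _); rewrite mulrA -scC -mulrA. Qed.
Lemma half_add x : sc 2^-1 * x + sc 2^-1 * x = x.
Proof.
by rewrite -mulrDl -scD (_ : _ + _ = 1) ?sc1 ?mul1r//; lra.
Qed.
Lemma invertible_sc r : r != 0 -> invertible (sc r).
Proof. by move=> r0; exists (sc r^-1); split; last rewrite scC; exact: scV. Qed.

Lemma star_scale (c : R[i]) x : star (c *: x) = conjc c *: star x.
Proof. exact: starZ. Qed.
Lemma star0 : star (0 : A) = 0.
Proof. by rewrite -(scale0r (0 : A)) star_scale rmorph0 !scale0r. Qed.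
Lemma starN x : star (- x) = - star x.
Proof. by apply/eqP; rewrite -addr_eq0 -starD addNr star0. Qed.
Lemma starB x y : star (x - y) = star x - star y.
Proof. by rewrite starD starN. Qed.
Lemma star1 : star (1 : A) = 1.
Proof. by rewrite -[RHS]starK -[star 1 in RHS]mulr1 starM starK mulr1. Qed.
Lemma star_sc r : star (sc r) = sc r.
Proof. by rewrite /sc star_scale star1 conjc_real. Qed.
Lemma star_scM r x : star (sc r * x) = sc r * star x.
Proof. by rewrite starM star_sc -scC. Qed.
Lemma starX x n : star (x ^+ n) = star x ^+ n.
Proof. by elim: n => [|n IH]; rewrite ?star1// exprS exprSr starM IH. Qed.
Lemma star_sum I (s : seq I) P (F : I -> A) :
  star (\sum_(i <- s | P i) F i) = \sum_(i <- s | P i) star (F i).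
Proof. by apply: (big_morph (@star R A)); [exact: starD|exact: star0]. Qed.

Lemma invertible_star x : invertible x -> invertible (star x).
Proof. by move=> [y [xy yx]]; exists (star y); rewrite -!starM xy yx star1. Qed.

Lemma inverse_star x : invertible x -> inverse (star x) = star (inverse x).
Proof.
by move=> /inverseP[xy yx]; apply: inverse_unique; rewrite -starM ?xy ?yx star1.
Qed.

Lemma cnorm_scM r x : cnorm (sc r * x) = `|r| * cnorm x.
Proof.
by rewrite -scE cnormZ normc_def /= expr0n /= addr0 sqrtr_sqr.
Qed.
Lemma cnorm0 : cnorm (0 : A) = 0.
Proof. by rewrite -(mul0r 0) -sc0 cnorm_scM normr0 mul0r. Qed.
Lemma cnormN x : cnorm (- x) = cnorm x.
Proof. by rewrite -[- x]mulN1r -sc1 -scN cnorm_scM normrN normr1 mul1r. Qed.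
Lemma cnorm_distC x y : cnorm (x - y) = cnorm (y - x).
Proof. by rewrite -cnormN opprB. Qed.
Lemma cnorm_ge0 x : 0 <= cnorm x.
Proof. by have := cnormD x (- x); rewrite subrr cnorm0 cnormN; lra. Qed.
Lemma cnormB x y : cnorm (x - y) <= cnorm x + cnorm y.
Proof. by rewrite -(cnormN y) cnormD. Qed.
Lemma cnorm_dist x y z : cnorm (x - z) <= cnorm (x - y) + cnorm (y - z).
Proof. by apply: le_trans (cnormD _ _); rewrite addrA subrK. Qed.
(** The C*-identity gives |y|^2 = |y* y| <= |y*| |y|; divide by |y|, and apply the result to
    [star x] as well. *)
Lemma cnorm_star x : cnorm (star x) = cnorm x.
Proof.
suff h y : cnorm y <= cnorm (star y) by apply/le_anti; rewrite h -{2}(starK x) h.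
have [->|y0] := eqVneq (cnorm y) 0; first exact: cnorm_ge0.
rewrite -(@ler_pM2r _ (cnorm y)) ?lt_neqAle ?cnorm_ge0 1?eq_sym ?y0//.
by rewrite -expr2 -cnorm_starM cnormM.
Qed.
Lemma cnorm1 : cnorm (1 : A) = 1.
Proof.
have := cnorm_starM (1 : A); rewrite star1 mulr1 => h.
have n0 : cnorm (1 : A) != 0 by apply/eqP => /cnorm0_eq0/eqP; rewrite oner_eq0.
by apply: (mulfI n0); rewrite mulr1 [RHS]h expr2.
Qed.
Lemma cnorm_sc r : cnorm (sc r) = `|r|.
Proof. by rewrite -[sc r]mulr1 cnorm_scM cnorm1 mulr1. Qed.
Lemma cnormX x n : cnorm (x ^+ n) <= cnorm x ^+ n.
Proof.
elim: n => [|n IH]; first by rewrite cnorm1.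
by rewrite !exprS (le_trans (cnormM _ _))// ler_wpM2l// cnorm_ge0.
Qed.
Lemma cnorm_sum I (s : seq I) P (F : I -> A) :
  cnorm (\sum_(i <- s | P i) F i) <= \sum_(i <- s | P i) cnorm (F i).
Proof.
elim/big_rec2 : _ => [|i a b _ h]; first by rewrite cnorm0.
by rewrite (le_trans (cnormD _ _))// lerD2l.
Qed.
Lemma sc_inj r s : sc r = sc s -> r = s.
Proof.
by move=> h; apply/eqP; rewrite -subr_eq0 -normr_eq0 -cnorm_sc scB h subrr cnorm0.
Qed.

Definition cto u (l : A) := cnorm (u n - l) @[n --> \oo] --> (0 : R).

Lemma cto_squeeze u l (a : nat -> R) :
  (forall n, cnorm (u n - l) <= a n) -> a n @[n --> \oo] --> (0 : R) -> cto u l.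
Proof.
move=> ua a0; apply: (squeeze_cvgr _ (cvg_cst 0) a0).
by apply: nearW => n; rewrite ua cnorm_ge0.
Qed.

Lemma cto_cst l : cto (fun=> l) l.
Proof. by rewrite /cto; under eq_fun do rewrite subrr cnorm0; exact: cvg_cst. Qed.

Lemma ctoD u v l m : cto u l -> cto v m -> cto (fun n => u n + v n) (l + m).
Proof.
move=> ul vm; apply: cto_squeeze => [n|]; last first.
  by rewrite -[0](addr0 0); exact: cvgD ul vm.
by rewrite opprD addrACA cnormD.
Qed.

Lemma ctoMl x u l : cto u l -> cto (fun n => x * u n) (x * l).
Proof.
move=> ul; apply: cto_squeeze => [n|]; last first.
  by rewrite -[0](mulr0 (cnorm x)); exact: cvgM (cvg_cst _) ul.
by rewrite -mulrBr cnormM.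
Qed.

Lemma cto_bounded u l : cto u l -> exists2 M : R, 0 <= M & forall n, cnorm (u n) <= M.
Proof.
move=> ul; have [] := cvg_seq_bounded (cvgP _ ul) => M [_ /(_ (M + 1))].
rewrite ltrDl ltr01 => /(_ isT) h; exists (M + 1 + cnorm l).
  by rewrite addr_ge0 ?cnorm_ge0//; apply: le_trans (h 0 I); rewrite normr_ge0.
move=> n; have /= := h n I; rewrite ger0_norm ?cnorm_ge0// => hn.
by rewrite -(subrK l (u n)) (le_trans (cnormD _ _))// lerD2r.
Qed.

Lemma ctoM u v l m : cto u l -> cto v m -> cto (fun n => u n * v n) (l * m).
Proof.
move=> ul vm; have [M M0 hM] := cto_bounded ul.
apply: (@cto_squeeze _ _ (fun n => M * cnorm (v n - m) + cnorm (u n - l) * cnorm m)).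
  move=> n; rewrite (_ : _ - _ = u n * (v n - m) + (u n - l) * m); last by ncring.
  rewrite (le_trans (cnormD _ _))// lerD ?cnormM// (le_trans (cnormM _ _))//.
  by rewrite ler_wpM2r ?cnorm_ge0.
rewrite (_ : 0 = M * 0 + 0 * cnorm m); last by rewrite mulr0 mul0r addr0.
by apply: cvgD; [apply: cvgM vm|apply: cvgM ul _]; exact: cvg_cst.
Qed.

Lemma cto_sc (a : nat -> R) r : a n @[n --> \oo] --> r -> cto (fun n => sc (a n)) (sc r).
Proof.
move=> ar; apply: (@cto_squeeze _ _ (fun n => `|a n - r|)) => [n|].
  by rewrite -scB cnorm_sc.
by rewrite -(@normr0 _ R) -(subrr r); apply: cvg_norm; apply: cvgB => //; exact: cvg_cst.
Qed.

Lemma ctoN u l : cto u l -> cto (fun n => - u n) (- l).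
Proof.
by rewrite /cto => h; under eq_fun do rewrite -opprD cnormN.
Qed.

Lemma ctoB u v l m : cto u l -> cto v m -> cto (fun n => u n - v n) (l - m).
Proof. by move=> ul /ctoN; exact: ctoD. Qed.

Lemma cto_star u l : cto u l -> cto (fun n => star (u n)) (star l).
Proof. by rewrite /cto => h; under eq_fun do rewrite -starB cnorm_star. Qed.

Lemma cto_shift u l : cto u l -> cto (fun n => u n.+1) l.
Proof.
move=> ul; rewrite /cto (_ : (fun _ => _) = (fun n => cnorm (u n - l)) \o addn^~ 1%N).
  exact: (cvg_comp _ _ (cvg_addnr 1) ul).
by apply/funext => n /=; rewrite addn1.
Qed.

Lemma cto_cnorm u l : cto u l -> cnorm (u n) @[n --> \oo] --> cnorm l.
Proof.
move=> ul; apply/cvgrPdist_le => /= e e0; near=> n.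
apply: (@le_trans _ _ (cnorm (u n - l))).
  rewrite ler_norml; have := cnorm_dist (u n) l 0; have := cnorm_dist l (u n) 0.
  by rewrite !subr0 (cnorm_distC l); lra.
by near: n; move/cvgrPdist_le: ul => /(_ e e0); apply: filterS => n;
  rewrite sub0r normrN ger0_norm ?cnorm_ge0.
Unshelve. all: by end_near. Qed.

Lemma cto_le u l r : (forall n, cnorm (u n) <= r) -> cto u l -> cnorm l <= r.
Proof. by move=> ur /cto_cnorm ul; apply: (cvgr_to_le ul); exact: nearW. Qed.

Lemma cto_unique u l m : cto u l -> cto u m -> l = m.
Proof.
move=> ul um; apply/eqP; rewrite -subr_eq0; apply/eqP/cnorm0_eq0.
apply/le_anti; rewrite cnorm_ge0 andbT.
have /cto_le : forall n, cnorm (u n - u n) <= 0 by move=> n; rewrite subrr cnorm0.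
by apply; exact: ctoB.
Qed.

(** The increments of [u] are bounded by those of a bounded nondecreasing real sequence, so [u] is
    Cauchy, and the tail estimate passes to the limit. It serves the Neumann series, the square
    root, the exponential and the logarithm. *)
Lemma dominated_cto u (a : nat -> R) r :
  (forall n, cnorm (u n.+1 - u n) <= a n.+1 - a n) -> (forall n, a n <= r) ->
  exists l, cto u l /\ forall n, cnorm (l - u n) <= r - a n.
Proof.
move=> ua ar.
have uam n m : (n <= m)%N -> cnorm (u m - u n) <= a m - a n.
  elim: m => [|m IH]; first by rewrite leqn0 => /eqP ->; rewrite !subrr cnorm0.
  rewrite leq_eqVlt => /orP[/eqP <-|/IH h]; first by rewrite !subrr cnorm0.
  by have := cnorm_dist (u m.+1) (u m) (u n); have := ua m; lra.
have a_nd : nondecreasing_seq a.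
  by move=> n m /uam h; have := cnorm_ge0 (u m - u n); lra.
have /cvgrPdist_lt a_cvg : a @ \oo --> sup (range a).
  by apply: nondecreasing_cvgn => //; exists r => _ [n _ <-].
have [l ul] : exists l, cto u l.
  apply: cnorm_complete => e e0.
  have [N _ hN] := a_cvg (e / 2) (divr_gt0 e0 (ltr0Sn _ _)).
  exists N => m n Nm Nn.
  have := hN m Nm; have := hN n Nn; rewrite /= !ltr_norml.
  have := uam N n Nn; have := uam N m Nm.
  have := cnorm_dist (u m) (u N) (u n); rewrite (cnorm_distC (u N)).
  case/orP: (leq_total m n) => mn; have := uam _ _ mn;
    rewrite 1?(cnorm_distC (u n)); lra.
exists l; split=> // n.
apply: (@cto_le (fun m => u (m + n)%N - u n)).
  by move=> m; rewrite (le_trans (uam _ _ (leq_addl _ _)))// lerD2r.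
by apply: ctoB (cto_cst _); exact: (cvg_comp _ _ (cvg_addnr n) ul).
Qed.

Lemma geometric_cto0 x : cnorm x < 1 -> cto (fun n => x ^+ n) 0.
Proof.
move=> x1; apply: (@cto_squeeze _ _ (fun n => cnorm x ^+ n)).
  by move=> n; rewrite subr0 cnormX.
by apply: cvg_expr; rewrite ger0_norm ?cnorm_ge0.
Qed.

Lemma neumann x : cnorm x < 1 -> invertible (1 - x).
Proof.
move=> x1; pose u n := \sum_(i < n) x ^+ i.
pose a n := \sum_(i < n) cnorm x ^+ i.
have [n|n|l [ul _]] := @dominated_cto u a ((1 - cnorm x)^-1).
- by rewrite /u /a !big_ord_recr/= ![_ + _ ^+ _ - _]addrC !addKr cnormX.
- rewrite -[_^-1]mul1r ler_pdivlMr ?subr_gt0// -opprB mulrN mulrC -subrX1 opprB.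
  by rewrite lerBlDr lerDl exprn_ge0// cnorm_ge0.
(* With one of [y], [z] equal to 1 and the other to 1 - x, this gives both one-sided inverses. *)
have h y z : (forall n, y * u n * z = 1 - x ^+ n) -> y * l * z = 1.
  move=> yz; apply: (@cto_unique (fun n => y * u n * z)).
    by apply: ctoM (cto_cst _); exact: ctoMl.
  rewrite -[1 in X in cto _ X]subr0 (_ : (fun _ => _) = fun n => 1 - x ^+ n).
    by apply: ctoB (geometric_cto0 x1); exact: cto_cst.
  exact/funext.
exists l; split.
  by rewrite -[_ * l]mulr1; apply: h => n; rewrite mulr1 /u -opprB mulNr -subrX1 opprB.
rewrite -[l]mul1r; apply: h => n; rewrite mul1r.
rewrite -[in RHS]opprB subrX1 -mulNr opprB /u.
by rewrite mulr_suml mulr_sumr; apply: eq_bigr => i _;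
  rewrite mulrBl mulrBr mul1r mulr1 -exprS -exprSr.
Qed.

End Norm.

(** * Positive elements *)

Section Positivity.
Variables (R : realType) (A : cstarAlgType R).
Implicit Types (a b x y z : A) (r c e : R).

Lemma cnorm_sq x : star x = x -> cnorm (x * x) = cnorm x ^+ 2.
Proof. by move=> xs; rewrite -cnorm_starM xs. Qed.

Lemma sq_eq0 x : star x = x -> x * x = 0 -> x = 0.
Proof.
move=> xs x0; apply: cnorm0_eq0; apply/eqP; rewrite -sqrf_eq0 -cnorm_sq// x0.
by rewrite cnorm0.
Qed.

Lemma mulr_commB x y : x * y = y * x -> (x - y) * (x + y) = x * x - y * y.
Proof. by move=> xy; rewrite mulrBl !mulrDr xy; ncring. Qed.

Lemma mulr_commD x y : x * y = y * x -> (x + y) * (x - y) = x * x - y * y.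
Proof. by move=> xy; rewrite mulrDl !mulrBr xy; ncring. Qed.

(* The square root of 1 - y is 1 - l, where l is the limit of the iteration
   x_(n+1) = (y + x_n^2)/2; it is dominated by the scalar iteration for y = 1. *)
Lemma sqrt_1sub y : star y = y -> cnorm y <= 1 ->
  exists k, [/\ star k = k, k * k = 1 - y, cnorm (1 - k) <= 1
    & forall z, y * z = z * y -> k * z = z * k].
Proof.
move=> ys y1.
pose x := fix x n := if n is m.+1 then sc A 2^-1 * (y + x m * x m) else 0.
pose t := fix t n : R := if n is m.+1 then 2^-1 * (1 + t m * t m) else 0.
have t01 n : 0 <= t n <= 1.
  elim: n => [|n /andP[h0 h1]]; first by rewrite /= lexx ler01.
  by rewrite /=; apply/andP; split; nra.
have xt n : cnorm (x n) <= t n.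
  elim: n => [|n IH]; first by rewrite cnorm0.
  rewrite [x _]/= [t _]/= cnorm_scM ger0_norm ?invr_ge0// ler_pM2l ?invr_gt0//.
  rewrite (le_trans (cnormD _ _))// lerD// (le_trans (cnormM _ _))//.
  by rewrite ler_pM// cnorm_ge0.
have dxt n : cnorm (x n.+1 - x n) <= t n.+1 - t n.
  elim: n => [|n IH].
    rewrite subr0 [x _]/= [t _]/= cnorm_scM ger0_norm ?invr_ge0// !mulr0 !addr0 subr0.
    by rewrite ler_pM2l ?invr_gt0.
  (* The difference of squares is split as p (p - q) + (p - q) q, which is valid without commutation
     and has the same shape for the scalars [t]. *)
  rewrite (_ : x n.+2 - x n.+1 =
      sc A 2^-1 * (x n.+1 * (x n.+1 - x n) + (x n.+1 - x n) * x n)); last first.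
    rewrite [x n.+2]/= [X in _ - X]/= -[X in sc A 2^-1 * (y + X * X) - _]/(x n.+1).
    by ncring.
  rewrite cnorm_scM ger0_norm ?invr_ge0//.
  rewrite (_ : t n.+2 - t n.+1 =
      2^-1 * (t n.+1 * (t n.+1 - t n) + (t n.+1 - t n) * t n)); last first.
    by rewrite [t n.+2]/= [X in _ - X]/= -[X in 2^-1 * (1 + X * X) - _]/(t n.+1); ring.
  rewrite ler_pM2l ?invr_gt0// (le_trans (cnormD _ _))// lerD//.
    by rewrite (le_trans (cnormM _ _))// ler_pM ?cnorm_ge0.
  by rewrite (le_trans (cnormM _ _))// ler_pM ?cnorm_ge0.
have [n|l [xl /(_ 0%N)]] := dominated_cto dxt (r := 1).
  by case/andP: (t01 n).
rewrite !subr0 => l1.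
have ll : l = sc A 2^-1 * (y + l * l).
  apply: cto_unique (cto_shift xl) _; apply: ctoMl; apply: ctoD; first exact: cto_cst.
  exact: ctoM.
exists (1 - l); split.
- rewrite starB star1; congr (_ - _); apply: cto_unique (cto_star xl) _.
  rewrite (_ : (fun _ => _) = x)//; apply/funext.
  by elim=> [|n /= IH]; rewrite ?star0// star_scM starD ys starM IH.
(* The fixed point equation reads l + l = y + l^2, hence (1 - l)^2 = 1 - y. *)
- rewrite (_ : _ * _ = 1 - (l + l) + l * l); last by ncring.
  by rewrite {1 2}ll half_add; ncring.
- by rewrite subKr.
- move=> z yz; rewrite mulrBl mulrBr mul1r mulr1; congr (_ - _).
  apply: (@cto_unique _ _ (fun n => x n * z)); first exact: ctoM (cto_cst z).
  rewrite (_ : (fun _ => _) = fun n => z * x n); first exact: ctoMl.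
  apply/funext; elim=> [|n /= IH]; first by rewrite mul0r mulr0.
  rewrite mulrA -scC -!mulrA; congr (_ * _); rewrite mulrDl mulrDr yz; congr (_ + _).
  by rewrite -mulrA IH !mulrA IH.
Qed.

Lemma invertible_sqrt k x : k * k = x -> invertible x -> invertible k.
Proof. by move=> kx ix; apply: (@comm_invertible _ k k); rewrite ?kx. Qed.

(** The element u = a + i b satisfies u* u = a^2 + b^2 = r^2, so |u| = r by the C*-identity, and [a]
    is the real part of [u]. *)
Lemma cnorm_parts a b r : star a = a -> star b = b -> a * b = b * a ->
  0 <= r -> a * a + b * b = sc A (r ^+ 2) -> cnorm a <= r.
Proof.
move=> sa sb ab r0 abr; pose u := a + 'i%C *: b.
have su : star u = a - 'i%C *: b.
  by rewrite starD star_scale sa sb -scaleNr; congr (_ + _ *: _); apply/eqP;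
    rewrite eq_complex /= oppr0 !eqxx.
have ii : 'i%C *: ('i%C *: (b * b)) = - (b * b).
  by rewrite scalerA -expr2 sqr_i scaleN1r.
have uu : cnorm u = r.
  apply/eqP; rewrite -(@eqrXn2 _ 2)// ?cnorm_ge0// -cnorm_starM su /u.
  rewrite (_ : _ * _ = a * a + b * b); last first.
    by rewrite mulrBl !mulrDr -!scalerAl -!scalerAr ii ab; ncring.
  by rewrite abr cnorm_sc ger0_norm ?exprn_ge0.
have -> : a = sc A 2^-1 * (u + star u).
  by rewrite su addrACA subrr addr0 mulrDr half_add.
rewrite cnorm_scM ger0_norm ?invr_ge0//; have := cnormD u (star u).
by rewrite cnorm_star uu; lra.
Qed.

(** Let k be the square root of 1 - x^2. Then k^2 + x^2 = 1 with commuting self-adjoint k and x, so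
    [cnorm_parts] gives |k| <= 1. *)
Lemma cnorm_1subsq x : star x = x -> cnorm x <= 1 -> cnorm (1 - x * x) <= 1.
Proof.
move=> xs x1; have [||k [ks kk _ kC]] := @sqrt_1sub (x * x).
- by rewrite starM xs.
- by rewrite cnorm_sq// expr_le1// cnorm_ge0.
rewrite -kk cnorm_sq// expr_le1 ?cnorm_ge0//.
apply: (@cnorm_parts _ x) => //; first by apply: kC; rewrite mulrA.
by rewrite kk expr1n sc1 subrK.
Qed.

(* Positivity expressed by the norm.  It is closed under sums by the triangle
   inequality; [cpositiveP] shows that it agrees with the spectral notion. *)
Definition npos a := star a = a /\ exists2 c, 0 <= c & cnorm (sc A c - a) <= c.

Lemma npos_star a : npos a -> star a = a. Proof. by case. Qed.

Lemma npos_sc r : 0 <= r -> npos (sc A r).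
Proof. by move=> r0; split; [exact: star_sc|exists r; rewrite ?subrr ?cnorm0]. Qed.

Lemma npos0 : npos 0. Proof. by rewrite -(sc0 A); exact: npos_sc. Qed.
Lemma npos1 : npos 1. Proof. by rewrite -(sc1 A); exact: npos_sc. Qed.

Lemma nposD a b : npos a -> npos b -> npos (a + b).
Proof.
move=> [sa [c c0 ac]] [sb [d d0 bd]]; split; first by rewrite starD sa sb.
exists (c + d); first exact: addr_ge0.
by rewrite scD opprD addrACA (le_trans (cnormD _ _))// lerD.
Qed.

Lemma npos_scM r a : 0 <= r -> npos a -> npos (sc A r * a).
Proof.
move=> r0 [sa [c c0 ac]]; split; first by rewrite star_scM sa.
exists (r * c); first exact: mulr_ge0.
by rewrite scM -mulrBr cnorm_scM ger0_norm// ler_wpM2l.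
Qed.

(** Dividing by |a| + 1, which is positive even for a = 0, reduces to [cnorm_1subsq]. *)
Lemma npos_sq a : star a = a -> npos (a * a).
Proof.
move=> sa; split; first by rewrite starM sa.
have m0 : 0 < cnorm a + 1 by have := cnorm_ge0 a; lra.
exists ((cnorm a + 1) ^+ 2); first by rewrite exprn_ge0 ?ltW.
pose x := sc A (cnorm a + 1)^-1 * a.
have ax : a = sc A (cnorm a + 1) * x by rewrite mulrA scV ?mul1r// gt_eqF.
rewrite (_ : _ - _ = sc A ((cnorm a + 1) ^+ 2) * (1 - x * x)); last first.
  by rewrite mulrBr mulr1; congr (_ - _); rewrite {1 2}ax scMM.
rewrite cnorm_scM gtr0_norm ?exprn_gt0// -[leRHS]mulr1 ler_pM2l ?exprn_gt0//.
apply: cnorm_1subsq; first by rewrite star_scM sa.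
rewrite cnorm_scM gtr0_norm ?invr_gt0// mulrC ler_pdivrMr//; lra.
Qed.

(** For c > 0 one has |1 - a / c| <= 1, so [sqrt_1sub] gives a root of a / c; for c = 0 the norm
    condition forces a = 0. *)
Lemma npos_sqrt a : npos a -> exists k, [/\ npos k, k * k = a
  & forall z, a * z = z * a -> k * z = z * k].
Proof.
move=> [sa [c]]; rewrite le_eqVlt => /orP[/eqP <-|c0] ac.
  exists 0; split => [||z _]; rewrite ?mulr0 ?mul0r//; first exact: npos0.
  apply/esym/cnorm0_eq0/le_anti; rewrite cnorm_ge0 andbT -cnormN.
  by rewrite -[- a]add0r -(sc0 A).
have c1 : sc A c * sc A c^-1 = 1 by rewrite scV ?gt_eqF.
have [||k [ks kk k1 kC]] := @sqrt_1sub (1 - sc A c^-1 * a).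
- by rewrite starB star1 star_scM sa.
- rewrite (_ : _ - _ = sc A c^-1 * (sc A c - a)); last first.
    by rewrite mulrBr [X in _ = X - _]scC c1.
  by rewrite cnorm_scM gtr0_norm ?invr_gt0// mulrC ler_pdivrMr// mul1r.
exists (sc A (Num.sqrt c) * k); split.
- apply: npos_scM; first exact: sqrtr_ge0.
  by split=> //; exists 1; rewrite ?sc1.
- by rewrite scMM -expr2 sqr_sqrtr ?ltW// kk subKr mulrA c1 mul1r.
- move=> z az; rewrite mulrA -scC -!mulrA kC// mulrBl mulrBr mul1r mulr1.
  by rewrite mulrA -scC -!mulrA az.
Qed.

(** The constant in [npos] can be any bound for the norm: with k^2 = a, the element c - a is c times
    1 - (k / sqrt c)^2. A common constant is what makes positivity closed under limits. *)
Lemma npos_le a c : npos a -> cnorm a <= c -> npos (sc A c - a) /\ cnorm (sc A c - a) <= c.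
Proof.
move=> ap ac; have c0 : 0 <= c := le_trans (cnorm_ge0 _) ac.
split; first by split; [rewrite starB star_sc npos_star|exists c; rewrite ?subKr].
have [k [[sk _] kk _]] := npos_sqrt ap.
have [c00|cn0] := eqVneq c 0.
  by rewrite c00 in ac *; rewrite sc0 sub0r cnormN.
have c_gt0 : 0 < c by rewrite lt_neqAle eq_sym cn0.
have -> : sc A c - a = sc A c * (1 - (sc A (Num.sqrt c)^-1 * k) * (sc A (Num.sqrt c)^-1 * k)).
  by rewrite scMM -expr2 exprVn sqr_sqrtr// kk mulrBr mulr1 mulrA scV// mul1r.
rewrite cnorm_scM ger0_norm// -[leRHS]mulr1 ler_pM2l//.
apply: cnorm_1subsq; first by rewrite star_scM sk.
rewrite -[leRHS]mulr1 -(@ler_pXn2r _ 2) ?nnegrE ?mulr1 ?cnorm_ge0//.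
rewrite -cnorm_sq ?star_scM ?sk//.
rewrite scMM -expr2 exprVn sqr_sqrtr//.
by rewrite kk cnorm_scM ger0_norm ?invr_ge0// mulrC ler_pdivrMr// expr1n mul1r.
Qed.

Lemma npos_comm_mul a b : npos a -> npos b -> a * b = b * a -> npos (a * b).
Proof.
move=> /npos_sqrt[h [/npos_star sh hh hC]] /npos_sqrt[k [/npos_star sk kk kC]] ab.
have hk : h * k = k * h by apply: hC; apply/esym/kC.
rewrite -hh -kk (_ : _ * _ = (h * k) * (h * k)); last first.
  by rewrite !mulrA -(mulrA h k h) -hk mulrA.
by apply: npos_sq; rewrite starM sh sk hk.
Qed.

(** The positive product (c - x)(c + x) = c^2 - x^2 has a square root k commuting with [x]; as x^2 +
    k^2 = c^2, [cnorm_parts] applies. *)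
Lemma npos_cnorm_le x c : star x = x -> 0 <= c ->
  npos (sc A c - x) -> npos (sc A c + x) -> cnorm x <= c.
Proof.
move=> sx c0 h1 h2.
have cx := scC c x.
have Px : (sc A c - x) * (sc A c + x) = sc A (c ^+ 2) - x * x.
  by rewrite mulr_commB// expr2 scM.
have xC : (sc A c - x) * (sc A c + x) = (sc A c + x) * (sc A c - x).
  by rewrite mulr_commB// mulr_commD.
have [k [[sk _] kk kC]] := npos_sqrt (npos_comm_mul h1 h2 xC).
apply: (@cnorm_parts _ k) => //; last by rewrite kk Px addrC subrK.
by apply/esym/kC; rewrite Px mulrBl mulrBr scC mulrA.
Qed.

Lemma cnorm_npos x c : star x = x -> cnorm x <= c -> npos (sc A c - x) /\ npos (sc A c + x).
Proof.
move=> sx xc; have c0 : 0 <= c := le_trans (cnorm_ge0 _) xc.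
split; split; rewrite ?starB ?starD ?star_sc ?sx//; exists c => //.
  by rewrite subKr.
by rewrite opprD addrA subrr sub0r cnormN.
Qed.

Lemma npos_antisym a : npos a -> npos (- a) -> a = 0.
Proof.
move=> ap an; apply: cnorm0_eq0; apply/le_anti; rewrite cnorm_ge0 andbT.
by apply: npos_cnorm_le; rewrite ?sc0 ?add0r// npos_star.
Qed.

Lemma npos_closed (u : nat -> A) l : (forall n, npos (u n)) -> cto u l -> npos l.
Proof.
move=> up ul; have [M M0 uM] := cto_bounded ul; split.
  apply: cto_unique (cto_star ul) _; rewrite (_ : (fun _ => _) = u)//.
  by apply/funext => n; rewrite npos_star.
exists M => //; apply: (@cto_le _ _ (fun n => sc A M - u n)).
  by move=> n; have [_] := npos_le (up n) (uM n).
by apply: ctoB ul; exact: cto_cst.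
Qed.

Lemma npos_invertible a e : npos a -> 0 < e -> invertible (a + sc A e).
Proof.
move=> [_ [c c0 ac]] e0; have ce : 0 < c + e by lra.
have -> : a + sc A e = sc A (c + e) * (1 - sc A (c + e)^-1 * (sc A c - a)).
  by rewrite mulrBr mulr1 mulrA scV ?gt_eqF// scD; ncring.
apply: invertibleM; first by apply: invertible_sc; rewrite gt_eqF.
apply: neumann; rewrite cnorm_scM gtr0_norm ?invr_gt0// mulrC ltr_pdivrMr//; lra.
Qed.

(** With a = s^2, w = s^-1 and e = 1 / (|w^2| + 1), the element 1 - e w^2 has a square root k
    commuting with s, and a - e = s (1 - e w^2) s = (k s)^2. *)
Lemma npos_strict a : npos a -> invertible a -> exists2 e, 0 < e & npos (a - sc A e).
Proof.
move=> ap ia; have [s [[ss _] sa _]] := npos_sqrt ap.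
have si := invertible_sqrt sa ia; have [sw ws] := inverseP si.
pose w := inverse s; pose e := (cnorm (w * w) + 1)^-1.
have wg : 0 < cnorm (w * w) + 1 by have := cnorm_ge0 (w * w); lra.
have e0 : 0 < e by rewrite invr_gt0.
have wstar : star w = w by rewrite -inverse_star ?ss.
have [||k [ks kk _ kC]] := @sqrt_1sub (sc A e * (w * w)).
- by rewrite star_scM starM wstar.
- rewrite cnorm_scM gtr0_norm// mulrC ler_pdivrMr//; lra.
have ks' : k * s = s * k.
  apply: kC; rewrite mulrA -!scC -!mulrA; congr (_ * _).
  by rewrite /w ws mulr1 mulrA sw mul1r.
exists e => //; rewrite (_ : _ - _ = (k * s) * (k * s)).
  by apply: npos_sq; rewrite starM ss ks.
rewrite (_ : k * s * (k * s) = k * k * (s * s)); last first.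
  by rewrite !mulrA -(mulrA k s k) -ks' mulrA.
rewrite kk mulrBl mul1r -(mulrA (sc A e)) (_ : w * w * (s * s) = 1) ?mulr1 ?sa//.
by rewrite -sa mulrA -(mulrA w w) ws mulr1 ws.
Qed.

(** Write a - l = b - d with b self-adjoint and d^2 = - s^2, where s is the imaginary part of l. The
    commuting product (b - d)(b + d) = b^2 + s^2 is invertible. *)
Lemma sa_invertible a (l : R[i]) : star a = a -> complex.Im l != 0 -> invertible (a - l%:A).
Proof.
case: l => [r s] /= sa s0; pose b := a - sc A r; pose j : A := ('i%C)%:A.
have jC z : j * z = z * j by rewrite /j -scalerAl mul1r -scalerAr mulr1.
have jj : j * j = - 1 by rewrite /j -scalerAl mul1r scalerA -expr2 sqr_i scaleN1r.
have l2 : (r +i* s)%:A = sc A r + j * sc A s.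
  by rewrite /sc /j -scalerAl mul1r scalerA -scalerDl; congr (_ *: _);
    rewrite [LHS]complexE.
rewrite l2 opprD addrA -/b.
have dC z : j * sc A s * z = z * (j * sc A s).
  by rewrite -mulrA scC mulrA jC mulrA.
set d := j * sc A s in dC *.
have dd : d * d = - sc A (s ^+ 2).
  by rewrite /d mulrA -(mulrA j) scC mulrA jj !mulN1r mulNr expr2 scM.
have bs : (b - d) * (b + d) = b * b + sc A (s ^+ 2).
  by rewrite mulr_commB// dd opprK.
apply: (@comm_invertible _ _ (b + d)); first by rewrite mulr_commB// mulr_commD.
rewrite bs; apply: npos_invertible; last by rewrite exprn_even_gt0.
by apply: npos_sq; rewrite starB star_sc sa.
Qed.

Lemma npos_cpositive a : npos a -> cpositive a.
Proof.
move=> ap; split; first exact: npos_star.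
move=> l nl; apply: contrapT => l0; apply: nl.
have [li|li] := eqVneq (complex.Im l) 0; last exact: sa_invertible (npos_star ap) li.
case: l l0 li => [r s] l0 /= s0; rewrite s0 in l0 *.
rewrite -[_%:A]/(sc A r) -scN; apply: npos_invertible => //.
rewrite oppr_gt0 ltNge; apply/negP => r0; apply: l0.
by rewrite /= lecE /= eqxx.
Qed.

Lemma cpositive_shift a r : cpositive a -> 0 < r -> invertible (a + sc A r).
Proof.
move=> [_ h] r0; apply: contrapT => n.
have : spectrum a (- r)%:C by rewrite /spectrum /= -/(sc A (- r)) scN opprK.
by move/h; rewrite /= ler0c oppr_ge0 leNgt r0.
Qed.

(* The infimum m of {t >= 0 | npos (a + t)} is attained; if m > 0 then a + m is
   invertible, so by [npos_strict] it could be lowered. *)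
Lemma cpositive_npos a : cpositive a -> npos a.
Proof.
move=> ap; have sa := ap.1.
pose T := [set t : R | 0 <= t /\ npos (a + sc A t)].
have T0 : T !=set0.
  exists (cnorm a); split; first exact: cnorm_ge0.
  by have [_] := cnorm_npos sa (lexx _); rewrite addrC.
have lbT : has_lbound T by exists 0 => t [].
have iT : has_inf T by [].
have m0 : 0 <= inf T by apply: lb_le_inf => // t [].
have ma : npos (a + sc A (inf T)).
  apply: (@npos_closed (fun n => a + sc A (inf T + n.+1%:R^-1))).
    move=> n; have n0 : 0 < n.+1%:R^-1 :> R by rewrite invr_gt0.
    have [t [t0 ta] tn] := inf_adherent n0 iT.
    rewrite (_ : a + _ = a + sc A t + sc A (inf T + n.+1%:R^-1 - t)); last first.
      by rewrite -addrA -scD; congr (_ + sc _ _); ring.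
    by apply: nposD => //; apply: npos_sc; rewrite subr_ge0 ltW.
  apply: ctoD; first exact: cto_cst.
  apply: cto_sc; rewrite -[X in _ --> X]addr0.
  by apply: cvgD; [exact: cvg_cst|exact: cvg_harmonic].
move: m0; rewrite le_eqVlt => /orP[/eqP m0|m0]; first by rewrite -m0 sc0 addr0 in ma.
have [e e0 ea] := npos_strict ma (cpositive_shift ap m0).
(* The minimum with [inf T] keeps the lowered value nonnegative. *)
have /(ge_inf lbT) : T (inf T - Order.min e (inf T)).
  split; first by rewrite subr_ge0 ge_min lexx orbT.
  rewrite (_ : a + _ = a + sc A (inf T) - sc A e + sc A (e - Order.min e (inf T))).
    by apply: nposD => //; apply: npos_sc; rewrite subr_ge0 ge_min lexx.
  by rewrite -addrA -!addrA -scN -!scD; congr (_ + sc _ _); ring.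
by rewrite lerBrDr gerDl leNgt lt_min e0 m0.
Qed.

Lemma cpositiveP a : cpositive a <-> npos a.
Proof. by split; [exact: cpositive_npos|exact: npos_cpositive]. Qed.

(** The nonzero points of the spectra of x x* and x* x coincide by [invertible_1subM], and 0 is
    itself nonnegative. *)
Lemma npos_swap x : npos (x * star x) -> npos (star x * x).
Proof.
move=> /npos_cpositive[_ h]; apply: cpositive_npos; split.
  by rewrite starM starK.
move=> l; have [->|l0] := eqVneq l 0; first by rewrite /= lexx.
move=> nl; apply: h => il; apply: nl; move: il.
have lin y : invertible (y - l%:A) <-> invertible (1 - l^-1 *: y).
  have unit_l (c : R[i]) : c != 0 -> invertible (c%:A : A).
    move=> c0; exists (c^-1%:A); rewrite -!scalerAl !mul1r !scalerA.
    by rewrite mulVf// divff// scale1r.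
  split=> [iy|iy].
    rewrite (_ : 1 - _ = (- l^-1)%:A * (y - l%:A)).
      by apply: invertibleM => //; apply: unit_l; rewrite oppr_eq0 invr_eq0.
    rewrite -scalerAl mul1r scalerBr scalerA mulNr mulVf// !scaleNr scale1r opprK.
    by rewrite addrC.
  rewrite (_ : _ - _ = (- l)%:A * (1 - l^-1 *: y)).
    by apply: invertibleM => //; apply: unit_l; rewrite oppr_eq0.
  rewrite -scalerAl mul1r scalerBr scalerA mulNr divff// !scaleNr scale1r opprK.
  by rewrite addrC.
rewrite !lin scalerAr => h'; rewrite scalerAl; exact: invertible_1subM.
Qed.

(** With [s] and [d] self-adjoint, s^2 + d^2 is twice the sum of y y* and y* y, so y y* is a sum of
    positive elements as soon as - y* y is positive. Then [npos_swap] makes y* y positive too, hence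
    0. *)
Lemma npos_starM_neg y : npos (- (star y * y)) -> star y * y = 0.
Proof.
move=> yn; apply: npos_antisym => //; apply: npos_swap.
pose d := 'i%C *: (y - star y); pose s := y + star y.
have sd : star d = d.
  rewrite star_scale starB starK -opprB scalerN -scaleNr; congr (_ *: _).
  by apply/eqP; rewrite eq_complex /= oppr0 opprK !eqxx.
have ss : star s = s by rewrite starD starK addrC.
have dd : d * d = - ((y - star y) * (y - star y)).
  by rewrite -scalerAl -scalerAr scalerA -expr2 sqr_i scaleN1r.
have sd2 : s * s + d * d = (y * star y + star y * y) + (y * star y + star y * y).
  by rewrite dd /s; ncring.
have -> : y * star y = sc A 2^-1 * (s * s + d * d) + - (star y * y).
  by rewrite sd2 mulrDr half_add addrK.
by apply: nposD => //; apply: npos_scM => //; apply: nposD; exact: npos_sq.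
Qed.

(* With p = |x*x| and b = p - x*x, the element y = x b satisfies
   y*y = - (q b)^2 for q = p^(1/2), hence vanishes, and so does b. *)
Lemma npos_starM x : npos (star x * x).
Proof.
set a := star x * x; have sa : star a = a by rewrite starM starK.
have [p [pp pa pC]] := npos_sqrt (npos_sq sa).
have [q [qp qq qC]] := npos_sqrt pp.
have ap : p * a = a * p by apply: pC; rewrite mulrA.
pose b := p - a.
have sb : star b = b by rewrite starB sa npos_star.
have qb : q * b = b * q by apply: qC; rewrite mulrBl mulrBr ap.
have sqb : star (q * b) = q * b by rewrite starM sb npos_star.
have ab : a * b = - (p * b) by rewrite mulrBr mulrBr pa ap; ncring.
have bb : b * b = p * b + p * b by rewrite {1}/b mulrBl ab opprK.
have ybb : star (x * b) * (x * b) = - ((q * b) * (q * b)).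
  have ba : b * a = a * b by rewrite mulrBl mulrBr ap.
  rewrite starM sb !mulrA -(mulrA b) -/a ba ab mulNr; congr (- _).
  by rewrite -(mulrA q b q) -qb mulrA qq.
have qb0 : q * b = 0.
  apply: sq_eq0 => //; apply/eqP; rewrite -oppr_eq0 -ybb; apply/eqP.
  by apply: npos_starM_neg; rewrite ybb opprK; exact: npos_sq.
have b0 : b = 0.
  by apply: sq_eq0 => //; rewrite bb -qq -mulrA qb0 mulr0 addr0.
by rewrite (_ : a = p)//; apply/eqP; rewrite eq_sym -subr_eq0 -/b b0.
Qed.

Lemma npos_Mstar x : npos (x * star x).
Proof. by rewrite -{1}(starK x); exact: npos_starM. Qed.

Lemma npos_conj x a : npos a -> npos (star x * a * x).
Proof.
move=> /npos_sqrt[k [/npos_star sk <- _]].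
by rewrite mulrA -mulrA -{1}sk -starM; exact: npos_starM.
Qed.

Definition cle a b := npos (b - a).

Lemma cle_refl a : cle a a.
Proof. by rewrite /cle subrr; exact: npos0. Qed.

Lemma cle_trans b a z : cle a b -> cle b z -> cle a z.
Proof. by rewrite /cle => ab bc; rewrite -(subrK b z) -addrA; exact: nposD. Qed.

Lemma cle_anti a b : cle a b -> cle b a -> a = b.
Proof.
move=> ab ba; apply/eqP; rewrite -subr_eq0; apply/eqP/npos_antisym => //.
by rewrite opprB.
Qed.

Lemma cleD a b a' b' : cle a b -> cle a' b' -> cle (a + a') (b + b').
Proof. by move=> ab ab'; rewrite /cle opprD addrACA; exact: nposD. Qed.

Lemma cle_scM r a b : 0 <= r -> cle a b -> cle (sc A r * a) (sc A r * b).
Proof. by move=> r0 ab; rewrite /cle -mulrBr; exact: npos_scM. Qed.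

Lemma cle_sc r c : r <= c -> cle (sc A r) (sc A c).
Proof. by move=> rc; rewrite /cle -scB; apply: npos_sc; rewrite subr_ge0. Qed.

Lemma cle_scl r c a : r <= c -> npos a -> cle (sc A r * a) (sc A c * a).
Proof. by move=> rc ap; rewrite /cle -mulrBl -scB; apply: npos_scM; rewrite ?subr_ge0. Qed.

Lemma cle_conj x a b : cle a b -> cle (star x * a * x) (star x * b * x).
Proof. by rewrite /cle -mulrBl -mulrBr; exact: npos_conj. Qed.

Lemma cle_conjr x a b : cle a b -> cle (x * a * star x) (x * b * star x).
Proof. by move=> /(cle_conj (star x)); rewrite starK. Qed.

Lemma cle_npos a b : npos a -> cle a b -> npos b.
Proof. by move=> ap ab; rewrite -(subrK a b); exact: nposD. Qed.

Lemma cle_closed (u v : nat -> A) l m : (forall n, cle (u n) (v n)) ->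
  cto u l -> cto v m -> cle l m.
Proof. by move=> uv ul vm; apply: (npos_closed uv); exact: ctoB. Qed.

Lemma cle_sc_inj r c : cle (sc A r) (sc A c) -> r <= c.
Proof.
rewrite /cle -scB => p; rewrite leNgt; apply/negP => cr.
have : sc A (c - r) = 0.
  by apply: npos_antisym => //; rewrite -scN opprB; apply: npos_sc; rewrite subr_ge0 ltW.
by rewrite -(sc0 A) => /sc_inj; lra.
Qed.

Lemma cnorm_le_starM x r : 0 <= r -> cnorm x <= r <-> cle (star x * x) (sc A (r ^+ 2)).
Proof.
move=> r0; have sx : star (star x * x) = star x * x by rewrite starM starK.
rewrite -(@ler_pXn2r _ 2)// ?nnegrE ?cnorm_ge0// -cnorm_starM; split=> [h|h].
  by have [] := cnorm_npos sx h.
apply: npos_cnorm_le => //; first exact: exprn_ge0.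
by apply: nposD; [apply: npos_sc; exact: exprn_ge0|exact: npos_starM].
Qed.

Lemma npos_cnorm a r : npos a -> 0 <= r -> cnorm a <= r <-> cle a (sc A r).
Proof.
move=> ap r0; split=> h; first by have [] := cnorm_npos (npos_star ap) h.
by apply: npos_cnorm_le => //; [exact: npos_star|apply: nposD => //; exact: npos_sc].
Qed.

Definition ppos a := npos a /\ invertible a.

Lemma ppos_strict a : ppos a <-> exists2 e, 0 < e & cle (sc A e) a.
Proof.
split=> [[ap ia]|[e e0 ea]]; first exact: npos_strict.
have ip := npos_invertible ea e0; rewrite subrK in ip; split=> //.
by apply: cle_npos ea; apply: npos_sc; exact: ltW.
Qed.

Lemma npos_inverse a : ppos a -> npos (inverse a).
Proof.
move=> [ap ia]; have [xi ix] := inverseP ia.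
have := npos_conj (inverse a) ap; rewrite -inverse_star// (npos_star ap) ix mul1r.
by [].
Qed.

Lemma ppos_conj x a : invertible x -> ppos a -> ppos (star x * a * x).
Proof.
move=> ix [ap ia]; split; first exact: npos_conj.
by do 2!apply: invertibleM => //; exact: invertible_star.
Qed.

Lemma ppos_sqrt a : ppos a -> exists k, [/\ ppos k, k * k = a
  & forall z, a * z = z * a -> k * z = z * k].
Proof.
move=> [/npos_sqrt[k [kp ka kC]] ia]; exists k; split=> //; split=> //.
exact: invertible_sqrt ka ia.
Qed.

(** Two roots are not known to commute with each other, but each commutes with the root [y] supplied
    by [ppos_sqrt]. Then (y + z)(y - z) = 0 with y + z strictly positive. *)
Lemma ppos_sqrt_unique h k : ppos h -> ppos k -> h * h = k * k -> h = k.
Proof.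
move=> hp kp hk.
have [y [yp yy yC]] : exists y, [/\ ppos y, y * y = h * h
  & forall z, h * h * z = z * (h * h) -> y * z = z * y].
  by apply: ppos_sqrt; have := ppos_conj hp.2 (conj npos1 (invertible1 A));
    rewrite mulr1 npos_star//; exact: hp.1.
suff main z : ppos z -> z * z = h * h -> z = y by rewrite (main h)// (main k).
move=> zp zz; have yz : y * z = z * y by apply: yC; rewrite -zz mulrA.
have iyz : invertible (y + z).
  have /ppos_strict[e e0 ey] := yp; have /ppos_strict[d d0 dz] := zp.
  suff [] : ppos (y + z) by [].
  by apply/ppos_strict; exists (e + d); [lra|rewrite scD; exact: cleD].
apply/eqP; rewrite -subr_eq0; apply/eqP; apply: (@invertible_mulrI _ _ _ (y + z)) => //.
by rewrite mulr0 mulrBr !mulrDl yz yy zz; ncring.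
Qed.

(* The elements a and z are similar, hence have the same spectrum. *)
Lemma cle1_similar a g h z : star a = a -> g * h = 1 -> h * g = 1 ->
  a = g * z * h -> cnorm z <= 1 -> cle a 1.
Proof.
move=> sa gh hg azg z1; apply: cpositive_npos; split; first by rewrite starB star1 sa.
move=> l nl; apply: contrapT => l0; apply: nl.
have [li|li] := eqVneq (complex.Im l) 0; last first.
  by apply: sa_invertible => //; rewrite starB star1 sa.
case: l l0 li => [r s] l0 /= s0; rewrite s0 in l0 *.
rewrite -[_%:A]/(sc A r).
have r0 : r < 0 by rewrite ltNge; apply/negP => r0; apply: l0; rewrite /= lecE /= eqxx.
have r1 : 1 - r != 0 by rewrite gt_eqF//; lra.
(* Since r < 0, the number 1 - r exceeds the norm of [z], so 1 - r - z is invertible by the Neumann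
   series. *)
have -> : 1 - a - sc A r = g * (sc A (1 - r) * (1 - sc A (1 - r)^-1 * z)) * h.
  rewrite mulrBr mulr1 (mulrA (sc A _)) scV//.
  by rewrite mul1r mulrBr mulrBl -azg -(scC (1 - r) g) -mulrA gh mulr1 scB sc1 addrAC.
apply: invertible_conj => //; apply: invertibleM.
  exact: invertible_sc.
apply: neumann; have r2 : 0 < 1 - r by lra.
rewrite cnorm_scM gtr0_norm ?invr_gt0// mulrC ltr_pdivrMr//; lra.
Qed.

End Positivity.

(** * Exponential, logarithm and real powers *)

Section CauchyProduct.
Variable T : pzRingType.
Implicit Types f g : nat -> T.

Lemma cauchy_triangle f g n :
  \sum_(k < n) \sum_(j < k.+1) f (k - j)%N * g j =
  \sum_(j < n) \sum_(0 <= i < n - j) f i * g j.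
Proof.
elim: n => [|n IH]; first by rewrite !big_ord0.
rewrite big_ord_recr/= IH [RHS]big_ord_recr/= subSnn big_nat1.
rewrite [X in _ + X]big_ord_recr/= subnn addrA -big_split/=; congr (_ + _).
by apply: eq_bigr => j _; rewrite subSn 1?ltnW// big_nat_recr.
Qed.

(** The terms with i + j >= n: inside the square of the product of partial sums, outside the
    triangle of the Cauchy product. In this form the tail is bounded termwise by the same tail of
    real series. *)
Definition cauchy_tail f g n : T := \sum_(j < n) \sum_(n - j <= i < n) f i * g j.

Lemma cauchy_tailE f g n :
  (\sum_(i < n) f i) * (\sum_(j < n) g j)
    - \sum_(k < n) \sum_(j < k.+1) f (k - j)%N * g j = cauchy_tail f g n.
Proof.
apply/eqP; rewrite cauchy_triangle subr_eq /cauchy_tail -big_split/= mulr_sumr; apply/eqP.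
apply: eq_bigr => j _; rewrite addrC -big_cat_nat ?leq_subr//= mulr_suml.
by rewrite big_mkord.
Qed.

End CauchyProduct.

Section Exponential.
Variables (R : realType) (A : cstarAlgType R).
Implicit Types (x y z : A) (r s t : R).

Definition ecoef x k : A := sc A k`!%:R^-1 * x ^+ k.

(** Same shape as [is_mxexp]; [clog] and [cpow] likewise follow [mxlog] and [mxpow]. At [matrix2 A]
    each becomes its matrix counterpart by conversion. *)
Definition is_cexp x y :=
  cnorm (\sum_(k < n) (k`!%:R^-1 : R[i]) *: x ^+ k - y) @[n --> \oo] --> (0 : R).

Definition cexp x : A := xget 0 [set y | is_cexp x y].

Lemma is_cexpE x y : is_cexp x y <-> cto (fun n => \sum_(k < n) ecoef x k) y.
Proof.
rewrite /is_cexp /cto (_ : (fun n => cnorm (\sum_(k < n) ecoef x k - y)) = 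
  (fun n => cnorm (\sum_(k < n) (k`!%:R^-1 : R[i]) *: x ^+ k - y)))//.
apply/funext => n; congr (cnorm (_ - _)); apply: eq_bigr => k _.
by rewrite /ecoef -scE fmorphV rmorph_nat.
Qed.

Lemma rexp_sum_cvg r : \sum_(k < n) exp_coeff r k @[n --> \oo] --> expR r.
Proof.
rewrite (_ : (fun _ => _) = series (exp_coeff r)).
  exact: is_cvg_series_exp_coeff.
by apply/funext => n; rewrite /series/= big_mkord.
Qed.

Lemma rexp_sum_le r n : 0 <= r -> \sum_(k < n) exp_coeff r k <= expR r.
Proof.
move=> r0; rewrite -(big_mkord xpredT (exp_coeff r)).
apply: (nondecreasing_cvgn_le _ (is_cvg_series_exp_coeff r)).
by apply: nondecreasing_series => k _ _; exact: exp_coeff_ge0.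
Qed.

Lemma cnorm_ecoef x r k : cnorm x <= r -> cnorm (ecoef x k) <= exp_coeff r k.
Proof.
move=> xr; rewrite /ecoef cnorm_scM ger0_norm ?invr_ge0 ?ler0n// /exp_coeff/= mulrC.
rewrite ler_wpM2r ?invr_ge0 ?ler0n// (le_trans (cnormX _ _))//.
by rewrite lerXn2r// ?nnegrE ?cnorm_ge0// (le_trans (cnorm_ge0 x)).
Qed.

Lemma ex_cexp x r : cnorm x <= r ->
  exists l, cto (fun n => \sum_(k < n) ecoef x k) l /\
    forall n, cnorm (l - \sum_(k < n) ecoef x k) <= expR r - \sum_(k < n) exp_coeff r k.
Proof.
move=> xr; apply: dominated_cto => n; last first.
  by apply: rexp_sum_le; rewrite (le_trans (cnorm_ge0 x)).
by rewrite !big_ord_recr/= ![_ + _ - _]addrAC !subrr !add0r; exact: cnorm_ecoef.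
Qed.

Lemma cexpP x : cto (fun n => \sum_(k < n) ecoef x k) (cexp x).
Proof.
apply/is_cexpE; rewrite /cexp; case: xgetP => [y -> //|/=].
have [l [xl _]] := ex_cexp (lexx (cnorm x)).
by move/(_ l); case; apply/is_cexpE.
Qed.

Lemma is_cexp_unique x y : is_cexp x y <-> cexp x = y.
Proof.
split=> [/is_cexpE h|<-]; last by apply/is_cexpE; exact: cexpP.
exact: cto_unique (cexpP x) h.
Qed.

Lemma cexp_tail x r n : cnorm x <= r ->
  cnorm (cexp x - \sum_(k < n) ecoef x k) <= expR r - \sum_(k < n) exp_coeff r k.
Proof.
by move=> /ex_cexp[l [xl h]]; rewrite (cto_unique (cexpP x) xl).
Qed.

Lemma cnorm_cexp x r : cnorm x <= r -> cnorm (cexp x) <= expR r.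
Proof. by move=> /(cexp_tail 0); rewrite !big_ord0 !subr0. Qed.

Lemma cnorm_cexp_sub1 x r : cnorm x <= r -> cnorm (cexp x - 1) <= r * expR r.
Proof.
move=> xr; have r0 := le_trans (cnorm_ge0 x) xr.
have := cexp_tail 1 xr; rewrite !big_ord_recr !big_ord0/= !add0r.
rewrite /ecoef/= fact0 /exp_coeff/= expr0 fact0 !divr1 mulr1 invr1 sc1 => /le_trans; apply.
(* Multiplying 1 - r <= exp(- r) by exp r gives exp r - 1 <= r exp r. *)
have := expR_ge1Dx (- r); have := expRxMexpNx_1 r; have := expR_gt0 r; nra.
Qed.

Lemma cnorm_cexp_sub2 x r : cnorm x <= r -> cnorm (cexp x - 1 - x) <= r ^+ 2 * expR r.
Proof.
move=> xr; have r0 := le_trans (cnorm_ge0 x) xr.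
have := cexp_tail 2 xr; rewrite !big_ord_recr !big_ord0/= !add0r.
rewrite /ecoef/= !fact0 !factS fact0 /exp_coeff/= expr0 !factS fact0 !muln1.
rewrite !divr1 !expr1 mulr1 invr1 sc1 mul1r opprD addrA => /le_trans; apply.
have h : expR r - 1 <= r * expR r.
  have := expR_ge1Dx (- r); have := expRxMexpNx_1 r; have := expR_gt0 r; nra.
rewrite expr2; nra.
Qed.

Lemma cexp0 : cexp 0 = 1.
Proof.
have : cnorm (0 : A) <= 0 by rewrite cnorm0.
move=> /cnorm_cexp_sub1; rewrite mul0r => h; apply/eqP; rewrite -subr_eq0; apply/eqP.
by apply/cnorm0_eq0/le_anti; rewrite h cnorm_ge0.
Qed.

Lemma sc_nat n x : sc A n%:R * x = x *+ n.
Proof. by rewrite -[RHS]mulr_natl; congr (_ * _); rewrite /sc rmorph_nat scaler_nat. Qed.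

Lemma ecoefD x y k : x * y = y * x ->
  ecoef (x + y) k = \sum_(j < k.+1) ecoef x (k - j)%N * ecoef y j.
Proof.
move=> xy; rewrite /ecoef exprDn_comm// mulr_sumr; apply: eq_bigr => j _.
rewrite scMM -sc_nat mulrA -scM; congr (sc _ _ * _).
have jk : (j <= k)%N by rewrite -ltnS.
rewrite -(bin_fact jk) !natrM.
have := ltn_ord j => _; have b0 : ('C(k, j)%:R : R) != 0 by rewrite pnatr_eq0 -lt0n bin_gt0.
have f1 : (j`!%:R : R) != 0 by rewrite pnatr_eq0 -lt0n fact_gt0.
have f2 : ((k - j)`!%:R : R) != 0 by rewrite pnatr_eq0 -lt0n fact_gt0.
by field; rewrite b0 f1 f2.
Qed.

Lemma exp_coeffD r s k :
  exp_coeff (r + s) k = \sum_(j < k.+1) exp_coeff r (k - j)%N * exp_coeff s j.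
Proof.
rewrite /exp_coeff/= exprDn mulr_suml; apply: eq_bigr => j _.
have jk : (j <= k)%N by rewrite -ltnS.
rewrite -mulr_natr -(bin_fact jk) !natrM.
have b0 : ('C(k, j)%:R : R) != 0 by rewrite pnatr_eq0 -lt0n bin_gt0.
have f1 : (j`!%:R : R) != 0 by rewrite pnatr_eq0 -lt0n fact_gt0.
have f2 : ((k - j)`!%:R : R) != 0 by rewrite pnatr_eq0 -lt0n fact_gt0.
by field; rewrite b0 f1 f2.
Qed.

(** The product of the partial sums minus the partial sum for x + y is a Cauchy tail, dominated by
    the tail of the real series for |x| and |y|; the latter tends to 0 because the real exponential
    is multiplicative. *)
Lemma cexpD x y : x * y = y * x -> cexp (x + y) = cexp x * cexp y.
Proof.
move=> xy; pose S z n := \sum_(k < n) ecoef z k.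
pose s r n := \sum_(k < n) exp_coeff r k.
have h : cto (fun n => S x n * S y n - S (x + y) n) 0.
  pose r := cnorm x; pose r' := cnorm y.
  apply: (@cto_squeeze _ _ _ _ (fun n => s r n * s r' n - s (r + r') n)).
    move=> n; rewrite subr0 /S /s.
    have -> : \sum_(k < n) ecoef (x + y) k =
        \sum_(k < n) \sum_(j < k.+1) ecoef x (k - j)%N * ecoef y j.
      by apply: eq_bigr => k _; exact: ecoefD.
    have -> : \sum_(k < n) exp_coeff (r + r') k =
        \sum_(k < n) \sum_(j < k.+1) exp_coeff r (k - j)%N * exp_coeff r' j.
      by apply: eq_bigr => k _; exact: exp_coeffD.
    rewrite !cauchy_tailE /cauchy_tail (le_trans (cnorm_sum _ _ _))// ler_sum// => j _.
    rewrite (le_trans (cnorm_sum _ _ _))// ler_sum// => i _.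
    by rewrite (le_trans (cnormM _ _))// ler_pM ?cnorm_ge0// cnorm_ecoef.
  rewrite -(subrr (expR (r + r'))) {1}expRD.
  by apply: cvgB; [apply: cvgM|]; exact: rexp_sum_cvg.
apply/esym/eqP; rewrite -subr_eq0; apply/eqP; apply: cto_unique h.
by apply: ctoB; [apply: ctoM|]; exact: cexpP.
Qed.

Lemma cexp_sc r : cexp (sc A r) = sc A (expR r).
Proof.
apply: cto_unique (cexpP _) _.
rewrite (_ : (fun _ => _) = fun n => sc A (\sum_(k < n) exp_coeff r k)).
  exact/cto_sc/rexp_sum_cvg.
apply/funext => n; elim: n => [|n IH]; first by rewrite !big_ord0 sc0.
rewrite !big_ord_recr/= IH scD; congr (_ + _).
by rewrite /ecoef /exp_coeff/= -scX -scM mulrC.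
Qed.

Lemma cexpMN x : cexp x * cexp (- x) = 1.
Proof. by rewrite -cexpD ?subrr ?cexp0// mulrN mulNr. Qed.

Lemma cexpNM x : cexp (- x) * cexp x = 1.
Proof. by rewrite -cexpD ?addNr ?cexp0// mulrN mulNr. Qed.

Lemma invertible_cexp x : invertible (cexp x).
Proof. by exists (cexp (- x)); rewrite cexpMN cexpNM. Qed.

Lemma cexp_shift x r : cexp (x + sc A r) = sc A (expR r) * cexp x.
Proof. by rewrite addrC cexpD ?cexp_sc// scC. Qed.

Lemma cexp_scD x r s : cexp (sc A (r + s) * x) = cexp (sc A r * x) * cexp (sc A s * x).
Proof. by rewrite scD mulrDl cexpD// !scMM mulrC. Qed.

Lemma cexp_scN x r : cexp (sc A (- r) * x) = cexp (- (sc A r * x)).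
Proof. by rewrite scN mulNr. Qed.

Lemma cexp_half x : cexp (sc A 2^-1 * x) * cexp (sc A 2^-1 * x) = cexp x.
Proof. by rewrite -cexp_scD (_ : 2^-1 + _ = 1) ?sc1 ?mul1r//; lra. Qed.

Lemma cexp_star x : cexp (star x) = star (cexp x).
Proof.
apply: cto_unique (cexpP _) _.
rewrite (_ : (fun _ => _) = fun n => star (\sum_(k < n) ecoef x k)).
  exact/cto_star/cexpP.
apply/funext => n; rewrite star_sum; apply: eq_bigr => k _.
by rewrite /ecoef star_scM starX.
Qed.

Lemma cexp_conj g h x : g * h = 1 -> h * g = 1 -> cexp (g * x * h) = g * cexp x * h.
Proof.
move=> gh hg; apply: cto_unique (cexpP _) _.
rewrite (_ : (fun _ => _) = fun n => g * (\sum_(k < n) ecoef x k) * h).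
  by apply: ctoM (cto_cst h); exact/ctoMl/cexpP.
apply/funext => n; rewrite mulr_sumr mulr_suml; apply: eq_bigr => k _.
rewrite /ecoef mulrA -scC -!mulrA; congr (_ * _); rewrite mulrA.
elim: (nat_of_ord k) => [|m IH]; first by rewrite !expr0 mul1r gh.
by rewrite exprS IH exprS !mulrA -(mulrA _ h) hg mulr1.
Qed.

Lemma cexp_sa x : star x = x -> star (cexp x) = cexp x.
Proof. by rewrite -cexp_star => ->. Qed.

Lemma ppos_cexp x : star x = x -> ppos (cexp x).
Proof.
move=> sx; split; last exact: invertible_cexp.
by rewrite -cexp_half; apply: npos_sq; apply: cexp_sa; rewrite star_scM sx.
Qed.

(** This is (exp(h x) - 1) / h for h = 2^-n. Along this sequence exp(h x) is an iterated square root
    of exp x, so properties of exp x that square roots preserve pass to x. *)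
Lemma cexp_quotient x : cto (fun n => sc A (2 ^+ n) * (cexp (sc A (2 ^- n) * x) - 1)) x.
Proof.
pose r := cnorm x.
apply: (@cto_squeeze _ _ _ _ (fun n => (r ^+ 2 * expR r) * (2^-1) ^+ n)) => [n|].
  have p0 : 0 < 2 ^+ n :> R by rewrite exprn_gt0.
  have nx : cnorm (sc A (2 ^- n) * x) <= 2 ^- n * r.
    by rewrite cnorm_scM gtr0_norm ?invr_gt0.
  rewrite (_ : _ - x = sc A (2 ^+ n) *
     (cexp (sc A (2 ^- n) * x) - 1 - sc A (2 ^- n) * x)); last first.
    by rewrite [in RHS]mulrBr (mulrA (sc A (2 ^+ n)) (sc A _)) scV ?mul1r// gt_eqF.
  rewrite cnorm_scM gtr0_norm//.
  rewrite (le_trans (ler_wpM2l (ltW p0) (cnorm_cexp_sub2 nx)))//.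
  rewrite exprVn exprMn expr2 -!mulrA mulVKf ?gt_eqF// mulrC -!mulrA.
  do 2!rewrite ler_wpM2l ?cnorm_ge0//.
  rewrite ler_pM2r ?invr_gt0// ler_expR ler_piMl ?cnorm_ge0// invf_le1// exprn_ege1//; lra.
rewrite -[X in _ --> X](mulr0 (r ^+ 2 * expR r)); apply: cvgM; first exact: cvg_cst.
by apply: cvg_expr; rewrite ger0_norm//; lra.
Qed.

(** Left to right, the norm shows that positive square roots of an element below 1 stay below 1, and
    the quotients of [cexp_quotient] converge to x. Conversely exp(- x) >= 1 because the further
    terms of its series are positive, and conjugation by exp(x / 2) turns this into exp x <= 1. *)
Lemma cle_cexp1 x : star x = x -> cle (cexp x) 1 <-> cle x 0.
Proof.
move=> sx; split=> [x1|x0].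
  have xn n : cle (cexp (sc A (2 ^- n) * x)) 1.
    elim: n => [|n IH]; first by rewrite expr0 invr1 sc1 mul1r.
    set y := sc A _ * x; have sy : star y = y by rewrite star_scM sx.
    have yy : cexp y * cexp y = cexp (sc A (2 ^- n) * x).
      rewrite /y -cexp_scD exprS invfM; congr (cexp (sc A _ * x)); lra.
    rewrite -(sc1 A); apply/npos_cnorm => //; first by case: (ppos_cexp sy).
    rewrite -(@ler_pXn2r _ 2)// ?nnegrE ?cnorm_ge0// -cnorm_sq ?cexp_sa// yy expr1n.
    apply/npos_cnorm; rewrite ?sc1//.
    by rewrite -yy; apply: npos_sq; exact: cexp_sa.
  rewrite /cle sub0r; apply: (npos_closed _ (ctoN (cexp_quotient x))) => n /=.
  by rewrite -mulrN opprB; apply: npos_scM => //; exact: xn.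
pose w := - x; have wp : npos w by rewrite /w -sub0r.
have sw : star w = w by exact: npos_star.
have wX k : npos (w ^+ k).
  elim: k => [|k IH]; first exact: npos1.
  by rewrite exprS; apply: npos_comm_mul => //; rewrite -exprS exprSr.
have : cle 1 (cexp w).
  apply: (cle_closed _ (cto_cst 1) (cto_shift (cexpP w))) => n.
  rewrite /cle big_ord_recl /ecoef/= fact0 invr1 sc1 mul1r addrC addKr.
  elim/big_ind : _ => [|a b|k _]; [exact: npos0|exact: nposD|].
  by apply: npos_scM => //; rewrite invr_ge0.
move=> /(cle_conj (cexp (sc A 2^-1 * x))).
rewrite cexp_sa ?star_scM ?sx// mulr1 cexp_half.
have -> : sc A 2^-1 * x = - (sc A 2^-1 * w) by rewrite /w mulrN opprK.
by rewrite -[cexp w]cexp_half -!mulrA cexpMN mulr1 cexpNM.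
Qed.

Lemma cle_cexp x r : star x = x -> cle (cexp x) (sc A (expR r)) <-> cle x (sc A r).
Proof.
move=> sx; have sxr : star (x - sc A r) = x - sc A r by rewrite starB star_sc sx.
have e1 : sc A (expR r) * cexp (x - sc A r) = cexp x.
  by rewrite -cexp_shift subrK.
have e2 : sc A (expR (- r)) * cexp x = cexp (x - sc A r).
  by rewrite -cexp_shift scN.
have := cle_cexp1 sxr; split=> [h|h].
  have : cle (x - sc A r) 0.
    apply/H; rewrite -e2; have := cle_scM (expR_ge0 (- r)) h.
    by rewrite -scM mulrC expRxMexpNx_1 sc1.
  by rewrite /cle sub0r opprB.
rewrite -e1 -[X in cle _ X]mulr1; apply: cle_scM; first exact: expR_ge0.
by apply/H; rewrite /cle sub0r opprB.
Qed.

Lemma cnorm_le_cexp x r : star x = x -> 0 <= r ->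
  cnorm x <= r <-> cle (cexp x) (sc A (expR r)) /\ cle (cexp (- x)) (sc A (expR r)).
Proof.
move=> sx r0; rewrite !cle_cexp ?starN ?sx//; split=> [h|[h1 h2]].
  by have [h1 h2] := cnorm_npos sx h; split; rewrite /cle ?opprK.
by apply: npos_cnorm_le => //; move: h2; rewrite /cle opprK.
Qed.

(** Positive square roots are unique, so exp(2^-n x) and exp(2^-n y) agree for all n, and
    [cexp_quotient] recovers the exponents. *)
Lemma cexp_inj x y : star x = x -> star y = y -> cexp x = cexp y -> x = y.
Proof.
move=> sx sy xy; apply: cto_unique (cexp_quotient x) _.
rewrite (_ : (fun _ => _) = fun n => sc A (2 ^+ n) * (cexp (sc A (2 ^- n) * y) - 1)).
  exact: cexp_quotient.
apply/funext => n; congr (_ * (_ - _)).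
elim: n => [|n IH]; first by rewrite expr0 invr1 sc1 !mul1r.
apply: ppos_sqrt_unique; [by apply: ppos_cexp; rewrite star_scM ?sx ?sy..|].
have h (z : A) : cexp (sc A (2 ^- n.+1) * z) * cexp (sc A (2 ^- n.+1) * z) =
    cexp (sc A (2 ^- n) * z).
  by rewrite -cexp_scD exprS invfM; congr (cexp (sc A _ * z)); lra.
by rewrite !h.
Qed.

End Exponential.

Section Logarithm.
Variables (R : realType) (A : cstarAlgType R).
Implicit Types (x y z : A) (r s t : R).

(** Telescoping without commutation. It is applied with m = 2^n and r = exp(2^-n B), where r^m stays
    equal to exp B. *)
Lemma cnorm_subX x y r m : cnorm x <= r -> cnorm y <= r -> 1 <= r ->
  cnorm (x ^+ m - y ^+ m) <= m%:R * r ^+ m * cnorm (x - y).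
Proof.
move=> xr yr r1; have r0 : 0 <= r by lra.
elim: m => [|m IH]; first by rewrite !expr0 subrr cnorm0 !mul0r.
rewrite (_ : _ - _ = x * (x ^+ m - y ^+ m) + (x - y) * y ^+ m); last first.
  by rewrite !exprS; ncring.
rewrite (le_trans (cnormD _ _))//.
have h1 : cnorm (x * (x ^+ m - y ^+ m)) <= r * (m%:R * r ^+ m * cnorm (x - y)).
  by rewrite (le_trans (cnormM _ _))// ler_pM ?cnorm_ge0.
have h2 : cnorm ((x - y) * y ^+ m) <= cnorm (x - y) * r ^+ m.
  rewrite (le_trans (cnormM _ _))// ler_wpM2l ?cnorm_ge0//.
  by rewrite (le_trans (cnormX _ _))// lerXn2r ?nnegrE ?cnorm_ge0.
have h3 : cnorm (x - y) * r ^+ m <= cnorm (x - y) * r ^+ m.+1.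
  by rewrite ler_wpM2l ?cnorm_ge0// exprS ler_peMl ?exprn_ge0.
rewrite -natr1 exprS in h3 *; lra.
Qed.

(** x - 1 = (x^2 - 1)(x + 1)^-1 is a product of commuting positive elements. *)
Lemma cle1_sqrt x : npos x -> cle 1 (x * x) -> cle 1 x.
Proof.
move=> xp x1; have i1 : invertible (x + 1) by rewrite -(sc1 A); exact: npos_invertible.
have p1 : ppos (x + 1) by split=> //; apply: nposD => //; exact: npos1.
have [yi iy] := inverseP i1.
have -> : x = 1 + (x - 1) by rewrite addrC subrK.
rewrite /cle addrC addKr.
have -> : x - 1 = (x * x - 1) * inverse (x + 1).
  by rewrite -[in RHS](mulr1 1) -mulr_commB ?mulr1 ?mul1r// -mulrA yi mulr1.
apply: npos_comm_mul => //; first exact: npos_inverse.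
by apply/esym/comm_inverse => //; rewrite mulrDl mulrBr mulrDr mulrBl !mulrDr; ncring.
Qed.

(* For y >= 1 with iterated square roots y_n, the decreasing sequence
   2^n (y_n - 1) converges to the logarithm. *)
Lemma ex_log_ge1 y : cle 1 y -> exists2 x, star x = x & cexp x = y.
Proof.
move=> y1.
have root z : cle 1 z -> {w | cle 1 w & w * w = z}.
  move=> z1; have /npos_sqrt/cid[w [wp wz _]] := cle_npos (npos1 A) z1.
  by exists w => //; apply: cle1_sqrt; rewrite ?wz.
pose M := fix M n : {z : A | cle 1 z} :=
  if n is m.+1 then
    let: exist2 w w1 _ := root (sval (M m)) (svalP (M m)) in exist _ w w1
  else exist _ y y1.
pose m n := sval (M n).
have m1 n : cle 1 (m n) := svalP (M n).
have mS n : m n.+1 * m n.+1 = m n.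
  by rewrite /m /=; case: (root _ _) => w w1 ww.
have mX n : m n ^+ (2 ^ n) = y.
  elim: n => [|n IH]; first by rewrite expn0 expr1.
  by rewrite expnS exprM expr2 mS.
clearbody m => {M}.
pose Y n := sc A (2 ^+ n) * (m n - 1).
have two0 n : 0 < 2 ^+ n :> R by rewrite exprn_gt0.
have mY n : m n = 1 + sc A (2 ^- n) * Y n.
  by rewrite /Y mulrA [sc _ _ * sc _ _]scC scV ?gt_eqF// mul1r addrC subrK.
have Yp n : npos (Y n) by apply: npos_scM; [exact: ltW|exact: m1].
(* From m_n - 1 = (m_(n+1) - 1)^2 + 2 (m_(n+1) - 1); in particular [Y] decreases. *)
have YS n : Y n - Y n.+1 = sc A (2 ^- n.+2) * (Y n.+1 * Y n.+1).
  rewrite /Y -mS scMM mulrA -scM.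
  have -> : (m n.+1 * m n.+1 - 1) = (m n.+1 - 1) * (m n.+1 - 1) + sc A 2 * (m n.+1 - 1).
    by rewrite sc2; ncring.
  rewrite mulrDr (mulrA _ (sc A 2)) -scM -exprSr addrK; congr (sc A _ * _).
  by rewrite !exprS; field; rewrite gt_eqF.
pose B := cnorm (Y 0%N).
have YB n : cnorm (Y n) <= B.
  apply/npos_cnorm => //; first exact: cnorm_ge0.
  elim: n => [|n IH]; first by have [] := cnorm_npos (npos_star (Yp 0%N)) (lexx _).
  apply: cle_trans IH; rewrite /cle YS; apply: npos_scM; first by rewrite invr_ge0 ltW.
  by apply: npos_sq; exact: npos_star.
have B0 : 0 <= B := cnorm_ge0 _.
(* The increments of the dominating sequence are 2^-(n+2) B^2, the bound that [YS] gives for those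
   of [Y]. *)
have [n|n|x [Yx _]] := @dominated_cto _ _ Y (fun n => - (B ^+ 2 / 2 ^+ n.+1)) 0.
- rewrite cnorm_distC YS cnorm_scM gtr0_norm ?invr_gt0//.
  rewrite (_ : - _ - - _ = 2 ^- n.+2 * B ^+ 2); last first.
    by rewrite !exprS; field; rewrite gt_eqF.
  rewrite ler_pM2l ?invr_gt0// cnorm_sq; last exact: npos_star.
  by rewrite lerXn2r ?nnegrE ?cnorm_ge0.
- by rewrite oppr_le0 divr_ge0 ?exprn_ge0// ltW.
have sx : star x = x := npos_star (npos_closed Yp Yx).
exists x => //; have xB : cnorm x <= B := cto_le YB Yx.
have xn n : cexp (sc A (2 ^- n) * x) ^+ (2 ^ n) = cexp x.
  elim: n => [|n IH]; first by rewrite expn0 expr0 invr1 sc1 mul1r expr1.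
  rewrite expnS exprM expr2 -cexp_scD -IH; congr (cexp (sc A _ * x) ^+ _).
  by rewrite exprS invfM; lra.
apply/eqP; rewrite -subr_eq0; apply/eqP.
apply: (@cto_unique _ _ (fun=> cexp x - y)); first exact: cto_cst.
(* [e n] bounds 2^n |exp(2^-n x) - m_n|; both elements have norm at most exp(2^-n B), and their
   2^n-th powers are exp x and y. *)
pose e n := cnorm (Y n - x) + B ^+ 2 * expR B * 2^-1 ^+ n.
apply: (@cto_squeeze _ _ _ _ (fun n => expR B * e n)) => [n|]; last first.
  rewrite -[X in _ --> X](mulr0 (expR B)); apply: cvgM; first exact: cvg_cst.
  rewrite -[X in _ --> X](addr0 0); apply: cvgD; first exact: Yx.
  rewrite -[X in _ --> X](mulr0 (B ^+ 2 * expR B)); apply: cvgM; first exact: cvg_cst.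
  by apply: cvg_expr; rewrite ger0_norm//; lra.
rewrite subr0 -(xn n) -(mX n).
have nx : cnorm (sc A (2 ^- n) * x) <= 2 ^- n * B.
  by rewrite cnorm_scM gtr0_norm ?invr_gt0// ler_pM2l ?invr_gt0.
have r1 : 1 <= expR (2 ^- n * B) by rewrite (le_trans _ (expR_ge1Dx _))// lerDl mulr_ge0// invr_ge0 ltW.
have h1 := cnorm_cexp nx.
have h2 : cnorm (m n) <= expR (2 ^- n * B).
  apply: le_trans (expR_ge1Dx _); rewrite mY (le_trans (cnormD _ _))// cnorm1 lerD2l.
  by rewrite cnorm_scM gtr0_norm ?invr_gt0// ler_pM2l ?invr_gt0.
rewrite (le_trans (cnorm_subX _ h1 h2 r1))//.
have -> : expR (2 ^- n * B) ^+ (2 ^ n) = expR B.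
  by rewrite -expRM_natl natrX mulrA divff ?mul1r// gt_eqF.
have h3 : cnorm (cexp (sc A (2 ^- n) * x) - m n) <=
    2 ^- n * cnorm (Y n - x) + (2 ^- n * B) ^+ 2 * expR B.
  rewrite mY (_ : _ - _ = (cexp (sc A (2 ^- n) * x) - 1 - sc A (2 ^- n) * x)
      - sc A (2 ^- n) * (Y n - x)); last by rewrite mulrBr; ncring.
  rewrite (le_trans (cnormB _ _))// addrC cnorm_scM gtr0_norm ?invr_gt0// lerD2l.
  rewrite (le_trans (cnorm_cexp_sub2 nx))// ler_wpM2l ?sqr_ge0//.
  rewrite ler_expR ler_piMl// invf_le1// exprn_ege1//; lra.
rewrite -mulrA mulrCA ler_wpM2l ?expR_ge0//.
have -> : e n = 2 ^+ n * (2 ^- n * cnorm (Y n - x) + (2 ^- n * B) ^+ 2 * expR B).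
  by rewrite /e exprVn; field; rewrite gt_eqF.
by rewrite natrX ler_pM2l.
Qed.

Lemma ex_log y : ppos y -> exists2 x, star x = x & cexp x = y.
Proof.
move=> /ppos_strict[e e0 ey].
have [|x sx xy] := @ex_log_ge1 (sc A e^-1 * y).
  have := cle_scM (_ : 0 <= e^-1) ey; rewrite -scM mulVf ?gt_eqF// sc1; apply.
  by rewrite invr_ge0 ltW.
exists (x + sc A (ln e)); first by rewrite starD star_sc sx.
by rewrite cexp_shift lnK// xy mulrA scV ?gt_eqF// mul1r.
Qed.

Definition clog y : A := xget 0 [set x | star x = x /\ is_cexp x y].

Lemma clogP y : ppos y -> star (clog y) = clog y /\ cexp (clog y) = y.
Proof.
move=> /ex_log[x sx xy]; rewrite /clog; case: xgetP => [z _ [sz /is_cexp_unique]//|].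
by move/(_ x); case; split=> //; apply/is_cexp_unique.
Qed.

Definition cpow y t : A := cexp (t%:C *: clog y).

Lemma cpowE y t : cpow y t = cexp (sc A t * clog y).
Proof. by rewrite /cpow scE. Qed.

End Logarithm.

Opaque sc cexp clog.

(** * The part metric of the positive cone *)

Section LoewnerHeinz.
Variables (R : realType) (A : cstarAlgType R).
Implicit Types (x y z : A) (r s t : R).

Lemma cnorm_cexp_scB x s t : 0 <= s <= 1 -> 0 <= t <= 1 ->
  cnorm (cexp (sc A t * x) - cexp (sc A s * x)) <=
    `|t - s| * (cnorm x * expR (cnorm x + cnorm x)).
Proof.
move=> s01 t01; set r := cnorm x; have r0 : 0 <= r := cnorm_ge0 _.
have -> : cexp (sc A t * x) - cexp (sc A s * x) =
    (cexp (sc A (t - s) * x) - 1) * cexp (sc A s * x).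
  by rewrite mulrBl -cexp_scD subrK mul1r.
have h1 : cnorm (cexp (sc A s * x)) <= expR r.
  by apply: cnorm_cexp; rewrite cnorm_scM ler_piMl// ler_norml; lra.
have h2 : cnorm (cexp (sc A (t - s) * x) - 1) <= (`|t - s| * r) * expR r.
  rewrite (le_trans (cnorm_cexp_sub1 (lexx _)))// cnorm_scM -/r.
  rewrite ler_wpM2l ?mulr_ge0// ler_expR ler_piMl// ler_norml; lra.
rewrite (le_trans (cnormM _ _))// expRD !mulrA ler_pM ?cnorm_ge0//.
Qed.

Lemma cto_cexp_sc x (u : nat -> R) t : (forall n, 0 <= u n <= 1) -> 0 <= t <= 1 ->
  u n @[n --> \oo] --> t -> cto (fun n => cexp (sc A (u n) * x)) (cexp (sc A t * x)).
Proof.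
move=> u01 t01 ut; apply: cto_squeeze => [n|]; first exact: cnorm_cexp_scB.
set c := _ * expR _; rewrite -[X in _ --> X](mul0r c); apply: cvgM; last exact: cvg_cst.
by rewrite -(@normr0 _ R) -(subrr t); apply: cvg_norm; apply: cvgB => //; exact: cvg_cst.
Qed.

(** Put a = exp x, b = exp y and Z_r = a^(r/2) b^(-r/2); then a^r <= b^r means |Z_r| <= 1. For p =
    (s + t)/2 the element b^(-p/2) a^p b^(-p/2) is similar to Z_t* Z_s, of norm at most 1, so it
    lies below 1. *)
Lemma cle_cexp_midpoint x y s t : star x = x -> star y = y ->
  cle (cexp (sc A s * x)) (cexp (sc A s * y)) ->
  cle (cexp (sc A t * x)) (cexp (sc A t * y)) ->
  cle (cexp (sc A ((s + t) / 2) * x)) (cexp (sc A ((s + t) / 2) * y)).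
Proof.
move=> sx sy; have sE r z : star z = z -> star (cexp (sc A r * z)) = cexp (sc A r * z).
  by move=> sz; rewrite cexp_sa ?star_scM ?sz.
have D r r' z : cexp (sc A r * z) * cexp (sc A r' * z) = cexp (sc A (r + r') * z).
  by rewrite -cexp_scD.
have D0 r r' z : r + r' = 0 -> cexp (sc A r * z) * cexp (sc A r' * z) = 1.
  by move=> rr; rewrite D rr sc0 mul0r cexp0.
pose Z r := cexp (sc A (r / 2) * x) * cexp (sc A (- (r / 2)) * y).
have Z1 r : cle (cexp (sc A r * x)) (cexp (sc A r * y)) -> cnorm (Z r) <= 1.
  move=> h; apply/cnorm_le_starM => //; rewrite expr1n sc1 /Z starM !sE//.
  have := cle_conj (cexp (sc A (- (r / 2)) * y)) h; rewrite !sE//.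
  have <- : cexp (sc A (r / 2) * x) * cexp (sc A (r / 2) * x) = cexp (sc A r * x).
    by rewrite D; congr (cexp (sc A _ * x)); lra.
  have <- : cexp (sc A (r / 2) * y) * cexp (sc A (r / 2) * y) = cexp (sc A r * y).
    by rewrite D; congr (cexp (sc A _ * y)); lra.
  by rewrite !mulrA D0 ?addNr// mul1r D0 ?subrr.
move=> /Z1 hs /Z1 ht; set p := (s + t) / 2.
pose T := cexp (sc A (- (p / 2)) * y) * cexp (sc A p * x) * cexp (sc A (- (p / 2)) * y).
suff T1 : cle T 1.
  have := cle_conj (cexp (sc A (p / 2) * y)) T1; rewrite sE// /T mulr1 !mulrA.
  rewrite D0 ?subrr// mul1r -mulrA D0 ?addNr// mulr1 D.
  by rewrite (_ : p / 2 + p / 2 = p)//; lra.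
(* The exponent (t - s)/4 is - p/2 + t/2, the difference between the outer left powers of the two
   products. *)
apply: (@cle1_similar _ _ _ (cexp (sc A ((t - s) / 4) * y)) (cexp (sc A ((s - t) / 4) * y))
   (star (Z t) * Z s)).
- by rewrite /T !starM !sE// mulrA.
- by apply: D0; lra.
- by apply: D0; lra.
- rewrite /T /Z starM !sE//.
  have -> : cexp (sc A p * x) = cexp (sc A (t / 2) * x) * cexp (sc A (s / 2) * x).
    by rewrite D; congr (cexp (sc A _ * x)); rewrite /p; lra.
  have -> : cexp (sc A (- (p / 2)) * y) =
      cexp (sc A ((t - s) / 4) * y) * cexp (sc A (- (t / 2)) * y).
    by rewrite D; congr (cexp (sc A _ * y)); rewrite /p; lra.
  rewrite -!mulrA; do 4!congr (_ * _).
  by rewrite !D; congr (cexp (sc A _ * y)); lra.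
- by rewrite (le_trans (cnormM _ _))// cnorm_star mulr_ile1 ?cnorm_ge0.
Qed.

(** Bisection keeps t between two points of [E] at distance 2^-n; the left ones converge to t. *)
Lemma midpoint_closed_itv (E : set R) : E 0 -> E 1 ->
  (forall s t, E s -> E t -> E ((s + t) / 2)) ->
  (forall (u : nat -> R) t, (forall n, 0 <= u n <= 1) -> 0 <= t <= 1 ->
     (forall n, E (u n)) -> u n @[n --> \oo] --> t -> E t) ->
  forall t, 0 <= t <= 1 -> E t.
Proof.
move=> E0 E1 Emid Ecl t t01.
have step n : exists s, [/\ E s, E (s + 2 ^- n), 0 <= s, s + 2 ^- n <= 1
    & s <= t <= s + 2 ^- n].
  elim: n => [|n [s [Es Es' s0 s1 /andP[st ts]]]].
    by exists 0; rewrite expr0 invr1 add0r.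
  have h : (2 ^- n : R) = 2 ^- n.+1 + 2 ^- n.+1 by rewrite exprS invfM; lra.
  have p0 : 0 < 2 ^- n.+1 :> R by rewrite invr_gt0 exprn_gt0.
  have Em : E (s + 2 ^- n.+1).
    by have := Emid _ _ Es Es'; congr E; rewrite h; lra.
  have [tm|tm] := leP t (s + 2 ^- n.+1).
    by exists s; split=> //; [lra|apply/andP; split].
  exists (s + 2 ^- n.+1); rewrite -addrA -h; split=> //; first lra.
  by apply/andP; split=> //; exact: ltW.
have [u uP] := choice step.
apply: (Ecl u) => // [n|n|]; try by case: (uP n).
  have p0 : 0 < 2 ^- n :> R by rewrite invr_gt0 exprn_gt0.
  by case: (uP n) => _ _ h1 h2 _; apply/andP; split=> //; lra.
have c0 : (2^-1 : R) ^+ n @[n --> \oo] --> (0 : R).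
  by apply: cvg_expr; rewrite ger0_norm//; lra.
have c1 : t - (2^-1 : R) ^+ n @[n --> \oo] --> t.
  by rewrite -[X in _ --> X]subr0; apply: cvgB => //; exact: cvg_cst.
apply: (squeeze_cvgr _ c1 (cvg_cst t)); apply: nearW => n.
case: (uP n) => _ _ _ _ /andP[h1 h2]; rewrite exprVn; apply/andP; split=> //; lra.
Qed.

(* Loewner-Heinz, by Pedersen's argument: the set of exponents for which the
   inequality holds is closed and stable under midpoints. *)
Lemma cle_cexp_sc x y t : star x = x -> star y = y -> cle (cexp x) (cexp y) ->
  0 <= t <= 1 -> cle (cexp (sc A t * x)) (cexp (sc A t * y)).
Proof.
move=> sx sy xy; apply: (@midpoint_closed_itv
  [set t | cle (cexp (sc A t * x)) (cexp (sc A t * y))]) => /=.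
- by rewrite sc0 !mul0r; exact: cle_refl.
- by rewrite sc1 !mul1r.
- by move=> s s'; exact: cle_cexp_midpoint.
- by move=> u s u01 s01 us su; apply: (cle_closed us); exact: cto_cexp_sc.
Qed.

End LoewnerHeinz.

(** * The part metric, its geodesics and their convexity *)

Section Thompson.
Variables (R : realType) (A : cstarAlgType R).
Implicit Types (x y z g a b c : A) (r s t u : R).

Definition thompson_le r a b :=
  cle b (sc A (expR r) * a) /\ cle a (sc A (expR r) * b).

(* The part metric of the cone, see [thompsonE] for its value. *)
Definition thompson a b : R := inf [set r | 0 <= r /\ thompson_le r a b].

Lemma thompson_le_conj g r a b : invertible g ->
  thompson_le r (g * a * star g) (g * b * star g) <-> thompson_le r a b.
Proof.
move=> /inverseP[gi ig].
have h y z : cle (g * y * star g) (sc A (expR r) * (g * z * star g)) <->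
    cle y (sc A (expR r) * z).
  have -> : sc A (expR r) * (g * z * star g) = g * (sc A (expR r) * z) * star g.
    by rewrite !mulrA scC.
  split; last exact: cle_conjr.
  move/(cle_conjr (inverse g)).
  have sg : star g * star (inverse g) = 1 by rewrite -starM ig star1.
  have e w : inverse g * (g * w * star g) * star (inverse g) = w.
    by rewrite -!mulrA sg mulr1 mulrA ig mul1r.
  by rewrite !e.
by rewrite /thompson_le !h.
Qed.

Lemma thompson_conj g a b : invertible g ->
  thompson (g * a * star g) (g * b * star g) = thompson a b.
Proof.
move=> ig; congr inf; apply/seteqP; split=> r [r0 h]; split=> //;
  exact/(thompson_le_conj _ _ _ ig).
Qed.

(** Conjugating 1 <= e^r exp x by exp(- x / 2) turns it into exp(- x) <= e^r, after which
    [cnorm_le_cexp] applies. *)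
Lemma thompson_le_cexp x r : star x = x -> 0 <= r ->
  thompson_le r 1 (cexp x) <-> cnorm x <= r.
Proof.
move=> sx r0; rewrite cnorm_le_cexp// /thompson_le mulr1.
pose h := sc A 2^-1 * x; have sh : star (cexp h) = cexp h by rewrite cexp_sa ?star_scM ?sx.
have sh' : star (cexp (- h)) = cexp (- h) by rewrite cexp_sa// starN star_scM sx.
have hx : cexp x = cexp h * cexp h by rewrite cexp_half.
have hx' : cexp (- x) = cexp (- h) * cexp (- h) by rewrite /h -mulrN cexp_half.
have m1 := cexpMN h; have m2 := cexpNM h; rewrite hx hx'.
have e1 : cexp (- h) * (sc A (expR r) * (cexp h * cexp h)) * cexp (- h) = sc A (expR r).
  by rewrite !mulrA -scC -!mulrA m1 mulr1 m2 mulr1.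
have e2 : cexp h * (cexp (- h) * cexp (- h)) * cexp h = 1.
  by rewrite mulrA m1 mul1r m2.
split=> -[h1 h2]; split=> //.
  by have := cle_conj (cexp (- h)) h2; rewrite sh' mulr1 e1.
by have := cle_conj (cexp h) h2; rewrite sh e2 -scC -mulrA.
Qed.

Lemma thompsonE g x : invertible g -> star x = x ->
  thompson (g * star g) (g * cexp x * star g) = cnorm x.
Proof.
move=> ig sx; rewrite -{1}(mulr1 g) thompson_conj// /thompson.
rewrite (_ : [set r | _] = [set r | cnorm x <= r]); last first.
  apply/seteqP; split=> r /=; first by case=> r0 /thompson_le_cexp; exact.
  by move=> h; have r0 := le_trans (cnorm_ge0 _) h; split=> //; apply/thompson_le_cexp.
apply/le_anti/andP; split.
  by apply: ge_inf => /=; first by exists (cnorm x).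
by apply: lb_le_inf => /=; first by exists (cnorm x) => /=.
Qed.

Definition cgeo a b t : A :=
  cpow a 2^-1 * cpow (cpow a (- 2^-1) * b * cpow a (- 2^-1)) t * cpow a 2^-1.

(** Normal form of a geodesic, with [g] the positive square root of [a]. Later arguments often keep
    only that [g] is invertible, since moving the base point replaces it by products that need not
    be self-adjoint. *)
Lemma cgeo_rep a b : ppos a -> ppos b -> exists g x,
  [/\ ppos g, star x = x, g * star g = a, g * cexp x * star g = b
    & forall t, cgeo a b t = g * cexp (sc A t * x) * star g].
Proof.
move=> ap bp; have [sl le] := clogP ap.
have sg r : star (cpow a r) = cpow a r by rewrite cpowE cexp_sa ?star_scM ?sl.
have g1 : cpow a 2^-1 * cpow a (- 2^-1) = 1 by rewrite !cpowE scN mulNr cexpMN.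
have g2 : cpow a (- 2^-1) * cpow a 2^-1 = 1 by rewrite !cpowE scN mulNr cexpNM.
set M := cpow a (- 2^-1) * b * cpow a (- 2^-1).
have Mp : ppos M.
  rewrite /M -{1}sg; apply: ppos_conj => //; exists (cpow a 2^-1); split=> //.
have [sM eM] := clogP Mp.
exists (cpow a 2^-1), (clog M); split=> //.
- by rewrite cpowE; apply: ppos_cexp; rewrite star_scM sl.
- by rewrite sg cpowE cexp_half.
- by rewrite eM sg /M !mulrA g1 mul1r -!mulrA g2 mulr1.
- by move=> t; rewrite /cgeo -/M sg [cpow M t]cpowE.
Qed.

Lemma thompson_rep a b : ppos a -> ppos b -> exists g x,
  [/\ invertible g, star x = x, a = g * star g & b = g * cexp x * star g].
Proof.
by move=> ap bp; have [g [x [[_ ig] sx <- <- _]]] := cgeo_rep ap bp; exists g, x.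
Qed.

Lemma thompson_leP a b r : ppos a -> ppos b -> 0 <= r ->
  thompson a b <= r <-> thompson_le r a b.
Proof.
move=> ap bp r0; have [g [x [ig sx -> ->]]] := thompson_rep ap bp.
rewrite thompsonE// -thompson_le_cexp// -(thompson_le_conj _ _ _ ig) mulr1.
by [].
Qed.

Lemma thompson_ge0 a b : 0 <= thompson a b.
Proof.
rewrite /thompson; set E := [set r | _].
have [->|/set0P E0] := eqVneq E set0; first by rewrite inf0.
by apply: lb_le_inf => // r [].
Qed.

Lemma thompson_sym a b : thompson a b = thompson b a.
Proof. by congr inf; apply/seteqP; split=> r [r0 []]. Qed.

Lemma thompson_eq0 a b : ppos a -> ppos b -> thompson a b = 0 <-> a = b.
Proof.
move=> ap bp; split=> [h|->].
  have /(thompson_leP ap bp (lexx 0))[] : thompson a b <= 0 by rewrite h.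
  by rewrite expR0 sc1 !mul1r => h1 h2; exact: cle_anti.
apply/le_anti; rewrite thompson_ge0 andbT; apply/(thompson_leP bp bp (lexx 0)).
by rewrite /thompson_le expR0 sc1 mul1r; split; exact: cle_refl.
Qed.

Lemma thompson_triangle a b c : ppos a -> ppos b -> ppos c ->
  thompson a c <= thompson a b + thompson b c.
Proof.
move=> ap bp cp; apply/thompson_leP => //; first by rewrite addr_ge0 ?thompson_ge0.
have /(thompson_leP ap bp (thompson_ge0 a b))[h1 h2] := lexx (thompson a b).
have /(thompson_leP bp cp (thompson_ge0 b c))[h3 h4] := lexx (thompson b c).
rewrite /thompson_le expRD scM; split.
  by apply: cle_trans h3 _; rewrite [sc _ _ * sc _ _]scC -mulrA; apply: cle_scM h1; exact: expR_ge0.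
by apply: cle_trans h2 _; rewrite -mulrA; apply: cle_scM h4; exact: expR_ge0.
Qed.

Lemma ppos_conj_cexp g x : invertible g -> star x = x -> ppos (g * cexp x * star g).
Proof.
move=> ig sx; rewrite -{1}(starK g); apply: ppos_conj; first exact: invertible_star.
exact: ppos_cexp.
Qed.

Lemma ppos_Mstar g : invertible g -> ppos (g * star g).
Proof.
by move=> ig; rewrite -{1}(mulr1 g) -(cexp0 A); apply: ppos_conj_cexp; rewrite ?star0.
Qed.

Lemma cexp_mul_sc x r s t : r + s = t ->
  cexp (sc A r * x) * cexp (sc A s * x) = cexp (sc A t * x).
Proof. by move=> <-; rewrite cexp_scD. Qed.

(** Makes the point at time s the new base point: its factor is g exp(s x / 2), and [x] is kept. *)
Lemma cexp_sc_half_star g x s : star x = x ->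
  g * cexp (sc A (s / 2) * x) * star (g * cexp (sc A (s / 2) * x)) =
  g * cexp (sc A s * x) * star g.
Proof.
move=> sx; have e := @cexp_mul_sc x (s / 2) (s / 2) s (ltac:(clear; lra)).
by rewrite starM cexp_sa ?star_scM ?sx// -e !mulrA.
Qed.

Lemma thompson_geo g x s t : invertible g -> star x = x ->
  thompson (g * cexp (sc A s * x) * star g) (g * cexp (sc A t * x) * star g)
    = `|t - s| * cnorm x.
Proof.
move=> ig sx; rewrite -cexp_sc_half_star//.
have -> : g * cexp (sc A t * x) * star g =
  (g * cexp (sc A (s / 2) * x)) * cexp (sc A (t - s) * x) *
  star (g * cexp (sc A (s / 2) * x)).
  have e1 := @cexp_mul_sc x (s / 2) (t - s) (t - s / 2) (ltac:(clear; lra)).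
  have e2 := @cexp_mul_sc x (t - s / 2) (s / 2) t (ltac:(clear; lra)).
  by rewrite starM cexp_sa ?star_scM ?sx// -e2 -e1 !mulrA.
rewrite thompsonE ?star_scM ?sx//; first by rewrite cnorm_scM.
by apply: invertibleM => //; exact: invertible_cexp.
Qed.

(** With a <= e^r b rewritten as exp x <= exp(y + r), [cle_cexp_sc] scales the exponents by t and
    yields the factor e^(t r). *)
Lemma thompson_cexp_sc x y t : star x = x -> star y = y -> 0 <= t <= 1 ->
  thompson (cexp (sc A t * x)) (cexp (sc A t * y)) <= t * thompson (cexp x) (cexp y).
Proof.
move=> sx sy t01; set r := thompson _ (cexp y); have r0 : 0 <= r := thompson_ge0 _ _.
have /andP[t0 t1] := t01.
have px z : star z = z -> ppos (cexp (sc A t * z)).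
  by move=> sz; apply: ppos_cexp; rewrite star_scM sz.
have /(thompson_leP (ppos_cexp sx) (ppos_cexp sy) r0)[h1 h2] := lexx r.
apply/thompson_leP; rewrite ?mulr_ge0//; try exact: px.
have e z w : star z = z -> star w = w -> cle (cexp z) (sc A (expR r) * cexp w) ->
    cle (cexp (sc A t * z)) (sc A (expR (t * r)) * cexp (sc A t * w)).
  move=> sz sw; rewrite -cexp_shift => /cle_cexp_sc h.
  have := h t sz _ t01; rewrite starD star_sc sw mulrDr -scM cexp_shift; exact.
by split; exact: e.
Qed.

Lemma thompson_geo_start g x y t : invertible g -> star x = x -> star y = y ->
  0 <= t <= 1 ->
  thompson (g * cexp (sc A t * x) * star g) (g * cexp (sc A t * y) * star g) <=
    t * thompson (g * cexp x * star g) (g * cexp y * star g).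
Proof. by move=> ig sx sy t01; rewrite !thompson_conj//; exact: thompson_cexp_sc. Qed.

(* Two representations of the same endpoint differ by a unitary factor. *)
Lemma thompson_geo_common g h x y t : invertible g -> invertible h ->
  star x = x -> star y = y -> g * star g = h * star h -> 0 <= t <= 1 ->
  thompson (g * cexp (sc A t * x) * star g) (h * cexp (sc A t * y) * star h) <=
    t * thompson (g * cexp x * star g) (h * cexp y * star h).
Proof.
move=> ig ih sx sy gh t01; have [gi gig] := inverseP ig; have [hi hih] := inverseP ih.
pose u := inverse g * h.
have us : u * star u = 1.
  rewrite /u starM mulrA -(mulrA _ h) -gh !mulrA gig mul1r -starM gig star1.
  by [].
have iu : invertible u by apply: invertibleM => //; exact: invertible_inverse.
have su : star u * u = 1.
  by apply: (@invertible_mulrI _ _ _ u) => //; rewrite mulrA us mul1r mulr1.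
have hu : h = g * u by rewrite /u mulrA gi mul1r.
clearbody u.
have e z : h * cexp z * star h = g * cexp (u * z * star u) * star g.
  by rewrite (cexp_conj z us su) hu starM !mulrA.
have uy : u * (sc A t * y) * star u = sc A t * (u * y * star u) by rewrite !mulrA scC.
rewrite (e (sc A t * y)) (e y) uy.
by apply: thompson_geo_start => //; rewrite !starM starK sy mulrA.
Qed.

(* The third side of the triangle is the geodesic from g g* to h e^y h*. *)
Lemma thompson_convex g h x y t : invertible g -> invertible h ->
  star x = x -> star y = y -> 0 <= t <= 1 ->
  thompson (g * cexp (sc A t * x) * star g) (h * cexp (sc A t * y) * star h) <=
    (1 - t) * thompson (g * star g) (h * star h) +
    t * thompson (g * cexp x * star g) (h * cexp y * star h).
Proof.
move=> ig ih sx sy t01.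
have [N [NE Np]] : exists N, N = h * cexp y * star h /\ ppos N.
  by exists (h * cexp y * star h); split=> //; exact: ppos_conj_cexp.
rewrite -NE.
have [gi gig] := inverseP ig.
have : ppos (inverse g * N * star (inverse g)).
  by rewrite -{1}(starK (inverse g)); apply: ppos_conj => //;
    apply: invertible_star; exact: invertible_inverse.
move=> /ex_log[z sz ez].
have gz : g * cexp z * star g = N.
  by rewrite ez !mulrA gi mul1r -mulrA -starM gi star1 mulr1.
have h1 : thompson (g * cexp (sc A t * x) * star g) (g * cexp (sc A t * z) * star g) <=
    t * thompson (g * cexp x * star g) N.
  by rewrite -gz; exact: thompson_geo_start.
(* The geodesic run backwards from its endpoint: factor k exp(w / 2), exponent - w, time 1 - t. A
   common endpoint thus becomes a common starting point. *)
have back k w : star w = w -> k * cexp (sc A t * w) * star k =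
    (k * cexp (sc A (1 / 2) * w)) * cexp (sc A (1 - t) * - w) *
      star (k * cexp (sc A (1 / 2) * w)).
  move=> sw; have e1 := @cexp_mul_sc w (1 / 2) (- (1 - t)) (t - 1 / 2) (ltac:(clear; lra)).
  have e2 := @cexp_mul_sc w (t - 1 / 2) (1 / 2) t (ltac:(clear; lra)).
  by rewrite starM cexp_sa ?star_scM ?sw// mulrN -cexp_scN -e2 -e1 !mulrA.
have back0 k w : star w = w -> (k * cexp (sc A (1 / 2) * w)) *
    star (k * cexp (sc A (1 / 2) * w)) = k * cexp w * star k.
  by move=> sw; rewrite cexp_sc_half_star// sc1 mul1r.
have back1 k w : star w = w -> (k * cexp (sc A (1 / 2) * w)) * cexp (- w) *
    star (k * cexp (sc A (1 / 2) * w)) = k * star k.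
  move=> sw; have e1 : cexp (sc A (1 / 2) * w) * cexp (sc A (1 / 2) * w) = cexp w.
    by rewrite (@cexp_mul_sc w _ _ 1) ?sc1 ?mul1r//; clear; lra.
  have e2 : cexp (- w) = cexp (- (sc A (1 / 2) * w)) * cexp (- (sc A (1 / 2) * w)).
    by rewrite -!cexp_scN (@cexp_mul_sc w _ _ (- 1)) ?scN ?sc1 ?mulN1r//; clear; lra.
  rewrite starM cexp_sa ?star_scM ?sw// e2 -!mulrA (mulrA (cexp (sc A (1 / 2) * w))).
  by rewrite cexpMN mul1r (mulrA (cexp (- _))) cexpNM mul1r.
have h2 : thompson (g * cexp (sc A t * z) * star g) (h * cexp (sc A t * y) * star h) <=
    (1 - t) * thompson (g * star g) (h * star h).
  rewrite (back g z sz) (back h y sy) -(back1 g z sz) -(back1 h y sy).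
  apply: thompson_geo_common; rewrite ?starN ?sz ?sy//.
  - by apply: invertibleM => //; exact: invertible_cexp.
  - by apply: invertibleM => //; exact: invertible_cexp.
  - by rewrite (back0 g z sz) (back0 h y sy) gz NE.
  - by move: t01; clear => /andP[t0 t1]; apply/andP; split; lra.
have st (w : A) : star w = w -> star (sc A t * w) = sc A t * w.
  by move=> sw; rewrite star_scM sw.
have := thompson_triangle (ppos_conj_cexp ig (st x sx)) (ppos_conj_cexp ig (st z sz))
  (ppos_conj_cexp ih (st y sy)).
by move/le_trans; apply; rewrite addrC lerD.
Qed.

End Thompson.

(** * Lengths of curves of positive elements *)

Section RealCalculus.
Variable R : realType.
Implicit Types (f F : R -> R) (s t e d : R).

(** Extends a continuous function on [0, 1] to one on the line, so that the fundamental theorem of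
    calculus applies at 0 and 1 as at interior points. *)
Definition clamp01 t : R := Order.max 0 (Order.min t 1).

Lemma clamp01_itv t : 0 <= clamp01 t <= 1.
Proof.
by rewrite /clamp01; case: (leP t 1) => t1; [case: (leP 0 t) => t0|case: (leP 0 1) => h];
  apply/andP; split; lra.
Qed.

Lemma clamp01_id t : 0 <= t <= 1 -> clamp01 t = t.
Proof. by case/andP=> t0 t1; rewrite /clamp01 min_l// max_r. Qed.

Lemma clamp01_dist s t : `|clamp01 s - clamp01 t| <= `|s - t|.
Proof.
rewrite /clamp01; case: (leP s 1) => s1; case: (leP t 1) => t1;
  case: (leP 0 s) => s0; case: (leP 0 t) => t0;
  do ?[case: (leP 0 1) => h01]; rewrite ler_norml; case: (ger0P (s - t)); lra.
Qed.

Definition continuous01 f := forall t, 0 <= t <= 1 -> forall e, 0 < e ->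
  exists2 d, 0 < d & forall s, 0 <= s <= 1 -> `|s - t| < d -> `|f s - f t| <= e.

Definition primitive01 F f := forall t, 0 <= t <= 1 -> forall e, 0 < e ->
  exists2 d, 0 < d & forall s, 0 <= s <= 1 -> `|s - t| < d ->
    `|F s - F t - (s - t) * f t| <= e * `|s - t|.

Lemma ex_primitive01 f : continuous01 f ->
  exists2 F, primitive01 F f & F 1 - F 0 = \int[lebesgue_measure]_(t in `[0, 1]) f t.
Proof.
move=> cf; pose g := f \o clamp01.
have cg : continuous g.
  move=> x; apply/cvgrPdist_le => e e0.
  have [d d0 fd] := cf _ (clamp01_itv x) e e0.
  have xd : \forall y \near x, `|x - y| < d by apply/nbhs_ballP; exists d.
  apply: filterS xd => y xy; rewrite distrC; apply: fd; first exact: clamp01_itv.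
  by rewrite (le_lt_trans (clamp01_dist _ _))// distrC.
have ig a b : lebesgue_measure.-integrable `[a, b] (EFin \o g).
  apply: continuous_compact_integrable; first exact: segment_compact.
  exact: continuous_subspaceT.
(* Starting at -1 makes 0 an interior point; the bound 2 below does the same for 1. *)
pose F x := \int[lebesgue_measure]_(t in `[- 1, x]) g t.
exists F => [t t01 e e0|].
  have t2 : t < 2 by lra.
  have tN1 : - 1 < t by lra.
  have [dF F't] := @continuous_FTC1_closed _ g (- 1) t 2 t2 (ig _ _) tN1 (cg t).
  move: dF; rewrite /derivable => dF.
  have {dF} /cvgrPdist_le/(_ e e0) : h^-1 *: (F (h *: 1 + t) - F t) @[h --> 0^'] --> g t.
    by rewrite -F't derive1E.
  rewrite near_withinE => /nbhs_ballP[d /= d0 h]; exists d => // s s01 st.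
  have [->|nst] := eqVneq s t; first by rewrite !subrr mul0r subr0 normr0 mulr0.
  have st0 : s - t != 0 by rewrite subr_eq0.
  have := h (s - t); rewrite /ball /= sub0r normrN => /(_ st st0).
  rewrite /g /= (clamp01_id t01) scaler1 subrK => h'.
  rewrite (_ : _ - _ = - ((s - t) * (f t - (s - t)^-1 *: (F s - F t)))); last first.
    by rewrite mulrBr /GRing.scale/= mulrA divff// mul1r opprB.
  by rewrite normrN normrM mulrC ler_pM2r// normr_gt0.
rewrite /F Rintegral_itvB//; [|by rewrite bnd_simp; lra..].
rewrite Rintegral_itv_obnd_cbnd; last first.
  by apply: integrableS (ig 0 1) => //; apply: subset_itv; rewrite bnd_simp.
by apply: eq_Rintegral => t; rewrite inE /= in_itv /= => t01; rewrite /g /= clamp01_id.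
Qed.

Lemma primitive01_rev F f : primitive01 F f ->
  primitive01 (fun t => - F (1 - t)) (fun t => f (1 - t)).
Proof.
move=> Ff t t01 e e0; have t01' : 0 <= 1 - t <= 1 by lra.
have [d d0 h] := Ff _ t01' e e0; exists d => // s s01 st.
have := h (1 - s); rewrite (_ : 1 - s - (1 - t) = - (s - t)); last by ring.
have s01' : 0 <= 1 - s <= 1 by lra.
rewrite normrN => /(_ s01' st) h'.
rewrite (_ : - F (1 - s) - - F (1 - t) - (s - t) * f (1 - t) =
  - (F (1 - s) - F (1 - t) - - (s - t) * f (1 - t))); last by ring.
by rewrite normrN.
Qed.

Lemma primitive01_continuous F f : primitive01 F f -> continuous01 F.
Proof.
move=> Ff t t01 e e0; have [d d0 h] := Ff t t01 1 ltr01.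
have c0 : 0 < 1 + `|f t| by have := normr_ge0 (f t); lra.
exists (Order.min d (e / (1 + `|f t|))); first by rewrite lt_min d0 divr_gt0.
move=> s s01; rewrite lt_min => /andP[sd se]; have := h s s01 sd; rewrite mul1r => h'.
have : `|F s - F t| <= `|s - t| + `|s - t| * `|f t|.
  rewrite -normrM -(subrK ((s - t) * f t) (F s - F t)).
  by rewrite (le_trans (ler_normD _ _))// lerD2r.
move=> /le_trans; apply; rewrite -[X in X + _]mulr1 -mulrDr.
by rewrite -ler_pdivlMr// ltW.
Qed.

Lemma continuous01_cvg f (u : nat -> R) t : continuous01 f -> 0 <= t <= 1 ->
  (forall n, 0 <= u n <= 1) -> u n @[n --> \oo] --> t -> f (u n) @[n --> \oo] --> f t.
Proof.
move=> cf t01 u01 /cvgrPdist_lt ut; apply/cvgrPdist_le => e e0.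
have [d d0 h] := cf t t01 e e0; near=> n; rewrite distrC; apply: h => //.
by rewrite distrC; near: n; exact: ut.
Unshelve. all: by end_near. Qed.

Lemma cvg_expR (u : nat -> R) t : u n @[n --> \oo] --> t ->
  expR (u n) @[n --> \oo] --> expR t.
Proof. by move=> ut; apply: cvg_comp ut _; exact: continuous_expR. Qed.

(** Continuous induction: the supremum of the points of [0, 1] in [P] lies in [P] by closedness, and
    below 1 it could be exceeded. *)
Lemma segment01_ind (P : set R) : P 0 ->
  (forall (u : nat -> R) t, (forall n, 0 <= u n <= 1) -> 0 <= t <= 1 ->
     (forall n, P (u n)) -> u n @[n --> \oo] --> t -> P t) ->
  (forall t, 0 <= t < 1 -> P t -> exists s, [/\ t < s, s <= 1 & P s]) -> P 1.
Proof.
move=> P0 Pcl Pstep; pose S := [set t | 0 <= t <= 1 /\ P t].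
have S0 : S 0 by split=> //; rewrite lexx ler01.
have ubS : ubound S 1 by move=> t [/andP[]].
have hS : has_sup S by split; [exists 0|exists 1].
have m0 : 0 <= sup S by apply: ub_le_sup => //; exists 1.
have m1 : sup S <= 1 by apply: ge_sup => //; exists 0.
have adh n : exists t, S t /\ sup S - n.+1%:R^-1 < t.
  have n0 : 0 < n.+1%:R^-1 :> R by rewrite invr_gt0.
  by have [t St lt] := sup_adherent n0 hS; exists t.
have [u uP] := choice adh.
have u01 n : 0 <= u n <= 1 by case: (uP n) => -[].
have Pu n : P (u n) by case: (uP n) => -[].
have us : u n @[n --> \oo] --> sup S.
  have c1 : sup S - n.+1%:R^-1 @[n --> \oo] --> sup S.
    rewrite -[X in _ --> X]subr0; apply: cvgB; first exact: cvg_cst.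
    exact: cvg_harmonic.
  apply: (squeeze_cvgr _ c1 (cvg_cst (sup S))); apply: nearW => k.
  have [Sk /ltW lk] := uP k; rewrite lk /=; apply: ub_le_sup => //; by exists 1.
have Pm : P (sup S) by apply: Pcl us; rewrite // m0 m1.
move: m1; rewrite le_eqVlt => /orP[/eqP <-//|m1].
have [||s [ms s1 Ps]] := Pstep (sup S); rewrite ?m0//.
have : S s by split=> //; rewrite s1 (le_trans m0)// ltW.
by move=> /(ub_le_sup (ex_intro _ 1 ubS)); rewrite leNgt ms.
Qed.

End RealCalculus.

(** * The Finsler norm through the order, and C^1 curves *)

Section Finsler.
Variables (R : realType) (A : cstarAlgType R).
Implicit Types (a b x y g : A) (c r s t e d : R) (gam dgam : R -> A).

Definition cfinsler a x : R := cnorm (cpow a (- 2^-1) * x * cpow a (- 2^-1)).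

(** Conjugation by a^(1/2) expresses the Finsler norm through the order alone, as - c a <= x <= c a;
    this is what the growth estimates along a curve use. *)
Lemma cfinsler_le a x c : ppos a -> star x = x -> 0 <= c ->
  cfinsler a x <= c <-> cle x (sc A c * a) /\ cle (- x) (sc A c * a).
Proof.
move=> ap sx c0; have [sl le] := clogP ap; rewrite /cfinsler.
have sg r : star (cpow a r) = cpow a r by rewrite cpowE cexp_sa ?star_scM ?sl.
have mul r s : cpow a r * cpow a s = cpow a (r + s) by rewrite !cpowE cexp_scD.
have a1 : cpow a 1 = a by rewrite cpowE sc1 mul1r.
have a0 : cpow a 0 = 1 by rewrite cpowE sc0 mul0r cexp0.
set k := cpow a (- 2^-1); pose h := cpow a 2^-1.
have hk : h * k = 1 by rewrite /h /k mul subrr a0.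
have kh : k * h = 1 by rewrite /h /k mul addNr a0.
have hh : h * h = a by rewrite /h mul -[RHS]a1; congr cpow; lra.
have sk : star k = k := sg _. have sh : star h = h := sg _.
have e y : h * (k * y * k) * h = y.
  by rewrite mulrA -mulrA kh mulr1 mulrA hk mul1r.
have eh : h * sc A c * h = sc A c * a by rewrite -scC -mulrA hh.
have ek : k * (sc A c * a) * k = sc A c.
  by rewrite -hh mulrA -(scC c k) -!mulrA hk mulr1 kh mulr1.
have kx : star (k * x * k) = k * x * k by rewrite !starM sk sx mulrA.
split=> [/(cnorm_npos kx)[h1 h2]|[h1 h2]].
  have := cle_conj h h1; have := cle_conj h (_ : cle (- (k * x * k)) (sc A c)).
  rewrite /cle opprK => /(_ h2); rewrite -!/(cle _ _) sh eh.
  by rewrite mulrN mulNr !e.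
apply: npos_cnorm_le => //.
  by have := cle_conj k h1; rewrite sk ek.
by have := cle_conj k h2; rewrite sk ek /cle mulrN mulNr opprK.
Qed.

Lemma cfinsler_ge0 a x : 0 <= cfinsler a x.
Proof. exact: cnorm_ge0. Qed.

(** [g] need not be the positive square root of g g*, so the definition does not apply directly; the
    inequalities of [cfinsler_le] can be conjugated by any invertible element. *)
Lemma cfinsler_conj g x : invertible g -> star x = x ->
  cfinsler (g * star g) (g * x * star g) = cnorm x.
Proof.
move=> ig sx; have [gi gig] := inverseP ig.
have sgx : star (g * x * star g) = g * x * star g by rewrite !starM starK sx mulrA.
have e y : inverse g * (g * y * star g) * star (inverse g) = y.
  by rewrite -!mulrA -starM gig star1 mulr1 mulrA gig mul1r.
have e' c : g * sc A c * star g = sc A c * (g * star g) by rewrite -scC -mulrA.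
have main c : 0 <= c -> cfinsler (g * star g) (g * x * star g) <= c <-> cnorm x <= c.
  move=> c0; rewrite cfinsler_le//; last exact: ppos_Mstar.
  have -> : - (g * x * star g) = g * (- x) * star g by rewrite mulrN mulNr.
  rewrite -e'; split=> [[h1 h2]|h].
    apply: npos_cnorm_le => //.
      by have := cle_conjr (inverse g) h1; rewrite !e.
    by have := cle_conjr (inverse g) h2; rewrite !e /cle opprK.
  have [h1 h2] := cnorm_npos sx h.
  by split; apply: cle_conjr; rewrite /cle ?opprK.
by apply/le_anti/andP; split; [apply/main|apply/main => //; exact: cfinsler_ge0];
  rewrite ?cnorm_ge0.
Qed.

Definition cC1_curve gam dgam :=
  forall t, t \in `[0, 1] ->
    cnorm (((s - t)^-1)%:C *: (gam s - gam t) - dgam t)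
      @[s --> within `[0, 1] t^'] --> (0 : R) /\
    cnorm (dgam s - dgam t) @[s --> within `[0, 1] (nbhs t)] --> (0 : R).

Definition differentiable01 gam dgam := forall t, 0 <= t <= 1 -> forall e, 0 < e ->
  exists2 d, 0 < d & forall s, 0 <= s <= 1 -> `|s - t| < d ->
    cnorm (gam s - gam t - sc A (s - t) * dgam t) <= e * `|s - t|.

Definition ccontinuous01 gam := forall t, 0 <= t <= 1 -> forall e, 0 < e ->
  exists2 d, 0 < d & forall s, 0 <= s <= 1 -> `|s - t| < d -> cnorm (gam s - gam t) <= e.

Lemma cC1_differentiable01 gam dgam : cC1_curve gam dgam -> differentiable01 gam dgam.
Proof.
move=> h t t01 e e0; have [|/cvgrPdist_le/(_ e e0) h1 _] := h t.
  by rewrite in_itv.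
move: h1; rewrite near_withinE near_withinE => /nbhs_ballP[d /= d0 hd]; exists d => // s s01 st.
have [->|nst] := eqVneq s t; first by rewrite !subrr sc0 mul0r subr0 cnorm0 normr0 mulr0.
have st0 : s - t != 0 by rewrite subr_eq0.
have := hd s; rewrite /ball /= distrC => /(_ st nst); rewrite in_itv /= => /(_ s01).
rewrite sub0r normrN ger0_norm ?cnorm_ge0// scE => h1.
rewrite (_ : _ - _ = sc A (s - t) * (sc A (s - t)^-1 * (gam s - gam t) - dgam t)).
  by rewrite cnorm_scM mulrC ler_wpM2r.
by rewrite [RHS]mulrBr (mulrA (sc A (s - t))) scV// mul1r.
Qed.

Lemma cC1_continuous01 gam dgam : cC1_curve gam dgam -> ccontinuous01 dgam.
Proof.
move=> h t t01 e e0; have [|_ /cvgrPdist_le/(_ e e0) h1] := h t.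
  by rewrite in_itv.
move: h1; rewrite near_withinE => /nbhs_ballP[d /= d0 hd]; exists d => // s s01 st.
have := hd s; rewrite /ball /= distrC => /(_ st); rewrite in_itv /= => /(_ s01).
by rewrite sub0r normrN ger0_norm ?cnorm_ge0.
Qed.

Lemma lipschitz_C1 gam dgam c :
  (forall s t, 0 <= s <= 1 -> 0 <= t <= 1 ->
    cnorm (gam s - gam t - sc A (s - t) * dgam t) <= c * `|s - t| ^+ 2) ->
  (forall s t, 0 <= s <= 1 -> 0 <= t <= 1 -> cnorm (dgam s - dgam t) <= c * `|s - t|) ->
  cC1_curve gam dgam.
Proof.
move=> h1 h2 t; rewrite in_itv /= => t01.
have c0 : 0 <= c.
  have h01 : 0 <= (0 : R) <= 1 by rewrite lexx ler01.
  have h11 : 0 <= (1 : R) <= 1 by rewrite lexx ler01.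
  have := h2 0 1 h01 h11; rewrite sub0r normrN normr1 mulr1.
  by apply: le_trans; exact: cnorm_ge0.
have near_lt e : 0 < e -> \forall s \near t, c * `|s - t| <= e.
  move=> e0; apply/nbhs_ballP; exists (e / (c + 1)) => /=.
    by rewrite divr_gt0// ltr_wpDl.
  move=> s; rewrite /ball /= distrC ltr_pdivlMr ?ltr_wpDl// => st.
  by have := normr_ge0 (s - t); nra.
split; apply/cvgrPdist_le => e e0.
  rewrite near_withinE near_withinE; near=> s => nst.
  rewrite /= in_itv /= sub0r normrN => s01; rewrite ger0_norm ?cnorm_ge0// scE.
  have st0 : s - t != 0 by rewrite subr_eq0.
  rewrite (_ : _ - _ = sc A (s - t)^-1 * (gam s - gam t - sc A (s - t) * dgam t)).
    rewrite cnorm_scM normfV mulrC ler_pdivrMr ?normr_gt0// (le_trans (h1 _ _ s01 t01))//.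
    by rewrite expr2 mulrA ler_wpM2r//; near: s; exact: near_lt.
  by rewrite [RHS]mulrBr (mulrA _ (sc A (s - t))) [sc _ _ * sc _ _]scC scV// mul1r.
rewrite near_withinE; near=> s; rewrite /= in_itv /= sub0r normrN => s01.
by rewrite ger0_norm ?cnorm_ge0// (le_trans (h2 _ _ s01 t01))//; near: s; exact: near_lt.
Unshelve. all: by end_near. Qed.

Lemma differentiable01_continuous gam dgam :
  differentiable01 gam dgam -> ccontinuous01 gam.
Proof.
move=> gd t t01 e e0; have [d d0 h] := gd t t01 1 ltr01.
have c0 : 0 < 1 + cnorm (dgam t) by have := cnorm_ge0 (dgam t); lra.
exists (Order.min d (e / (1 + cnorm (dgam t)))); first by rewrite lt_min d0 divr_gt0.
move=> s s01; rewrite lt_min => /andP[sd se]; have := h s s01 sd; rewrite mul1r => h'.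
have : cnorm (gam s - gam t) <= `|s - t| + `|s - t| * cnorm (dgam t).
  rewrite -cnorm_scM -(subrK (sc A (s - t) * dgam t) (gam s - gam t)).
  by rewrite (le_trans (cnormD _ _))// lerD2r.
move=> /le_trans; apply; rewrite -[X in X + _]mulr1 -mulrDr.
by rewrite -ler_pdivlMr// ltW.
Qed.

Lemma ccontinuous01_cto gam (u : nat -> R) t : ccontinuous01 gam -> 0 <= t <= 1 ->
  (forall n, 0 <= u n <= 1) -> u n @[n --> \oo] --> t -> cto (fun n => gam (u n)) (gam t).
Proof.
move=> cg t01 u01 /cvgrPdist_lt ut; apply/cvgrPdist_le => e e0.
have [d d0 h] := cg t t01 e e0; near=> n.
rewrite sub0r normrN ger0_norm ?cnorm_ge0//; apply: h => //.
by rewrite distrC; near: n; exact: ut.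
Unshelve. all: by end_near. Qed.

Lemma differentiable01_rev gam dgam : differentiable01 gam dgam ->
  differentiable01 (fun t => gam (1 - t)) (fun t => - dgam (1 - t)).
Proof.
move=> gd t t01 e e0; have t01' : 0 <= 1 - t <= 1 by lra.
have [d d0 h] := gd _ t01' e e0; exists d => // s s01 st.
have := h (1 - s); rewrite (_ : 1 - s - (1 - t) = - (s - t)); last by ring.
rewrite normrN scN mulNr mulrN => h'; apply: h' => //; lra.
Qed.

(* Away from 1 any s.a. perturbation is absorbed by the strictly positive gam t,
   so gam s <= (1 + (s - t)(f t + e)) gam t for s > t close to t. *)
Lemma cle_growth_step gam dgam (f : R -> R) t e : 0 <= t < 1 -> 0 < e ->
  ppos (gam t) -> (forall s, 0 <= s <= 1 -> star (gam s) = gam s) ->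
  star (dgam t) = dgam t ->
  cle (dgam t) (sc A (f t) * gam t) -> differentiable01 gam dgam ->
  exists2 d, 0 < d & forall s, t < s -> s <= 1 -> s - t < d ->
    cle (gam s) (sc A (expR ((s - t) * (f t + e))) * gam t).
Proof.
move=> /andP[t0 t1] e0 gp sg sdg dgf gd.
have /ppos_strict[m m0 mg] := gp.
have [|d d0 h] := gd t _ (m * e) (mulr_gt0 m0 e0).
  by rewrite t0 ltW.
exists d => // s ts s1 sd; set k := s - t in sd *; have k0 : 0 < k by rewrite subr_gt0.
have s01 : 0 <= s <= 1 by rewrite s1 (le_trans t0)// ltW.
have := h s s01; rewrite gtr0_norm ?subr_gt0// => /(_ sd).
have st : star (gam s - gam t - sc A k * dgam t) = gam s - gam t - sc A k * dgam t.
  by rewrite !starB star_scM !sg// ?sdg// t0 ltW.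
move=> /(cnorm_npos st)[h1 _].
have h2 : cle (gam s) (gam t + sc A k * dgam t + sc A (m * e * k)).
  rewrite /cle; move: h1; rewrite -/k; congr npos; ncring.
apply: (cle_trans h2).
have h3 : cle (sc A (m * e * k)) (sc A (e * k) * gam t).
  rewrite (_ : m * e * k = (e * k) * m); last by ring.
  by rewrite scM; apply: cle_scM mg; rewrite mulr_ge0// ltW.
have h4 : cle (sc A k * dgam t) (sc A (k * f t) * gam t).
  by rewrite scM -mulrA; apply: cle_scM dgf; exact: ltW.
apply: (@cle_trans _ _ (sc A (1 + k * (f t + e)) * gam t)).
  have -> : sc A (1 + k * (f t + e)) * gam t =
      gam t + sc A (k * f t) * gam t + sc A (e * k) * gam t.
    rewrite (_ : 1 + _ = 1 + k * f t + e * k); last by ring.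
    by rewrite !scD sc1 !mulrDl mul1r.
  by apply: cleD h3; apply: cleD h4; exact: cle_refl.
by apply: cle_scl; [exact: expR_ge1Dx|case: gp].
Qed.

(** Continuous induction on gam t <= exp(F t - F 0 + e t) gam 0. Half of the slack e pays for
    linearising [gam], the other half for linearising [F]; then e tends to 0. *)
Lemma cle_growth gam dgam (f F : R -> R) :
  (forall t, 0 <= t <= 1 -> ppos (gam t)) ->
  (forall t, 0 <= t <= 1 -> star (dgam t) = dgam t) ->
  (forall t, 0 <= t <= 1 -> cle (dgam t) (sc A (f t) * gam t)) ->
  differentiable01 gam dgam -> primitive01 F f ->
  cle (gam 1) (sc A (expR (F 1 - F 0)) * gam 0).
Proof.
move=> gp sdg dgf gd Ff; have t00 : 0 <= (0 : R) <= 1 by rewrite lexx ler01.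
have t11 : 0 <= (1 : R) <= 1 by rewrite lexx ler01.
have sg s : 0 <= s <= 1 -> star (gam s) = gam s by move=> /gp[/npos_star].
have main e : 0 < e -> cle (gam 1) (sc A (expR (F 1 - F 0 + e)) * gam 0).
  move=> e0; rewrite -[e]mulr1.
  apply: (@segment01_ind R [set t | cle (gam t) (sc A (expR (F t - F 0 + e * t)) * gam 0)]).
  - by rewrite /= subrr mulr0 addr0 expR0 sc1 mul1r; exact: cle_refl.
  - move=> u t u01 t01 Pu ut; apply: (cle_closed Pu).
      by apply: ccontinuous01_cto => //; exact: differentiable01_continuous gd.
    apply: ctoM (cto_cst _); apply: cto_sc.
    have Fu : F (u n) @[n --> \oo] --> F t.
      by apply: continuous01_cvg => //; exact: primitive01_continuous Ff.
    apply: cvg_expR.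
    apply: cvgD; first by apply: cvgB => //; exact: cvg_cst.
    by apply: cvgM => //; exact: cvg_cst.
  - move=> t /andP[t0 t1] /= Pt; have t01 : 0 <= t <= 1 by rewrite t0 ltW.
    have e2 : 0 < e / 2 by rewrite divr_gt0.
    have [|d d0 hd] := @cle_growth_step gam dgam f t (e / 2) _ e2 (gp _ t01) sg (sdg _ t01)
      (dgf _ t01) gd; first by rewrite t0.
    have [d' d'0 hF] := Ff t t01 (e / 2) e2.
    pose k := Order.min (Order.min (d / 2) (d' / 2)) (1 - t).
    have k0 : 0 < k by rewrite !lt_min !divr_gt0// subr_gt0.
    have kd : k <= d / 2 by rewrite /k !ge_min lexx.
    have kd' : k <= d' / 2 by rewrite /k !ge_min lexx orbT.
    have k1 : k <= 1 - t by rewrite /k !ge_min lexx orbT.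
    exists (t + k); split; [lra|lra|].
    have s01 : 0 <= t + k <= 1 by apply/andP; split; lra.
    have tk : t + k - t = k by ring.
    have := hd (t + k); rewrite tk => /(_ _ _ _)/cle_trans; apply; try lra.
    apply: (cle_trans (cle_scM (expR_ge0 _) Pt)).
    rewrite mulrA -scM -expRD; apply: cle_scl; last by case: (gp 0 t00).
    rewrite ler_expR; have := hF (t + k) s01; rewrite tk gtr0_norm// ler_norml.
    move=> /(_ _)/andP[]; first lra.
    move: k0; lra.
apply: (@cle_closed _ _ (fun=> gam 1)
  (fun n => sc A (expR (F 1 - F 0 + n.+1%:R^-1)) * gam 0)).
- by move=> n; apply: main; rewrite invr_gt0.
- exact: cto_cst.
- apply: ctoM (cto_cst _); apply: cto_sc.
  apply: cvg_expR.
  rewrite -[X in _ --> X]addr0; apply: cvgD; first exact: cvg_cst.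
  exact: cvg_harmonic.
Qed.

(** As b >= m, an error of norm r is at most (r / m) b in the order. Replacing a by b costs c r and
    replacing x by y costs r, whence the term (c + 1) r / m. *)
Lemma cle_perturb a b x y m r c : ppos a -> ppos b -> star x = x -> star y = y ->
  0 < m -> 0 <= c -> cle (sc A m) b -> cnorm (a - b) <= r -> cnorm (x - y) <= r ->
  cfinsler a x <= c -> cfinsler b y <= c + (c + 1) * r / m.
Proof.
move=> ap bp sx sy m0 c0 mb ab xy; have r0 : 0 <= r := le_trans (cnorm_ge0 _) ab.
move=> /(cfinsler_le ap sx c0)[h1 h2].
apply/cfinsler_le => //; first by rewrite addr_ge0// !mulr_ge0// ?addr_ge0// invr_ge0 ltW.
have sab : star (a - b) = a - b by rewrite starB !npos_star//; [case: bp|case: ap].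
have sxy : star (x - y) = x - y by rewrite starB sx sy.
have [h3 _] := cnorm_npos sab ab; have [h5 h6] := cnorm_npos sxy xy.
have h7 : cle (sc A r) (sc A (r / m) * b).
  have rm : 0 <= r / m by rewrite divr_ge0// ltW.
  by have := cle_scM rm mb; rewrite -scM divfK ?gt_eqF.
have key z z' : cle z (sc A c * a) -> cle z' (z + sc A r) ->
    cle z' (sc A (c + (c + 1) * r / m) * b).
  move=> hz hz'; apply: (cle_trans hz').
  apply: (@cle_trans _ _ (sc A c * (b + sc A r) + sc A r)).
    apply: cleD (cle_refl _); apply: (cle_trans hz); apply: cle_scM => //.
    by rewrite /cle; move: h3; congr npos; ncring.
  have -> : sc A c * (b + sc A r) + sc A r = sc A c * b + sc A (c + 1) * sc A r.
    by rewrite mulrDr scD sc1 mulrDl mul1r addrA.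
  have -> : sc A (c + (c + 1) * r / m) * b = sc A c * b + sc A (c + 1) * (sc A (r / m) * b).
    by rewrite scD mulrDl mulrA -scM mulrA.
  by apply: cleD; [exact: cle_refl|apply: cle_scM => //; exact: addr_ge0].
split.
  by apply: (key x) => //; rewrite /cle; move: h6; congr npos; ncring.
by apply: (key (- x)) => //; rewrite /cle; move: h5; congr npos; ncring.
Qed.

Lemma cfinsler_continuous gam dgam : (forall t, 0 <= t <= 1 -> ppos (gam t)) ->
  (forall t, 0 <= t <= 1 -> star (dgam t) = dgam t) ->
  ccontinuous01 gam -> ccontinuous01 dgam ->
  continuous01 (fun t => cfinsler (gam t) (dgam t)).
Proof.
move=> gp sdg cg cdg t t01 e e0; have /ppos_strict[m m0 mg] := gp t t01.
set c := cfinsler (gam t) (dgam t); have c0 : 0 <= c := cfinsler_ge0 _ _.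
(* Capping at 1 gives c' <= c + 1 for the Finsler norm c' at the nearby point, so c' + 1 can be
   replaced by c + 2; m / 2 will be a lower bound for [gam s]. *)
pose e1 := Order.min e 1; have e10 : 0 < e1 by rewrite lt_min e0 ltr01.
pose r := Order.min (m / 2) (e1 * m / (2 * (c + 2))).
have r0 : 0 < r.
  by rewrite lt_min; apply/andP; split; rewrite ?divr_gt0// ?mulr_gt0// ltr_wpDl.
have r1 : r <= m / 2 by rewrite ge_min lexx.
have r2 : (c + 2) * r / (m / 2) <= e1.
  rewrite ler_pdivrMr ?divr_gt0// -ler_pdivlMl ?ltr_wpDl//.
  apply: (@le_trans _ _ (e1 * m / (2 * (c + 2)))); first by rewrite /r ge_min lexx orbT.
  by rewrite (_ : e1 * m / _ = (c + 2)^-1 * (e1 * (m / 2)))//; field; rewrite gt_eqF// ltr_wpDl.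
have [d d0 hd] := cg t t01 r r0; have [d' d'0 hd'] := cdg t t01 r r0.
exists (Order.min d d'); first by rewrite lt_min d0.
move=> s s01; rewrite lt_min => /andP[sd sd'].
have gr := hd s s01 sd; have dr := hd' s s01 sd'.
have mg' : cle (sc A (m / 2)) (gam s).
  have sgs : star (gam s - gam t) = gam s - gam t.
    by rewrite starB !npos_star//; [case: (gp t t01)|case: (gp s s01)].
  have [_ h] := cnorm_npos sgs gr.
  apply: (@cle_trans _ _ (sc A m - sc A r)).
    by rewrite -scB; apply: cle_sc; lra.
  apply: (@cle_trans _ _ (gam t - sc A r)); first by apply: cleD => //; exact: cle_refl.
  by rewrite /cle; move: h; congr npos; ncring.
have m2 : 0 < m / 2 by rewrite divr_gt0.
set c' := cfinsler (gam s) (dgam s).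
have h1 : c' <= c + (c + 1) * r / (m / 2).
  apply: (cle_perturb (gp t t01) (gp s s01) (sdg t t01) (sdg s s01)) => //;
    by rewrite cnorm_distC.
have h2 : c <= c' + (c' + 1) * r / m.
  by apply: (cle_perturb (gp s s01) (gp t t01) (sdg s s01) (sdg t t01)) => //;
    exact: cfinsler_ge0.
have e1e : e1 <= e by rewrite ge_min lexx.
have e11 : e1 <= 1 by rewrite ge_min lexx orbT.
have h3 : (c + 1) * r / (m / 2) <= (c + 2) * r / (m / 2).
  by rewrite !ler_pM2r ?invr_gt0//; lra.
have h4 : (c' + 1) * r / m <= (c + 2) * r / (m / 2).
  apply: (@le_trans _ _ ((c + 2) * r / m)).
    by rewrite !ler_pM2r ?invr_gt0//; lra.
  by rewrite ler_pM2l ?mulr_gt0 ?ltr_wpDl// lef_pV2 ?posrE//; lra.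
rewrite ler_norml; apply/andP; split; lra.
Qed.

Lemma C1_star gam dgam t : (forall s, 0 <= s <= 1 -> star (gam s) = gam s) ->
  differentiable01 gam dgam -> 0 <= t <= 1 -> star (dgam t) = dgam t.
Proof.
move=> sg gd t01; apply/eqP; rewrite -subr_eq0; apply/eqP/cnorm0_eq0/le_anti.
rewrite cnorm_ge0 andbT; apply/ler_addgt0Pr => e e0; rewrite add0r.
have [d d0 hd] := gd t t01 (e / 2) (divr_gt0 e0 (ltr0Sn _ _)).
(* The point s is taken to the right of t in the first half and to the left in the second, so that
   it stays in [0, 1]. *)
have [s [s01 st sd]] : exists s, [/\ 0 <= s <= 1, s != t & `|s - t| < d].
  pose k := Order.min (d / 2) (1 / 2).
  have k0 : 0 < k by rewrite lt_min !divr_gt0.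
  have kd : k <= d / 2 by rewrite ge_min lexx.
  have k1 : k <= 1 / 2 by rewrite ge_min lexx orbT.
  case: (leP t (1 / 2)) => t1.
    exists (t + k); rewrite (_ : t + k - t = k); last by ring.
    rewrite gtr0_norm// gt_eqF ?ltrDl//; split=> //; [apply/andP; split|]; lra.
  exists (t - k); rewrite (_ : t - k - t = - k); last by ring.
  rewrite normrN gtr0_norm// lt_eqF ?gtrDl ?oppr_lt0//; split=> //; [apply/andP; split|]; lra.
have st0 : 0 < `|s - t| by rewrite normr_gt0 subr_eq0.
have h := hd s s01 sd; set w := gam s - gam t - sc A (s - t) * dgam t in h.
have : sc A (s - t) * (star (dgam t) - dgam t) = w - star w.
  by rewrite /w !starB star_scM !sg// mulrBr; ncring.
move=> /(congr1 (@cnorm R A)); rewrite cnorm_scM => h'.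
have := cnormB w (star w); rewrite -h' cnorm_star => h''.
by rewrite -(ler_pM2l st0); lra.
Qed.

(** [cle_growth] bounds gam 1 by gam 0; the other inequality comes from the same lemma for the curve
    run backwards. *)
Lemma thompson_le_length gam dgam : cC1_curve gam dgam ->
  (forall t, t \in `[0, 1] -> ppos (gam t)) ->
  thompson (gam 0) (gam 1) <=
    \int[lebesgue_measure]_(t in `[0, 1]) cfinsler (gam t) (dgam t).
Proof.
move=> gC1 gp'; have gp t : 0 <= t <= 1 -> ppos (gam t) by move=> t01; apply: gp'; rewrite in_itv.
have gd := cC1_differentiable01 gC1.
have sg s : 0 <= s <= 1 -> star (gam s) = gam s by move=> /gp[/npos_star].
have sdg t : 0 <= t <= 1 -> star (dgam t) = dgam t by move=> t01; exact: C1_star gd t01.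
have cg := differentiable01_continuous gd; have cdg := cC1_continuous01 gC1.
have [F Ff FE] := ex_primitive01 (cfinsler_continuous gp sdg cg cdg).
set f := fun t => _ in Ff.
have hf t : 0 <= t <= 1 -> cle (dgam t) (sc A (f t) * gam t) /\ cle (- dgam t) (sc A (f t) * gam t).
  move=> t01; apply/(cfinsler_le (gp _ t01) (sdg _ t01)) => //; exact: cfinsler_ge0.
have h1 := cle_growth gp sdg (fun t t01 => (hf t t01).1) gd Ff.
have r01 t : 0 <= t <= 1 -> 0 <= 1 - t <= 1 by move=> t01; lra.
have h2 : cle (gam 0) (sc A (expR (F 1 - F 0)) * gam 1).
  have := @cle_growth (fun t => gam (1 - t)) (fun t => - dgam (1 - t))
    (fun t => f (1 - t)) (fun t => - F (1 - t)).
  rewrite subrr subr0 opprK addrC; apply.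
  - by move=> t /r01; exact: gp.
  - by move=> t /r01 t01; rewrite starN sdg.
  - by move=> t /r01 t01; exact: (hf _ t01).2.
  - exact: differentiable01_rev.
  - exact: primitive01_rev.
have t00 : 0 <= (0 : R) <= 1 by rewrite lexx ler01.
have t11 : 0 <= (1 : R) <= 1 by rewrite lexx ler01.
have FF : 0 <= F 1 - F 0.
  by rewrite FE; apply: Rintegral_ge0 => t _; exact: cfinsler_ge0.
by rewrite -FE; apply/thompson_leP => //; exact: gp.
Qed.

Lemma geodesic_C1 g x :
  cC1_curve (fun t => g * cexp (sc A t * x) * star g)
    (fun t => g * (x * cexp (sc A t * x)) * star g).
Proof.
set r := cnorm x; have r0 : 0 <= r := cnorm_ge0 x.
have gn y n : cnorm y <= n -> cnorm (g * y * star g) <= cnorm g ^+ 2 * n.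
  move=> yn; rewrite (le_trans (cnormM _ _))// cnorm_star expr2 mulrAC.
  rewrite ler_wpM2r ?cnorm_ge0// (le_trans (cnormM _ _))// ler_wpM2l ?cnorm_ge0//.
apply: (@lipschitz_C1 _ _ (cnorm g ^+ 2 * (r ^+ 2 * expR (r + r)))) => s t s01 t01.
  rewrite (_ : _ - _ = g * ((cexp (sc A (s - t) * x) - 1 - sc A (s - t) * x)
      * cexp (sc A t * x)) * star g); last first.
    have -> : sc A (s - t) * (g * (x * cexp (sc A t * x)) * star g) =
        g * (sc A (s - t) * x * cexp (sc A t * x)) * star g.
      by rewrite !mulrA scC.
    by rewrite 2!mulrBl mul1r -cexp_scD subrK; ncring.
  rewrite -[leRHS]mulrA; apply: gn; rewrite (le_trans (cnormM _ _))//.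
  have st1 : `|s - t| <= 1 by rewrite ler_norml; lra.
  have h1 : cnorm (sc A (s - t) * x) <= `|s - t| * r by rewrite cnorm_scM.
  have h2 : cnorm (cexp (sc A t * x)) <= expR r.
    by apply: cnorm_cexp; rewrite cnorm_scM ler_piMl// ler_norml; lra.
  have -> : r ^+ 2 * expR (r + r) * `|s - t| ^+ 2 = (`|s - t| * r) ^+ 2 * expR r * expR r.
    by rewrite expRD; ring.
  apply: ler_pM => //; try exact: cnorm_ge0.
  rewrite (le_trans (cnorm_cexp_sub2 h1))// ler_wpM2l ?sqr_ge0// ler_expR.
  by rewrite ler_piMl.
rewrite (_ : _ - _ = g * (x * (cexp (sc A s * x) - cexp (sc A t * x))) * star g); last first.
  by rewrite !mulrBr mulrBl.
rewrite -[leRHS]mulrA; apply: gn; rewrite (le_trans (cnormM _ _))// expr2 -!mulrA.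
rewrite ler_wpM2l// (le_trans (cnorm_cexp_scB x t01 s01))// -/r.
by rewrite mulrC -mulrA.
Qed.

Lemma comm_cexp x z : x * z = z * x -> cexp x * z = z * cexp x.
Proof.
move=> xz; apply: (@cto_unique _ _ (fun n => (\sum_(k < n) ecoef x k) * z)).
  by apply: ctoM (cto_cst z); exact: cexpP.
rewrite (_ : (fun _ => _) = fun n => z * \sum_(k < n) ecoef x k).
  exact/ctoMl/cexpP.
apply/funext => n; rewrite mulr_suml mulr_sumr; apply: eq_bigr => k _.
rewrite /ecoef mulrA -scC -!mulrA; congr (_ * _).
elim: (nat_of_ord k) => [|m IH]; first by rewrite mul1r mulr1.
by rewrite exprSr -mulrA xz mulrA IH -mulrA.
Qed.

Lemma cdistE a b : ppos a -> ppos b ->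
  inf [set l | exists gam dgam : R -> A,
    [/\ cC1_curve gam dgam, forall t, t \in `[0, 1] -> ppos (gam t), gam 0 = a,
        gam 1 = b & l = \int[lebesgue_measure]_(t in `[0, 1]) cfinsler (gam t) (dgam t)]]
  = thompson a b.
Proof.
move=> ap bp; set E := [set l | _].
have lbE : lbound E (thompson a b).
  by move=> l [gam [dgam [C1 gp <- <- ->]]]; exact: thompson_le_length.
have [g [x [ig sx ga gb]]] := thompson_rep ap bp.
have El : E (thompson a b).
  exists (fun t => g * cexp (sc A t * x) * star g),
    (fun t => g * (x * cexp (sc A t * x)) * star g); split.
  - exact: geodesic_C1.
  - by move=> t _; apply: ppos_conj_cexp => //; rewrite star_scM sx.
  - by rewrite sc0 mul0r cexp0 mulr1 -ga.
  - by rewrite sc1 mul1r -gb.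
  rewrite ga gb thompsonE// (_ : (fun t => _) = fun=> cnorm x); last first.
    apply/funext => t.
    have e : cexp (sc A (t / 2) * x) * x = x * cexp (sc A (t / 2) * x).
      by apply: comm_cexp; rewrite (mulrA x) -scC.
    (* Rebased at g exp(t x / 2), the tangent vector is a congruence of [x] itself, so its Finsler
       norm is |x| at every time. *)
    have <- : g * cexp (sc A (t / 2) * x) * x * star (g * cexp (sc A (t / 2) * x)) =
        g * (x * cexp (sc A t * x)) * star g.
      have h : t / 2 + t / 2 = t by clear; lra.
      rewrite starM cexp_sa ?star_scM ?sx// -(cexp_mul_sc x h) -(mulrA g) e.
      by rewrite !mulrA.
    rewrite -(cexp_sc_half_star g t sx) cfinsler_conj//.
    by apply: invertibleM => //; exact: invertible_cexp.
  rewrite Rintegral_cst//= lebesgue_measure_itv/= lte_fin ltr01 oppr0 adde0 mulr1.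
  by [].
apply/le_anti/andP; split; first by apply: ge_inf El; exists (thompson a b).
by apply: lb_le_inf lbE; exists (thompson a b).
Qed.

End Finsler.

(** * The C*-algebra of 2 x 2 matrices *)

Section HilbertModule.
Variables (R : realType) (A : cstarAlgType R).
Implicit Types (M N : 'M[A]_2) (x y : 'cV[A]_2) (a b : A) (r : R) (c : R[i]).

Lemma mxstarE m n (M : 'M[A]_(m, n)) i j : mxstar M i j = star (M j i).
Proof. by rewrite !mxE. Qed.

Lemma mxstar_mul m n p (M : 'M[A]_(m, n)) (N : 'M[A]_(n, p)) :
  mxstar (M *m N) = mxstar N *m mxstar M.
Proof.
apply/matrixP => i j; rewrite mxstarE !mxE star_sum; apply: eq_bigr => k _.
by rewrite starM !mxstarE.
Qed.

Lemma mxstarK m n (M : 'M[A]_(m, n)) : mxstar (mxstar M) = M.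
Proof. by apply/matrixP => i j; rewrite !mxstarE starK. Qed.

Lemma mxstarD m n (M N : 'M[A]_(m, n)) : mxstar (M + N) = mxstar M + mxstar N.
Proof. by apply/matrixP => i j; rewrite [RHS]mxE !mxstarE mxE starD. Qed.

Lemma mul_mxE m n (M : 'M[A]_(m, 2)) (N : 'M[A]_(2, n)) i j :
  (M *m N) i j = M i 0 * N 0 j + M i 1 * N 1 j.
Proof. by rewrite mxE !big_ord_recl big_ord0 addr0; congr (_ + _ * _); [congr (M _ _)|congr (N _ _)]; exact: val_inj. Qed.

Definition inner x y : A := (mxstar x *m y) 0 0.

Lemma innerE x y : inner x y = star (x 0 0) * y 0 0 + star (x 1 0) * y 1 0.
Proof. by rewrite /inner mul_mxE !mxstarE. Qed.

Lemma inner_adj M x y : inner (M *m x) y = inner x (mxstar M *m y).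
Proof. by rewrite /inner mxstar_mul mulmxA. Qed.

Lemma star_inner x y : star (inner x y) = inner y x.
Proof. by rewrite !innerE starD !starM !starK. Qed.

Lemma inner_npos x : npos (inner x x).
Proof. by rewrite innerE; apply: nposD; exact: npos_starM. Qed.

Lemma vnorm_ge0 x : 0 <= vnorm x. Proof. exact: sqrtr_ge0. Qed.

Lemma vnorm_sqr x : vnorm x ^+ 2 = cnorm (inner x x).
Proof. by rewrite /vnorm sqr_sqrtr ?cnorm_ge0. Qed.

Lemma vnorm_le x r : 0 <= r -> vnorm x <= r <-> cle (inner x x) (sc A (r ^+ 2)).
Proof.
move=> r0; rewrite -npos_cnorm ?exprn_ge0//; last exact: inner_npos.
by rewrite -vnorm_sqr ler_pXn2r// nnegrE vnorm_ge0.
Qed.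

Lemma vnorm_coord x i : cnorm (x i 0) <= vnorm x.
Proof.
rewrite cnorm_le_starM ?vnorm_ge0//.
apply: (@cle_trans _ _ (inner x x)); last first.
  by apply/vnorm_le; first exact: vnorm_ge0.
rewrite innerE /cle; case: (unliftP 0 i) => [j ->|->]; last first.
  by rewrite addrC addKr; exact: npos_starM.
rewrite (_ : lift 0 j = 1); last by apply: val_inj; rewrite [j]ord1.
by rewrite addrK; exact: npos_starM.
Qed.

Lemma vnorm_le_sum x : vnorm x <= cnorm (x 0 0) + cnorm (x 1 0).
Proof.
rewrite -(@ler_pXn2r _ 2) ?nnegrE ?addr_ge0 ?vnorm_ge0 ?cnorm_ge0// vnorm_sqr innerE.
rewrite (le_trans (cnormD _ _))// !cnorm_starM sqrrD lerD2r lerDl mulrn_wge0//.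
by rewrite mulr_ge0 ?cnorm_ge0.
Qed.

(* For r > |x|, positivity of <z, z> with z = x (r^-2 <x, y>) - y gives
   <x, y>* <x, y> <= r^2 <y, y>. *)
Lemma inner_le x y : cnorm (inner x y) <= vnorm x * vnorm y.
Proof.
(* Taking r > |x| allows division by r even when |x| = 0; r then tends to |x|. *)
suff h r : vnorm x < r -> cnorm (inner x y) <= r * vnorm y.
  have [y0|y0] := eqVneq (vnorm y) 0.
    have := h (vnorm x + 1); rewrite y0 !mulr0; apply; lra.
  have yp : 0 < vnorm y by rewrite lt_neqAle eq_sym y0 vnorm_ge0.
  rewrite -ler_pdivrMr//; apply/ler_addgt0Pr => e e0.
  by rewrite ler_pdivrMr//; apply: h; rewrite ltrDl.
move=> xr; have r0 : 0 < r := le_lt_trans (vnorm_ge0 x) xr.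
set a := inner x y; pose k := sc A (r ^- 2).
have k1 : k * sc A (r ^+ 2) = 1 by rewrite /k scC scV// expf_neq0// gt_eqF.
have sk : star k = k by exact: star_sc.
have kC b : k * b = b * k by exact: scC.
pose z : 'cV[A]_2 := \col_i (x i 0 * (k * a) - y i 0).
have zz : inner z z = k * (k * (star a * inner x x * a)) - (k * (star a * a) + k * (star a * a))
    + inner y y.
  have ya : star a = inner y x by rewrite star_inner.
  have sa : star (k * a) = k * star a by rewrite starM sk -kC.
  transitivity (k * star a * inner x x * (k * a) - k * star a * a - inner y x * (k * a)
      + inner y y).
    rewrite {1}innerE !mxE !starB !(starM (x _ _)) sa /a !innerE; clear; ncring.
  rewrite -ya; congr (_ + _); rewrite opprD addrA; congr (_ - _ - _).
  - by rewrite !mulrA; congr (_ * _); rewrite -[RHS]mulrA -[RHS]mulrA [RHS]kC -!mulrA kC !mulrA.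
  - by rewrite mulrA.
  - by rewrite !mulrA -kC.
have zp := inner_npos z; rewrite zz in zp.
have k0 : npos k by apply: npos_sc; rewrite invr_ge0 exprn_ge0// ltW.
have h1 : cle (star a * inner x x * a) (sc A (r ^+ 2) * (star a * a)).
  have := cle_conj a (_ : cle (inner x x) (sc A (r ^+ 2))).
  have -> : star a * sc A (r ^+ 2) * a = sc A (r ^+ 2) * (star a * a) by rewrite -scC -mulrA.
  apply.
  by apply/vnorm_le; exact: ltW.
have h2 : cle (k * (star a * a)) (inner y y).
  rewrite /cle.
  have h3 : npos (k * (k * (sc A (r ^+ 2) * (star a * a) - star a * inner x x * a))).
    by rewrite /k; do 2!(apply: npos_scM; first by rewrite invr_ge0 exprn_ge0// ltW).
  have := nposD zp h3; congr npos.
  have e : k * (sc A (r ^+ 2) * (star a * a)) = star a * a by rewrite mulrA k1 mul1r.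
  by rewrite (mulrBr k (sc A _ * _)) e; ncring.
rewrite -(@ler_pXn2r _ 2) ?nnegrE ?mulr_ge0 ?cnorm_ge0 ?vnorm_ge0// ?(ltW r0)//.
rewrite -cnorm_starM exprMn vnorm_sqr.
apply/npos_cnorm; [exact: npos_starM|by rewrite mulr_ge0 ?exprn_ge0 ?cnorm_ge0// ltW|].
have h4 : cle (inner y y) (sc A (cnorm (inner y y))).
  by apply/npos_cnorm; [exact: inner_npos|exact: cnorm_ge0|].
have := cle_scM (_ : 0 <= r ^+ 2) (cle_trans h2 h4).
rewrite exprn_ge0 ?ltW// => /(_ isT); rewrite mulrA -/k [sc A (r ^+ 2) * k]scC k1 mul1r -scM.
by [].
Qed.

Lemma innerDl x y z : inner (x + y) z = inner x z + inner y z.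
Proof. by rewrite !innerE !mxE !starD !mulrDl addrACA. Qed.

Lemma innerDr x y z : inner x (y + z) = inner x y + inner x z.
Proof. by rewrite !innerE !mxE !mulrDr addrACA. Qed.

Lemma vnormD x y : vnorm (x + y) <= vnorm x + vnorm y.
Proof.
rewrite -(@ler_pXn2r _ 2) ?nnegrE ?addr_ge0 ?vnorm_ge0// vnorm_sqr.
rewrite innerDl !innerDr sqrrD !vnorm_sqr.
rewrite (le_trans (cnormD _ _))//.
have h1 := cnormD (inner x x) (inner x y); have h2 := cnormD (inner y x) (inner y y).
have h3 := inner_le x y; have h4 := inner_le y x; rewrite (mulrC (vnorm y)) in h4.
rewrite mulr2n; move: h1 h2 h3 h4; clear; lra.
Qed.

Definition cvscale c x : 'cV[A]_2 := map_mx ( *:%R c) x.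

Lemma vnorm_cvscale c x : vnorm (cvscale c x) = complex.Re `|c| * vnorm x.
Proof.
have c0 : 0 <= complex.Re `|c| by rewrite normc_def /= sqrtr_ge0.
apply/eqP; rewrite -(@eqrXn2 _ 2) ?mulr_ge0 ?vnorm_ge0// vnorm_sqr exprMn vnorm_sqr.
rewrite !innerE !mxE !star_scale -!scalerAl -!scalerAr !scalerA -scalerDr cnormZ.
rewrite normrM (_ : `|c^*%C| = `|c|); last by rewrite normcJ.
apply/eqP; congr (_ * _); rewrite normc_def -rmorphM /= -expr2.
by [].
Qed.

Lemma vnorm0 : vnorm (0 : 'cV[A]_2) = 0.
Proof.
by apply/eqP; rewrite -sqrf_eq0 vnorm_sqr innerE !mxE star0 !mul0r addr0 cnorm0.
Qed.

Definition entry_sum M : R := \sum_i \sum_j cnorm (M i j).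

Lemma sum2 (F : 'I_2 -> R) : \sum_i F i = F 0 + F 1.
Proof. by rewrite !big_ord_recl big_ord0 addr0; congr (_ + F _); exact: val_inj. Qed.

Lemma vnorm_mul_le M x : vnorm (M *m x) <= entry_sum M * vnorm x.
Proof.
rewrite (le_trans (vnorm_le_sum _))// /entry_sum !sum2 !mul_mxE !mulrDl.
have h i : cnorm (M i 0 * x 0 0 + M i 1 * x 1 0) <=
    cnorm (M i 0) * vnorm x + cnorm (M i 1) * vnorm x.
  rewrite (le_trans (cnormD _ _))// lerD// (le_trans (cnormM _ _))//;
    by rewrite ler_wpM2l ?cnorm_ge0// vnorm_coord.
by apply: lerD; exact: h.
Qed.

Let unit_image M := [set vnorm (M *m x) | x in [set x | vnorm x <= 1]].

Lemma has_sup_unit_image M : has_sup (unit_image M).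
Proof.
split; first by exists (vnorm (M *m 0)), 0 => //=; rewrite vnorm0 ler01.
exists (entry_sum M) => _ [x /= x1 <-]; rewrite (le_trans (vnorm_mul_le _ _))//.
rewrite ler_piMr//; apply: sumr_ge0 => i _; apply: sumr_ge0 => j _; exact: cnorm_ge0.
Qed.

Lemma mxnorm_le M r : 0 <= r -> (forall x, vnorm (M *m x) <= r * vnorm x) -> mxnorm M <= r.
Proof.
move=> r0 h; apply: ge_sup; first by case: (has_sup_unit_image M).
by move=> _ [x /= x1 <-]; rewrite (le_trans (h x))// ler_piMr.
Qed.

Lemma mxnorm_ge0 M : 0 <= mxnorm M.
Proof.
apply: (@le_trans _ _ (vnorm (M *m 0))); first exact: vnorm_ge0.
apply: ub_le_sup; first by case: (has_sup_unit_image M).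
by exists 0 => //=; rewrite vnorm0 ler01.
Qed.

Lemma mxscale_mul c M x : mxscale c M *m x = cvscale c (M *m x).
Proof.
apply/matrixP => i j; rewrite mul_mxE [RHS]mxE mul_mxE scalerDr !scalerAl.
by rewrite !mxE.
Qed.

Lemma mulmx_cvscale c M x : M *m cvscale c x = cvscale c (M *m x).
Proof.
apply/matrixP => i j; rewrite mul_mxE [RHS]mxE mul_mxE scalerDr !scalerAr.
by rewrite !mxE.
Qed.

Lemma Re_norm_real r : 0 <= r -> complex.Re `|r%:C| = r.
Proof. by move=> r0; rewrite normc_def /= expr0n /= addr0 sqrtr_sqr ger0_norm. Qed.

Lemma vnorm_eq0 x : vnorm x = 0 -> x = 0.
Proof.
move=> x0; apply/matrixP => i j; rewrite [j]ord1 mxE; apply/cnorm0_eq0/le_anti.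
by rewrite cnorm_ge0 andbT -x0 vnorm_coord.
Qed.

Lemma vnorm_mulmx M x : vnorm (M *m x) <= mxnorm M * vnorm x.
Proof.
have [x0|x0] := eqVneq (vnorm x) 0.
  by rewrite (vnorm_eq0 x0) mulmx0 vnorm0 mulr0.
have xp : 0 < vnorm x by rewrite lt_neqAle eq_sym x0 vnorm_ge0.
pose y := cvscale (vnorm x)^-1%:C x.
have yE : vnorm y = 1 by rewrite vnorm_cvscale Re_norm_real ?invr_ge0 ?ltW// mulVf.
have : vnorm (M *m y) <= mxnorm M.
  apply: ub_le_sup; first by case: (has_sup_unit_image M).
  by exists y => //=; rewrite yE.
rewrite mulmx_cvscale vnorm_cvscale Re_norm_real ?invr_ge0 ?vnorm_ge0// mulrC.
by rewrite ler_pdivrMr.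
Qed.

(** Together with [entry_le_mxnorm] this makes the operator norm equivalent to the entrywise one,
    whence completeness. *)
Lemma mxnorm_le_sum M : mxnorm M <= entry_sum M.
Proof.
apply: mxnorm_le; last exact: vnorm_mul_le.
by apply: sumr_ge0 => i _; apply: sumr_ge0 => j _; exact: cnorm_ge0.
Qed.

Lemma entry_le_mxnorm M i j : cnorm (M i j) <= mxnorm M.
Proof.
pose e : 'cV[A]_2 := \col_k (if k == j then 1 else 0).
have e1 : vnorm e = 1.
  apply/eqP; rewrite -(@eqrXn2 _ 2) ?vnorm_ge0// vnorm_sqr innerE !mxE expr1n.
  have [->|->] : j = 0 \/ j = 1.
    by case: (unliftP 0 j) => [k ->|->]; [right|left]; rewrite // [k]ord1; exact: val_inj.
  - by rewrite /= star1 star0 mul0r mulr1 addr0 cnorm1.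
  - by rewrite /= star1 star0 mul0r mulr1 add0r cnorm1.
have -> : M i j = (M *m e) i 0.
  rewrite mul_mxE !mxE.
  have [->|->] : j = 0 \/ j = 1.
    by case: (unliftP 0 j) => [k ->|->]; [right|left]; rewrite // [k]ord1; exact: val_inj.
  - by rewrite /= mulr0 mulr1 addr0.
  - by rewrite /= mulr0 mulr1 add0r.
by rewrite (le_trans (vnorm_coord _ _))// (le_trans (vnorm_mulmx _ _))// e1 mulr1.
Qed.

Lemma mxnorm_eq0 M : mxnorm M = 0 -> M = 0.
Proof.
move=> M0; apply/matrixP => i j; rewrite mxE; apply/cnorm0_eq0/le_anti.
by rewrite cnorm_ge0 andbT -M0 entry_le_mxnorm.
Qed.

Lemma mxnormD M N : mxnorm (M + N) <= mxnorm M + mxnorm N.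
Proof.
apply: mxnorm_le => [|x]; first by rewrite addr_ge0 ?mxnorm_ge0.
by rewrite mulmxDl mulrDl (le_trans (vnormD _ _))// lerD// vnorm_mulmx.
Qed.

Lemma mxscale_inv c M : c != 0 -> mxscale c^-1 (mxscale c M) = M.
Proof. by move=> c0; apply/matrixP => i j; rewrite !mxE scalerA mulVf// scale1r. Qed.

Lemma mxnormZ c M : mxnorm (mxscale c M) = complex.Re `|c| * mxnorm M.
Proof.
have h (b : R[i]) N : mxnorm (mxscale b N) <= complex.Re `|b| * mxnorm N.
  apply: mxnorm_le => [|x].
    by rewrite mulr_ge0 ?mxnorm_ge0// normc_def /= sqrtr_ge0.
  by rewrite mxscale_mul vnorm_cvscale -mulrA ler_wpM2l ?vnorm_mulmx// normc_def /= sqrtr_ge0.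
have [->|c0] := eqVneq c 0.
  apply/le_anti; rewrite h normr0 /= mul0r mxnorm_ge0.
  by [].
apply/le_anti; rewrite h /=; have := h c^-1 (mxscale c M); rewrite mxscale_inv// => h'.
set n := complex.Re `|c|; have cn : `|c| = n%:C by rewrite /n normc_def.
have n0 : 0 < n by move: c0; rewrite -normr_gt0 ltcE => /andP[].
by move: h'; rewrite normfV cn -fmorphV /= -ler_pdivlMl ?invr_gt0// invrK.
Qed.

Lemma mxnormM M N : mxnorm (M * N) <= mxnorm M * mxnorm N.
Proof.
apply: mxnorm_le => [|x]; first by rewrite mulr_ge0 ?mxnorm_ge0.
rewrite -mulmxA (le_trans (vnorm_mulmx _ _))// -mulrA ler_wpM2l ?mxnorm_ge0//.
exact: vnorm_mulmx.
Qed.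

(** |M x|^2 = |<x, M* M x>| <= |M* M| |x|^2 by [inner_le]. *)
Lemma mxnorm_sqr_le M : mxnorm M ^+ 2 <= mxnorm (mxstar M * M).
Proof.
rewrite -(sqr_sqrtr (mxnorm_ge0 (mxstar M * M))) lerXn2r ?nnegrE ?mxnorm_ge0 ?sqrtr_ge0//.
apply: mxnorm_le => [|x]; first exact: sqrtr_ge0.
rewrite -(@ler_pXn2r _ 2) ?nnegrE ?mulr_ge0 ?sqrtr_ge0 ?vnorm_ge0//.
rewrite vnorm_sqr exprMn sqr_sqrtr ?mxnorm_ge0// inner_adj mulmxA.
rewrite (le_trans (inner_le _ _))// expr2 mulrCA ler_wpM2l ?vnorm_ge0//.
exact: vnorm_mulmx.
Qed.

Lemma mxnorm_star_le M : mxnorm M <= mxnorm (mxstar M).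
Proof.
have [->|M0] := eqVneq (mxnorm M) 0; first exact: mxnorm_ge0.
rewrite -(@ler_pM2r _ (mxnorm M)) ?lt_neqAle ?mxnorm_ge0 1?eq_sym ?M0//.
by rewrite -expr2 (le_trans (mxnorm_sqr_le M))// mxnormM.
Qed.

Lemma mxnorm_starM M : mxnorm (mxstar M * M) = mxnorm M ^+ 2.
Proof.
apply/le_anti; rewrite mxnorm_sqr_le andbT (le_trans (mxnormM _ _))// expr2.
by rewrite ler_wpM2r ?mxnorm_ge0// -{2}(mxstarK M) mxnorm_star_le.
Qed.

Lemma mxnorm_complete (u : nat -> 'M[A]_2) :
  (forall e : R, 0 < e -> exists N : nat, forall m n : nat,
     (N <= m)%N -> (N <= n)%N -> mxnorm (u m - u n) < e) ->
  exists l, mxnorm (u n - l) @[n --> \oo] --> (0 : R).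
Proof.
move=> cu.
have lim i j : exists l, cto (fun n => u n i j) l.
  apply: cnorm_complete => e /cu[N h]; exists N => m n Nm Nn.
  apply: le_lt_trans (h m n Nm Nn).
  by have := entry_le_mxnorm (u m - u n) i j; rewrite !mxE.
pose f i j := sval (cid (lim i j)); have fP i j := svalP (cid (lim i j)).
exists (\matrix_(i, j) f i j).
apply: (@squeeze_cvgr _ _ _ _ (fun=> 0) (fun n => entry_sum (u n - \matrix_(i, j) f i j))).
- by apply: nearW => n; rewrite mxnorm_ge0 mxnorm_le_sum.
- exact: cvg_cst.
rewrite /entry_sum; under eq_fun do rewrite !sum2 !mxE.
have h := cvgD (cvgD (fP 0 0) (fP 0 1)) (cvgD (fP 1 0) (fP 1 1)).
by rewrite !addr0 in h; exact: h.
Qed.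

End HilbertModule.

(* The library's left scaling on 'M[A]_2 is by A, hence an alias for the complex
   algebra. *)
Definition matrix2 (R : realType) (A : cstarAlgType R) : Type := 'M[A]_2.

Section MatrixAlgebra.
Variables (R : realType) (A : cstarAlgType R).

HB.instance Definition _ := GRing.NzRing.copy (matrix2 A) 'M[A]_2.

Definition matrix2_scale (c : R[i]) (M : matrix2 A) : matrix2 A := mxscale c M.

Lemma matrix2_scalerA a b v : matrix2_scale a (matrix2_scale b v) = matrix2_scale (a * b) v.
Proof. by apply/matrixP => i j; rewrite !mxE scalerA. Qed.

Lemma matrix2_scale1r : left_id 1 matrix2_scale.
Proof. by move=> v; apply/matrixP => i j; rewrite !mxE scale1r. Qed.

Lemma matrix2_scalerDr : right_distributive matrix2_scale +%R.
Proof. by move=> a u v; apply/matrixP => i j; rewrite !mxE scalerDr. Qed.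

Lemma matrix2_scalerDl v : {morph matrix2_scale^~ v : a b / a + b}.
Proof. by move=> a b; apply/matrixP => i j; rewrite !mxE scalerDl. Qed.

HB.instance Definition _ := GRing.Zmodule_isLmodule.Build R[i] (matrix2 A)
  matrix2_scalerA matrix2_scale1r matrix2_scalerDr matrix2_scalerDl.

Lemma matrix2_scalerAl (a : R[i]) (u v : matrix2 A) : a *: (u * v) = (a *: u) * v.
Proof.
apply/matrixP => i j; rewrite [LHS]mxE [(u * v) i j]mul_mxE [RHS]mul_mxE.
by rewrite !mxE scalerDr !scalerAl.
Qed.

HB.instance Definition _ := GRing.Lmodule_isLalgebra.Build R[i] (matrix2 A) matrix2_scalerAl.

Lemma matrix2_scalerAr (a : R[i]) (u v : matrix2 A) : a *: (u * v) = u * (a *: v).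
Proof.
apply/matrixP => i j; rewrite [LHS]mxE [(u * v) i j]mul_mxE [RHS]mul_mxE.
by rewrite !mxE scalerDr !scalerAr.
Qed.

HB.instance Definition _ := GRing.Lalgebra_isAlgebra.Build R[i] (matrix2 A) matrix2_scalerAr.

Lemma matrix2_starZ (c : R[i]) (x : matrix2 A) :
  mxstar (c *: x : matrix2 A) = c^*%C *: (mxstar x : matrix2 A) :> matrix2 A.
Proof. by apply/matrixP => i j; rewrite !mxE star_scale. Qed.

HB.instance Definition _ := Algebra_isCStar.Build R (matrix2 A)
  (@mxnorm_eq0 R A) (@mxnormD R A) (@mxnormZ R A) (@mxnormM R A) (@mxnorm_complete R A)
  (@mxstarK R A 2 2) (@mxstarD R A 2 2) matrix2_starZ (@mxstar_mul R A 2 2 2)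
  (@mxnorm_starM R A).

End MatrixAlgebra.

(** * Geodesics under unitary conjugation and inversion *)

Section GeodesicFormulas.
Variables (R : realType) (A : cstarAlgType R).
Implicit Types (a b g x u rho : A) (s t : R).

(** The endpoints determine the parameters of the normal form: [g] as the positive square root of
    the first, [x] by injectivity of the exponential. So a geodesic can be computed from any
    representation with positive [g]. *)
Lemma cgeo_eq g x t : ppos g -> star x = x ->
  cgeo (g * g) (g * cexp x * g) t = g * cexp (sc A t * x) * g.
Proof.
move=> gp sx; have sg : star g = g := npos_star gp.1.
have ap : ppos (g * g) by have := ppos_Mstar gp.2; rewrite sg.
have bp : ppos (g * cexp x * g) by have := ppos_conj_cexp gp.2 sx; rewrite sg.
have [h [y [hp sy ha hb ->]]] := cgeo_rep ap bp.
have sh : star h = h := npos_star hp.1.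
have gh : h = g by apply: ppos_sqrt_unique => //; rewrite -ha sh.
rewrite gh sg in hb *; congr (_ * cexp (_ * _) * _); apply: cexp_inj => //.
by apply: (invertible_mulrI gp.2); apply: (invertible_mulIr gp.2).
Qed.

Lemma ppos_cgeo a b t : ppos a -> ppos b -> ppos (cgeo a b t).
Proof.
move=> ap bp; have [g [x [gp sx _ _ ->]]] := cgeo_rep ap bp.
by apply: ppos_conj_cexp; [case: gp|rewrite star_scM sx].
Qed.

Lemma ppos_rep a b : ppos a -> ppos b -> exists g x,
  [/\ ppos g, star x = x, a = g * g & b = g * cexp x * g].
Proof.
move=> ap bp; have [g [x [gp sx <- <- _]]] := cgeo_rep ap bp.
by exists g, x; rewrite (npos_star gp.1).
Qed.

Lemma ppos_unitary u a : u * star u = 1 -> star u * u = 1 -> ppos a ->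
  ppos (u * a * star u).
Proof.
move=> uu uu' ap; have iu : invertible (star u) by exists u.
by have := ppos_conj iu ap; rewrite starK.
Qed.

(** A unitary conjugates the normal form into one whose [g] is again positive, so [cgeo_eq] applies
    on both sides. *)
Lemma cgeo_unitary u a b t : u * star u = 1 -> star u * u = 1 -> ppos a -> ppos b ->
  cgeo (u * a * star u) (u * b * star u) t = u * cgeo a b t * star u.
Proof.
move=> uu uu' ap bp; have [g [x [gp sx -> ->]]] := ppos_rep ap bp.
have M y z : u * (y * z) * star u = (u * y * star u) * (u * z * star u).
  by rewrite -!mulrA (mulrA (star u) u) uu' mul1r.
have gp' : ppos (u * g * star u) by exact: ppos_unitary.
have sx' : star (u * x * star u) = u * x * star u by rewrite !starM starK sx mulrA.
have Mz z : u * (g * z * g) * star u = (u * g * star u) * (u * z * star u) * (u * g * star u).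
  by rewrite (M (g * z) g) (M g z).
rewrite (M g g) (Mz (cexp x)) -(cexp_conj x uu uu') (@cgeo_eq _ _ t gp' sx').
rewrite (@cgeo_eq _ _ t gp sx) Mz -(cexp_conj _ uu uu').
have -> : u * (sc A t * x) * star u = sc A t * (u * x * star u) by rewrite !mulrA scC.
by [].
Qed.

Lemma thompson_unitary u a b : u * star u = 1 -> star u * u = 1 ->
  thompson (u * a * star u) (u * b * star u) = thompson a b.
Proof. by move=> uu uu'; apply: thompson_conj; exists (star u). Qed.

(* Conjugation by rho carries the geodesic from a to b to the one from a^-1 to
   b^-1, which is the pointwise inverse of the former. *)
Lemma cgeo_symmetric rho a b t : star rho = rho -> rho * rho = 1 ->
  ppos a -> ppos b -> rho * a * rho * a = 1 -> rho * b * rho * b = 1 ->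
  rho * cgeo a b t * rho * cgeo a b t = 1.
Proof.
move=> srho rho2 ap bp.
have := @cgeo_unitary rho a b t; rewrite srho => /(_ rho2 rho2 ap bp) <-.
have [g [x [gp sx -> ->]]] := ppos_rep ap bp => ra rb.
have [gi ig] := inverseP gp.2; set k := inverse g in gi ig.
have kp : ppos k by split; [exact: npos_inverse|exists g].
have ea : rho * (g * g) * rho = k * k.
  apply: (invertible_mulIr (_ : invertible (g * g))); first by apply: invertibleM; case: gp.
  by rewrite ra -mulrA (mulrA k g g) ig mul1r ig.
have eb : rho * (g * cexp x * g) * rho = k * cexp (- x) * k.
  apply: (invertible_mulIr (_ : invertible (g * cexp x * g))).
    apply: invertibleM; last by case: gp.
    by apply: invertibleM; [case: gp|exact: invertible_cexp].
  by rewrite rb !mulrA -(mulrA _ k g) ig mulr1 -(mulrA k) cexpNM mulr1 ig.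
have sxN : star (- x) = - x by rewrite starN sx.
rewrite ea eb (@cgeo_eq _ _ t kp sxN) (@cgeo_eq _ _ t gp sx) mulrN.
by rewrite !mulrA -(mulrA _ k g) ig mulr1 -(mulrA k) cexpNM mulr1 ig.
Qed.

Lemma cexp_shift_rep g x s t : star x = x ->
  g * cexp (sc A (s + t) * x) * star g = (g * cexp (sc A (s / 2) * x)) *
    cexp (sc A t * x) * star (g * cexp (sc A (s / 2) * x)).
Proof.
move=> sx; have e1 := @cexp_mul_sc R A x (s / 2) t (s / 2 + t) erefl.
have e2 := @cexp_mul_sc R A x (s / 2 + t) (s / 2) (s + t) (ltac:(clear; lra)).
by rewrite starM cexp_sa ?star_scM ?sx// -e2 -e1 !mulrA.
Qed.

End GeodesicFormulas.

Lemma interval_conv (R : realType) (I : interval R) (a b u : R) : a \in I -> b \in I ->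
  0 <= u <= 1 -> u * a + (1 - u) * b \in I.
Proof.
move=> aI bI u01; have := @interval_is_interval R I; rewrite /is_interval => h.
case: (leP a b) => [ab|/ltW ba].
  by apply: (h a b) => //; nra.
by apply: (h b a) => //; nra.
Qed.

(* A set U embedded by W in the positive cone, such that the image of U contains
   the geodesics between its points. *)
Section GeodesicModel.
Variables (R : realType) (A : cstarAlgType R) (T : Type).
Variables (U : set T) (W : T -> A) (d : T -> T -> R) (G : interval R -> (R -> T) -> Prop).
Hypothesis W_ppos : forall w, U w -> ppos (W w).
Hypothesis W_inj : forall w w', U w -> U w' -> W w = W w' -> w = w'.
Hypothesis W_geo : forall w w' t, U w -> U w' -> exists2 v, U v & W v = cgeo (W w) (W w') t.
Hypothesis dE : forall w w', U w -> U w' -> d w w' = thompson (W w) (W w').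
Hypothesis GE : forall I c, G I c <-> (forall t, t \in I -> U (c t)) /\
  exists a b, [/\ ppos a, ppos b & forall t, t \in I -> W (c t) = cgeo a b t].

Lemma model_metric : is_metric_on U d.
Proof.
split.
- by move=> x y Ux Uy; rewrite dE// thompson_ge0.
- move=> x y Ux Uy; rewrite dE// thompson_eq0; try exact: W_ppos.
  by split=> [|-> //]; exact: W_inj.
- by move=> x y Ux Uy; rewrite !dE// thompson_sym.
- by move=> x y z Ux Uy Uz; rewrite !dE// thompson_triangle//; exact: W_ppos.
Qed.

Lemma model_repr I c : G I c -> (forall t, t \in I -> U (c t)) /\ exists g x,
  [/\ invertible g, star x = x &
      forall t, t \in I -> W (c t) = g * cexp (sc A t * x) * star g].
Proof.
move=> /GE[cU [a [b [ap bp cab]]]]; split=> //.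
have [g [x [[_ ig] sx _ _ gE]]] := cgeo_rep ap bp.
by exists g, x; split=> // t tI; rewrite cab.
Qed.

(** The distance between times s and t is |t - s| |x|, so the sum over a partition telescopes. *)
Lemma model_short I c : G I c -> short_curve d I c.
Proof.
move=> /model_repr[cU [g [x [ig sx cE]]]] a b aI bI ab.
have dl s t : s \in I -> t \in I -> d (c s) (c t) = `|t - s| * cnorm x.
  by move=> sI tI; rewrite (dE (cU s sI) (cU t tI)) (cE s sI) (cE t tI) thompson_geo.
have len s : itv_partition a b s ->
    \sum_(0 <= k < size s) d (c (nth b (a :: s) k)) (c (nth b (a :: s) k.+1)) =
    d (c a) (c b).
  move=> abs; have pI k : (k < (size s).+1)%N -> nth b (a :: s) k \in I.
    move=> ks; apply: (@interval_is_interval R I a b) => //.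
    by rewrite (itv_partition_nth_ge ks abs) (itv_partition_nth_le ks abs).
  rewrite (eq_big_nat _ _ (F2 := fun k =>
      nth b (a :: s) k.+1 * cnorm x - nth b (a :: s) k * cnorm x)).
    rewrite telescope_sumr//= (itv_partition_nth_size b abs) dl// ger0_norm ?subr_ge0//.
    by rewrite mulrBl.
  move=> k /andP[_ ks]; rewrite dl; [|by apply: pI; exact: ltnW|exact: pI].
  rewrite -mulrBl ger0_norm// subr_ge0 ltW//=.
  by case: abs => /(pathP b)/(_ k ks).
rewrite /curve_length; apply/le_anti/andP; split.
  by apply: ge_ereal_sup => _ [s /len -> <-].
(* For a = b the only partition is the empty list, since partitions increase strictly. *)
apply: ereal_sup_ubound; move: ab; rewrite le_eqVlt => /orP[/eqP ab|ab].
  by exists [::]; [rewrite /itv_partition /= ab|rewrite len// /itv_partition /= ab].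
by exists [:: b]; [exact: itv_partition1|rewrite len//; exact: itv_partition1].
Qed.

Lemma model_geodesic x y : U x -> U y -> exists c, [/\ G `[0, 1] c, c 0 = x & c 1 = y].
Proof.
move=> Ux Uy; have pos := W_ppos; pose c t := s2val (cid2 (W_geo t Ux Uy)).
have cU t : U (c t) := s2valP (cid2 (W_geo t Ux Uy)).
have cE t : W (c t) = cgeo (W x) (W y) t := s2valP' (cid2 (W_geo t Ux Uy)).
have [g [z [gp sz gx gy gE]]] := cgeo_rep (W_ppos Ux) (W_ppos Uy).
exists c; split.
- by apply/GE; split=> //; exists (W x), (W y); split=> //; exact: W_ppos.
- by apply: W_inj => //; rewrite cE gE sc0 mul0r cexp0 mulr1.
- by apply: W_inj => //; rewrite cE gE sc1 mul1r.
Qed.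

(** Taking the points at time t as base points and replacing each exponent x by (s - t) x reduces
    the claim to [thompson_convex] on [0, 1], with s and t in either order. *)
Lemma model_convex I c1 c2 s t u : G I c1 -> G I c2 -> s \in I -> t \in I ->
  0 <= u <= 1 -> d (c1 (u * s + (1 - u) * t)) (c2 (u * s + (1 - u) * t)) <=
    u * d (c1 s) (c2 s) + (1 - u) * d (c1 t) (c2 t).
Proof.
move=> /model_repr[U1 [g [x [ig sx c1E]]]] /model_repr[U2 [h [y [ih sy c2E]]]] sI tI u01.
have uI := interval_conv sI tI u01.
rewrite (dE (U1 _ uI) (U2 _ uI)) (dE (U1 s sI) (U2 s sI)) (dE (U1 t tI) (U2 t tI)).
rewrite (c1E _ uI) (c2E _ uI) (c1E s sI) (c2E s sI) (c1E t tI) (c2E t tI).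
pose p (k z : A) := k * cexp (sc A (t / 2) * z); pose q (z : A) := sc A (s - t) * z.
have F k z : star z = z -> [/\ k * cexp (sc A (u * s + (1 - u) * t) * z) * star k =
      p k z * cexp (sc A u * q z) * star (p k z),
    k * cexp (sc A s * z) * star k = p k z * cexp (q z) * star (p k z) &
    k * cexp (sc A t * z) * star k = p k z * star (p k z)].
  have e0 : u * s + (1 - u) * t = t + u * (s - t) by clear; ring.
  move=> sz; rewrite e0; split; last exact: esym (cexp_sc_half_star k t sz).
    by rewrite (cexp_shift_rep k t (u * (s - t)) sz) (scM A u) /p /q -(mulrA (sc A u)).
  have e2 : t + (s - t) = s by clear; ring.
  by have := cexp_shift_rep k t (s - t) sz; rewrite e2.
have ip k z : invertible k -> invertible (p k z).
  by move=> ik; apply: invertibleM => //; exact: invertible_cexp.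
have sq z : star z = z -> star (q z) = q z by move=> sz; rewrite star_scM sz.
have [-> -> ->] := F g x sx; have [-> -> ->] := F h y sy.
rewrite [leRHS]addrC; move: (ip g x ig) (ip h y ih) (sq x sx) (sq y sy) u01.
by clear; exact: thompson_convex.
Qed.

Lemma model_npc : metric_length_space U d G /\ nonpositively_curved d G.
Proof.
split; first by split; [exact: model_metric|exact: model_short|exact: model_geodesic].
split=> [I c1 c2 G1 G2 t x y|c1 c2 G1 G2 c0 t].
  rewrite !inE /= => xI yI; rewrite !convRE.
  by apply: (model_convex G1 G2 xI yI); apply/andP; split.
rewrite in_itv /= => t01.
have I0 : (0 : R) \in `[0, 1] by rewrite in_itv /= lexx ler01.
have I1 : (1 : R) \in `[0, 1] by rewrite in_itv /= lexx ler01.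
have := model_convex G1 G2 I1 I0 t01; rewrite !mulr1 !mulr0 !addr0 => /le_trans; apply.
have [U1 _] := model_repr G1; have [U2 _] := model_repr G2.
have [_ h _ _] := model_metric.
by rewrite (proj2 (h _ _ (U1 _ I0) (U2 _ I0)) c0) mulr0 addr0.
Qed.

End GeodesicModel.

(** * The half-space, the disk and the Cayley transform *)

Section Cayley.
Variables (R : realType) (A : cstarAlgType R).
Implicit Types (a b x y z h w v : A) (c q : R[i]).

(* 1 - t a is a strict contraction for small t > 0. *)
Lemma accretive_invertible a e : 0 < e -> cle (sc A e) (a + star a) -> invertible a.
Proof.
move=> e0 ea; pose m := cnorm a ^+ 2 + 1.
have m0 : 0 < m by rewrite ltr_wpDl ?sqr_ge0.
(* The first bound gives t^2 |a|^2 <= t e / 2, hence |1 - t a|^2 <= 1 - t e / 2; the second keeps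
   this number nonnegative. *)
pose t := Order.min (e / (2 * m)) (1 / (2 * e)).
have t0 : 0 < t by rewrite lt_min !divr_gt0// mulr_gt0.
have te : t * e <= 1 / 2.
  rewrite -ler_pdivlMr//; apply: (@le_trans _ _ (1 / (2 * e))); first by rewrite ge_min lexx orbT.
  by rewrite le_eqVlt; apply/orP; left; apply/eqP; field; rewrite gt_eqF.
have tm : t * m <= e / 2.
  rewrite -ler_pdivlMr//; apply: (@le_trans _ _ (e / (2 * m))); first by rewrite ge_min lexx.
  by rewrite le_eqVlt; apply/orP; left; apply/eqP; field; rewrite gt_eqF.
pose s := 1 - t * e / 2.
have s1 : s < 1 by rewrite ltrBlDr ltrDl divr_gt0// mulr_gt0.
have s0 : 0 <= s by rewrite /s; move: te; lra.
have h1 : cle (star (1 - sc A t * a) * (1 - sc A t * a)) (sc A s).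
  have -> : star (1 - sc A t * a) * (1 - sc A t * a) =
      1 - sc A t * (a + star a) + sc A (t ^+ 2) * (star a * a).
    rewrite starB star1 star_scM mulrBl mul1r mulrBr mulr1 scMM -expr2 mulrDr.
    by ncring.
  have h2 : cle (star a * a) (sc A m).
    apply: cle_trans (cle_sc A (_ : cnorm a ^+ 2 <= m)).
      exact/cnorm_le_starM/lexx/cnorm_ge0.
    by rewrite lerDl.
  apply: (@cle_trans _ _ (1 - sc A (t * e) + sc A (t ^+ 2 * m))).
    apply: cleD; last by rewrite (scM A (t ^+ 2)); apply: cle_scM => //; exact: sqr_ge0.
    rewrite /cle opprD opprK addrACA subrr add0r addrC scM -mulrBr.
    by apply: npos_scM => //; exact: ltW.
  rewrite -(sc1 A) -scB -scD; apply: cle_sc; rewrite /s.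
  have : t * (t * m) <= t * (e / 2) by rewrite ler_pM2l.
  rewrite expr2; clear; lra.
have n1 : cnorm (1 - sc A t * a) < 1.
  have : cnorm (1 - sc A t * a) <= Num.sqrt s.
    by apply/cnorm_le_starM; rewrite ?sqrtr_ge0// sqr_sqrtr.
  move=> /le_lt_trans; apply; rewrite -[X in _ < X]sqrtr1 ltr_sqrt//.
have := neumann n1; rewrite subKr => ita.
rewrite (_ : a = sc A t^-1 * (sc A t * a)); last first.
  by rewrite mulrA [sc A t^-1 * _]scC scV ?mul1r// gt_eqF.
by apply: invertibleM => //; apply: invertible_sc; rewrite invr_eq0 gt_eqF.
Qed.

Definition ci : A := ('i%C : R[i])%:A.

Lemma ci_scale x : 'i%C *: x = ci * x.
Proof. by rewrite /ci -scalerAl mul1r. Qed.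

Lemma ciC x : ci * x = x * ci.
Proof. by rewrite /ci -scalerAl mul1r -scalerAr mulr1. Qed.

Lemma ci2 : ci * ci = - 1.
Proof. by rewrite -ci_scale /ci scalerA -expr2 sqr_i scaleN1r. Qed.

Lemma star_ci : star ci = - ci.
Proof.
rewrite /ci star_scale star1 -scaleNr; congr (_ *: _).
by apply/eqP; rewrite eq_complex /= oppr0 !eqxx.
Qed.

Lemma imag2 h : imag h + imag h = - (ci * (h - star h)).
Proof.
rewrite /imag -scalerDl -ci_scale -scaleNr; congr (_ *: _).
rewrite invfM -mulrDl -{1 2}[2%:R^-1]mul1r -mulrDl -(natrD _ 1 1) divff ?pnatr_eq0// mul1r.
apply: (mulfI (_ : 'i%C != 0 :> R[i])); first by rewrite eq_complex /= oner_eq0 andbF.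
by rewrite divff ?eq_complex/= ?oner_eq0 ?andbF// mulrN -expr2 sqr_i opprK.
Qed.

Lemma half_spaceP h : half_space h <-> ppos (imag h).
Proof. by rewrite /half_space /ppos /= cpositiveP. Qed.

Lemma diskP z : disk z <-> ppos (1 - star z * z).
Proof.
have zz := npos_starM z; rewrite ppos_strict /disk /=; split=> [z1|[e e0 ez]].
  have n0 := cnorm_ge0 z; exists (1 - cnorm z ^+ 2).
    by rewrite subr_gt0 expr_lt1.
  have := iffLR (cnorm_le_starM z n0) (lexx _).
  by rewrite /cle scB sc1; congr npos; ncring.
have h : cle (star z * z) (sc A (1 - e)).
  by move: ez; rewrite /cle scB sc1; congr npos; ncring.
have e1 : 0 <= 1 - e.
  by apply: cle_sc_inj; rewrite sc0; apply: cle_trans h; rewrite /cle subr0.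
have : cnorm z <= Num.sqrt (1 - e).
  by apply/cnorm_le_starM; rewrite ?sqrtr_ge0// sqr_sqrtr.
move=> /le_lt_trans; apply; rewrite -[X in _ < X]sqrtr1 ltr_sqrt//; lra.
Qed.

(** Twice the real part of 1 - i h is 2 + 2 Im h >= 2. *)
Lemma half_space_invertible h : half_space h -> invertible (1 - ci * h).
Proof.
move=> /half_spaceP[hp _]; apply: (@accretive_invertible _ 2) => //.
rewrite starB star1 starM star_ci mulrN opprK -ciC /cle sc2.
rewrite (_ : _ - _ = imag h + imag h); first exact: nposD.
by rewrite imag2; ncring.
Qed.

Lemma disk_invertible z : disk z -> invertible (1 + z).
Proof. by move=> z1; rewrite -[z]opprK; apply: neumann; rewrite cnormN. Qed.

Lemma cayleyE h : cayley h = (1 + ci * h) * inverse (1 - ci * h).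
Proof. by rewrite /cayley ci_scale. Qed.

(** The solution h of z (1 - i h) = 1 + i h; the factors 1 - z and (1 + z)^-1 commute. *)
Definition cayley_inv z : A := ci * ((1 - z) * inverse (1 + z)).

(** With a = 1 - i h and b = 1 + i h one has a* a - b* b = 4 Im h; congruence by a^-1 turns the left
    side into 1 - z* z for z = b a^-1. *)
Lemma cayley_disk h : half_space h -> disk (cayley h).
Proof.
move=> hh; have ia := half_space_invertible hh; have [ai iaa] := inverseP ia.
apply/diskP; rewrite cayleyE; set a := 1 - ci * h in ia ai iaa *.
have ias := invertible_inverse ia; set d := inverse a in ai iaa ias *.
have -> : 1 - star ((1 + ci * h) * d) * ((1 + ci * h) * d) =
    star d * (sc A 4 * imag h) * d.
  have -> : sc A 4 * imag h = star a * a - star (1 + ci * h) * (1 + ci * h).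
    have -> : sc A 4 * imag h = (imag h + imag h) + (imag h + imag h).
      have -> : (4 : R) = 2 + 2 by lra.
      by rewrite scD sc2 mulrDl mulrDl mul1r.
    rewrite imag2 /a starB starD star1 starM star_ci mulrN -ciC.
    rewrite mulrBr mulrDl mulrBl; ncring.
  rewrite mulrBr mulrBl -mulrA -(mulrA _ a d) ai mulr1 -starM ai star1 starM.
  by rewrite !mulrA.
apply: ppos_conj => //; have [hp hi] := iffLR (half_spaceP h) hh.
split; first exact: npos_scM.
by apply: invertibleM => //; exact: invertible_sc.
Qed.

(** The sum of [star (1 + z) * (1 - z)] and its adjoint is 2 (1 - z* z); congruence by (1 + z)^-1
    gives twice the imaginary part of the image. *)
Lemma cayley_inv_half_space z : disk z -> half_space (cayley_inv z).
Proof.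
move=> zd; have ia := disk_invertible zd; have [ai iaa] := inverseP ia.
have ids := invertible_inverse ia; rewrite /cayley_inv.
set d := inverse (1 + z) in ai iaa ids *.
apply/half_spaceP; rewrite (_ : imag _ = star d * (1 - star z * z) * d).
  by apply: ppos_conj => //; exact/diskP.
rewrite -[LHS]half_add -mulrDr imag2; set X := (1 - z) * d.
have -> : ci * X - star (ci * X) = ci * X + star X * ci.
  by rewrite starM star_ci mulrN opprK.
have E y : - (ci * (ci * y + star y * ci)) = y + star y.
  by rewrite mulrDr -(ciC (star y)) !mulrA ci2 !mulN1r opprD !opprK.
rewrite E.
rewrite /X starM.
have -> : (1 - z) * d + star d * star (1 - z) =
    star d * (1 - star z * z) * d + star d * (1 - star z * z) * d.
  have e1 : (1 - z) * d = star d * (star (1 + z) * (1 - z)) * d.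
    by rewrite mulrA -starM ai star1 mul1r.
  have e2 : star d * star (1 - z) = star d * (star (1 - z) * (1 + z)) * d.
    by rewrite -!mulrA ai mulr1.
  by rewrite e1 e2 starB starD star1; ncring.
by rewrite mulrDr half_add.
Qed.

Lemma cayleyK h : half_space h -> cayley_inv (cayley h) = h.
Proof.
move=> hh; have ia := half_space_invertible hh; have [ai iaa] := inverseP ia.
rewrite /cayley_inv cayleyE; set a := 1 - ci * h in ia ai iaa *.
set d := inverse a in ai iaa *; set b := 1 + ci * h.
have e1 : 1 + b * d = sc A 2 * d by rewrite -{1}ai -mulrDl /a /b sc2; ncring.
have e2 : 1 - b * d = - (sc A 2 * (ci * h)) * d.
  by rewrite -{1}ai -mulrBl /a /b sc2; ncring.
have i2 : inverse (sc A 2 * d) = a * sc A 2^-1.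
  have c2 : sc A 2 * sc A 2^-1 = 1 by rewrite scV.
  apply: inverse_unique; rewrite !mulrA.
    by rewrite -(mulrA _ d) iaa mulr1.
  by rewrite -(mulrA a) [sc A 2^-1 * _]scC c2 mulr1.
rewrite e1 e2 i2 -mulrA (mulrA d) iaa mul1r mulNr mulrN.
have -> : sc A 2 * (ci * h) * sc A 2^-1 = ci * h.
  by rewrite -scC mulrA [sc A 2^-1 * _]scC scV// mul1r.
by rewrite mulrA ci2 mulN1r opprK.
Qed.

Lemma cayley_invK z : disk z -> cayley (cayley_inv z) = z.
Proof.
move=> zd; have ia := disk_invertible zd; have [ai iaa] := inverseP ia.
rewrite cayleyE /cayley_inv mulrA ci2 mulN1r.
set d := inverse (1 + z) in ai iaa *.
have e1 : 1 - (1 - z) * d = sc A 2 * z * d by rewrite -{1}ai -mulrBl sc2; ncring.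
have e2 : 1 - - ((1 - z) * d) = sc A 2 * d by rewrite opprK -{1}ai -mulrDl sc2; ncring.
have i2 : inverse (sc A 2 * d) = (1 + z) * sc A 2^-1.
  have c2 : sc A 2 * sc A 2^-1 = 1 by rewrite scV.
  apply: inverse_unique; rewrite !mulrA.
    by rewrite -(mulrA _ d) iaa mulr1.
  by rewrite -(mulrA (1 + z)) [sc A 2^-1 * _]scC c2 mulr1.
rewrite e1 e2 i2 -mulrA (mulrA d) iaa mul1r.
by rewrite -scC mulrA [sc A 2^-1 * _]scC scV// mul1r.
Qed.

(* The derivative of v |-> (1 + q v)^-1 at x is v |-> - q r v r, r = (1 + q x)^-1. *)
Lemma differentiable_resolvent (f : A -> A) x y c q : invertible (1 + q *: x) ->
  (forall v, invertible (1 + q *: v) -> f v = y + c *: inverse (1 + q *: v)) ->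
  differentiable_at f x.
Proof.
move=> ix fE; have [xi ixx] := inverseP ix; set r := inverse (1 + q *: x) in xi ixx.
pose D v : A := - (c * q) *: (r * v * r).
have D_lin : linear D.
  move=> k u v; rewrite /D mulrDr mulrDl scalerDr; congr (_ + _).
  by rewrite -scalerAr -scalerAl !scalerA mulrC.
pose Dl := GRing.isLinear.Build R[i] A A *:%R D D_lin.
pose DL : {linear A -> A} := HB.pack D Dl.
pose nm (k : R[i]) := complex.Re `|k|.
have nm0 k : 0 <= nm k by rewrite /nm normc_def /= sqrtr_ge0.
pose n := cnorm r; have n0 : 0 <= n := cnorm_ge0 r.
exists DL; split.
  exists (nm (- (c * q)) * (n * n)) => v /=; rewrite cnormZ -[leRHS]mulrA ler_wpM2l ?nm0//.
  rewrite (le_trans (cnormM _ _))// mulrAC ler_wpM2r//.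
  by rewrite (le_trans (cnormM _ _))//.
move=> e e0; pose K := nm c * (2 * (nm q * n) ^+ 2 * n) + 1.
have K0 : 0 < K by rewrite ltr_wpDl// !mulr_ge0// exprn_ge0// mulr_ge0.
(* |v| < 1 / m makes |w| <= 1 / 2 below, so that 1 + w has an inverse of norm at most 2; this is the
   factor 2 in [K]. *)
pose m := 2 * (nm q * n) + 1; have m0 : 0 < m by rewrite ltr_wpDl// !mulr_ge0.
exists (Order.min (e / K) (1 / m)); first by rewrite lt_min !divr_gt0.
move=> v; rewrite lt_min ltr_pdivlMr// ltr_pdivlMr// => /andP[ve vm].
pose w := q *: (r * v); have v0 := cnorm_ge0 v.
have wn : cnorm w <= nm q * n * cnorm v.
  by rewrite /w cnormZ -mulrA ler_wpM2l ?nm0// cnormM.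
have w2 : cnorm w <= 1 / 2 by move: wn vm; rewrite /m mulrDr mulr1; nra.
have iw : invertible (1 + w) by rewrite -[w]opprK; apply: neumann; rewrite cnormN; lra.
have [ws sw] := inverseP iw; set s := inverse (1 + w) in ws sw.
have s2 : cnorm s <= 2.
  have : cnorm (1 - w * s) <= 1 + 1 / 2 * cnorm s.
    rewrite (le_trans (cnormB _ _))// cnorm1 lerD2l (le_trans (cnormM _ _))//.
    by rewrite ler_wpM2r ?cnorm_ge0.
  have -> : 1 - w * s = s by rewrite -ws; ncring.
  lra.
have xv : 1 + q *: (x + v) = (1 + q *: x) * (1 + w).
  rewrite mulrDr mulr1 /w -scalerAr mulrA xi mul1r scalerDr addrA.
  by [].
have ixv : invertible (1 + q *: (x + v)) by rewrite xv; exact: invertibleM.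
rewrite (fE _ ixv) (fE _ ix) xv inverseM// -/r -/s.
(* (1 + w)^-1 - 1 + w = w^2 (1 + w)^-1, so the remainder is quadratic in v. *)
have -> : y + c *: (s * r) - (y + c *: r) - DL v = c *: (w * w * s * r).
  rewrite /= /D scaleNr opprK -scalerA opprD addrACA subrr add0r -scalerBr -scalerDr.
  congr (_ *: _); rewrite (_ : q *: (r * v * r) = w * r); last by rewrite /w scalerAl.
  have -> : w * w * s = s - 1 + w.
    have h : w * s = 1 - s by rewrite -ws; ncring.
    by rewrite -mulrA h mulrBr mulr1 h; ncring.
  by rewrite !mulrDl mulNr mul1r.
rewrite cnormZ -/(nm c).
have h1 : cnorm (w * w * s * r) <= (nm q * n * cnorm v) ^+ 2 * 2 * n.
  rewrite (le_trans (cnormM _ _))// ler_wpM2r// (le_trans (cnormM _ _))//.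
  by rewrite ler_pM ?cnorm_ge0// (le_trans (cnormM _ _))// expr2 ler_pM ?cnorm_ge0.
rewrite (le_trans (ler_wpM2l (nm0 c) h1))//.
have -> : nm c * ((nm q * n * cnorm v) ^+ 2 * 2 * n) = (K - 1) * cnorm v * cnorm v.
  by rewrite /K; ring.
by rewrite ler_wpM2r//; move: ve; nra.
Qed.

(** Both maps are affine functions of a resolvent: - 1 + 2 (1 - i h)^-1 and - i + 2 i (1 + z)^-1. *)
Lemma cayley_diffeomorphism : diffeomorphism (@half_space R A) (@disk R A) (@cayley R A).
Proof.
exists cayley_inv; split.
- by move=> h hh; split; [exact: cayley_disk|exact: cayleyK].
- by move=> z zd; split; [exact: cayley_inv_half_space|exact: cayley_invK].
- move=> h hh; apply: (@differentiable_resolvent _ _ (- 1) 2%:R (- 'i%C)).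
    by rewrite scaleNr ci_scale; exact: half_space_invertible.
  move=> v; rewrite scaleNr ci_scale cayleyE => /inverseP[vi iv].
  rewrite scaler_nat mulr2n; move: (inverse _) vi {iv} => d vi.
  have -> : (1 + ci * v) * d = - ((1 - ci * v) * d) + (d + d) by ncring.
  by rewrite vi.
- move=> z zd; apply: (@differentiable_resolvent _ _ (- ci) (2%:R * 'i%C) 1).
    by rewrite scale1r; exact: disk_invertible.
  move=> v; rewrite scale1r /cayley_inv -scalerA ci_scale scaler_nat mulr2n => /inverseP[vi iv].
  move: (inverse _) vi {iv} => d vi.
  have -> : ci * ((1 - v) * d) = - (ci * ((1 + v) * d)) + (ci * d + ci * d) by ncring.
  by rewrite vi mulr1.
Qed.

End Cayley.

(** * Block notation in M_2(A), and the matrix notions as instances of the general ones *)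

Section Matrix2.
Variables (R : realType) (A : cstarAlgType R).
Notation B := (matrix2 A).
Implicit Types (a b c d : A) (M N : B).

Definition entry M (i j : 'I_2) : A := (M : 'M[A]_2) i j.

Definition mx2 a b c d : B := mx22 a b c d.

Lemma mx2P M N : entry M 0 0 = entry N 0 0 -> entry M 0 1 = entry N 0 1 ->
  entry M 1 0 = entry N 1 0 -> entry M 1 1 = entry N 1 1 -> M = N.
Proof.
move=> h00 h01 h10 h11; apply/matrixP => i j.
have two (k : 'I_2) : k = 0 \/ k = 1.
  by case: (unliftP 0 k) => [l ->|->]; [right|left]; rewrite // [l]ord1; exact: val_inj.
by case: (two i) => ->; case: (two j) => ->.
Qed.

Lemma entry_mx2 a b c d : (entry (mx2 a b c d) 0 0 = a) * (entry (mx2 a b c d) 0 1 = b) *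
  (entry (mx2 a b c d) 1 0 = c) * (entry (mx2 a b c d) 1 1 = d).
Proof. by rewrite /entry /mx2 /mx22 !mxE. Qed.

Lemma entryM M N i j : entry (M * N) i j = entry M i 0 * entry N 0 j + entry M i 1 * entry N 1 j.
Proof. exact: mul_mxE. Qed.

Lemma entryD M N i j : entry (M + N) i j = entry M i j + entry N i j.
Proof. by rewrite /entry mxE. Qed.

Lemma entryN M i j : entry (- M) i j = - entry M i j.
Proof. by rewrite /entry mxE. Qed.

Lemma entry_star M i j : entry (star M) i j = star (entry M j i).
Proof. exact: mxstarE. Qed.

Lemma mx2_eta M : M = mx2 (entry M 0 0) (entry M 0 1) (entry M 1 0) (entry M 1 1).
Proof. by apply: mx2P; rewrite entry_mx2. Qed.

Lemma mx2M a b c d a' b' c' d' : mx2 a b c d * mx2 a' b' c' d' =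
  mx2 (a * a' + b * c') (a * b' + b * d') (c * a' + d * c') (c * b' + d * d').
Proof. by apply: mx2P; rewrite entryM !entry_mx2. Qed.

Lemma mx2D a b c d a' b' c' d' :
  mx2 a b c d + mx2 a' b' c' d' = mx2 (a + a') (b + b') (c + c') (d + d').
Proof. by apply: mx2P; rewrite entryD !entry_mx2. Qed.

Lemma mx2N a b c d : - mx2 a b c d = mx2 (- a) (- b) (- c) (- d).
Proof. by apply: mx2P; rewrite entryN !entry_mx2. Qed.

Lemma mx2_star a b c d : star (mx2 a b c d) = mx2 (star a) (star c) (star b) (star d).
Proof. by apply: mx2P; rewrite entry_star !entry_mx2. Qed.

Lemma mx2_1 : 1 = mx2 1 0 0 1.
Proof. by apply: mx2P; rewrite entry_mx2 /entry !mxE. Qed.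

Lemma mx2_inj a b c d a' b' c' d' : mx2 a b c d = mx2 a' b' c' d' ->
  [/\ a = a', b = b', c = c' & d = d'].
Proof.
move=> h; have e i j : entry (mx2 a b c d) i j = entry (mx2 a' b' c' d') i j by rewrite h.
by have := (e 0 0, e 0 1, e 1 0, e 1 1); rewrite !entry_mx2 => -[[[]]].
Qed.

Lemma entry_npos M i : npos M -> npos (entry M i i).
Proof.
move=> /npos_sqrt[S [/npos_star sS <- _]]; rewrite -{1}sS entryM !entry_star.
by apply: nposD; exact: npos_starM.
Qed.

Lemma glposP (M : 'M[A]_2) : glpos M <-> ppos (M : B).
Proof.
rewrite /glpos /ppos -cpositiveP.
by [].
Qed.

Lemma mxpowE (M : 'M[A]_2) t : mxpow M t = cpow (M : B) t.
Proof. by []. Qed.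

Lemma geodesic_gE (M N : 'M[A]_2) t : geodesic_g M N t = cgeo (M : B) N t.
Proof. by rewrite /geodesic_g !mxpowE. Qed.

Lemma dist_gE (M N : 'M[A]_2) : glpos M -> glpos N -> dist_g M N = thompson (M : B) N.
Proof.
move=> /glposP Mp /glposP Np; rewrite -(cdistE Mp Np); congr inf; apply/seteqP.
split=> l [gam [dgam [C1 gp g0 g1 lE]]]; exists gam, dgam; split=> // t t01;
  exact/glposP/gp.
Qed.

End Matrix2.

(** * Representatives x of w, and the point of the cone attached to w *)

Section Frames.
Variables (R : realType) (A : cstarAlgType R).
Notation B := (matrix2 A).
Variable rho : B.
Hypothesis star_rho : star rho = rho.
Hypothesis rho2 : rho * rho = 1.
Implicit Types (w k : A) (x : 'cV[A]_2).

Definition represents w x := @Kset R A rho x /\ x 1 0 * inverse (x 0 0) = w.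

Definition outer x : B := x *m mxstar x.

Definition frame w : 'cV[A]_2 := \col_i (if i == 0 then 1 else w).

(** The form at the column (1, w): 1 - w* w for the disk, 2 Im w for the half-space. Each domain is
    the set where it is positive and invertible. *)
Definition gram w : A := theta rho (frame w) (frame w).

Definition point w : B := (rho : 'M[A]_2) *m Phi rho w.

Lemma gramE w : gram w = star (entry rho 0 0 + entry rho 0 1 * w) +
  star (entry rho 1 0 + entry rho 1 1 * w) * w.
Proof. by rewrite /gram /theta -/(inner _ _) innerE !mul_mxE !mxE /= !mulr1. Qed.

Lemma theta_frame w x : x 1 0 = w * x 0 0 ->
  theta rho x x = star (x 0 0) * gram w * x 0 0.
Proof.
move=> xw; rewrite gramE /theta -/(inner _ _) innerE !mul_mxE xw -!/(entry rho _ _).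
have e i : entry rho i 0 * x 0 0 + entry rho i 1 * (w * x 0 0) =
    (entry rho i 0 + entry rho i 1 * w) * x 0 0 by rewrite mulrDl mulrA.
by rewrite !e !starM; ncring.
Qed.

Lemma represents_snd w x : represents w x -> x 1 0 = w * x 0 0.
Proof. by move=> [[_ /inverseP[_ ix]] <-]; rewrite -mulrA ix mulr1. Qed.

(** The condition theta(x, x) = 1 reads x_1* gram(w) x_1 = 1, that is x_1 x_1* = gram(w)^-1. So x x*
    depends on w only, and the choice made in [Phi] does not matter. *)
Lemma outerE w x : represents w x -> let k := inverse (gram w) in
  outer x = mx2 k (k * star w) (w * k) (w * k * star w).
Proof.
move=> rx; have xw := represents_snd rx; case: rx => -[th ix] _.
have -> : inverse (gram w) = x 0 0 * star (x 0 0).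
  move: th; rewrite (theta_frame xw) => th; have [xi ixx] := inverseP ix.
  have gx : star (x 0 0) * gram w = inverse (x 0 0).
    by apply: (invertible_mulIr ix); rewrite ixx.
  apply: inverse_unique; last by rewrite -mulrA gx xi.
  apply: (invertible_mulIr ix); rewrite mul1r -!mulrA.
  apply: (invertible_mulrI (invertible_star ix)).
  by rewrite !mulrA th mul1r.
have e i j : entry (outer x) i j = x i 0 * star (x j 0).
  by rewrite /entry /outer mxE big_ord1 mxstarE.
by apply: mx2P; rewrite e entry_mx2 ?xw ?starM ?mulrA.
Qed.

Lemma Phi_outer w x : represents w x -> Phi rho w = outer x * rho + outer x * rho - 1 :> B.
Proof.
move=> rx; rewrite /Phi; case: xgetP => [y _ ry|/(_ x)//].
have -> : Defs.proj rho y = outer x * rho :> B.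
  by rewrite (outerE rx) -(outerE (ry : represents w y)).
congr (_ - _); apply/matrixP => i j.
by rewrite [LHS]mxE scaler_nat mulr2n [RHS]mxE.
Qed.

(** The column (1, w) is normalised by gram(w)^(-1/2) on the right. *)
Lemma ex_represents w : ppos (gram w) -> exists x, represents w x.
Proof.
move=> /ppos_sqrt[s [[sp si] ss _]]; have [sr rs] := inverseP si; set r := inverse s in sr rs.
have star_r : star r = r by rewrite /r -inverse_star ?npos_star.
pose x : 'cV[A]_2 := \col_i (if i == 0 then r else w * r).
have x0 : x 0 0 = r by rewrite mxE. have x1 : x 1 0 = w * r by rewrite mxE.
exists x; split; last by rewrite x0 x1 /r inverseK// -/r -mulrA rs mulr1.
split; last by rewrite x0; exists s.
by rewrite (@theta_frame w) ?x0 ?x1// star_r -ss mulrA rs mul1r.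
Qed.

Lemma outer_idem x : Kset rho x -> outer x * rho * outer x = outer x.
Proof.
move=> [th _]; have th1 : mxstar x *m (rho : 'M[A]_2) *m x = 1%:M.
  apply/matrixP => i j; rewrite !ord1 [RHS]mxE /= mulr1n -th /theta mxstar_mul.
  by rewrite -[mxstar rho]/(star rho) star_rho.
rewrite /outer; change (x *m mxstar x *m (rho : 'M[A]_2) *m (x *m mxstar x) = x *m mxstar x).
have -> : x *m mxstar x *m (rho : 'M[A]_2) *m (x *m mxstar x) =
    x *m (mxstar x *m (rho : 'M[A]_2) *m x) *m mxstar x by rewrite !mulmxA.
by rewrite th1 mulmx1.
Qed.

Definition dual_point x : B := outer x + outer x - rho.

Lemma point_dual w x : represents w x -> point w = rho * dual_point x * rho.
Proof.
move=> rx; rewrite /point (Phi_outer rx) /dual_point; set E := outer x.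
have -> : rho * (E + E - rho) * rho = rho * E * rho + rho * E * rho - rho * rho * rho by ncring.
rewrite rho2 mul1r; change (rho * (E * rho + E * rho - 1) = rho * E * rho + rho * E * rho - rho).
by ncring.
Qed.

Lemma dual_point_rho x : Kset rho x -> dual_point x * rho * dual_point x = rho.
Proof.
move=> Kx; have h := outer_idem Kx; rewrite /dual_point; set E := outer x in h *.
have -> : (E + E - rho) * rho * (E + E - rho) =
    (E * rho * E + E * rho * E) + (E * rho * E + E * rho * E) - (E * (rho * rho) + E * (rho * rho))
    - (rho * rho * E + rho * rho * E) + rho * rho * rho by ncring.
by rewrite h rho2 !mulr1 !mul1r; ncring.
Qed.

Lemma point_symmetric w x : represents w x -> rho * point w * rho * point w = 1.
Proof.
move=> rx; rewrite (point_dual rx); set Q := dual_point x.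
have h : Q * rho * Q = rho := dual_point_rho rx.1.
have -> : rho * (rho * Q * rho) * rho * (rho * Q * rho) =
    (rho * rho) * Q * (rho * rho) * rho * Q * rho by ncring.
by rewrite rho2 mul1r mulr1 h rho2.
Qed.

Lemma invertible_dual_point x : Kset rho x -> invertible (dual_point x).
Proof.
move=> /dual_point_rho h; exists (rho * dual_point x * rho).
by split; [rewrite !mulrA h|rewrite -!mulrA (mulrA _ rho) h].
Qed.

End Frames.

(** * Points of the disk as symmetric positive matrices *)

Section Disk.
Variables (R : realType) (A : cstarAlgType R).
Notation B := (matrix2 A).
Notation rD := (rhoD A : B).
Implicit Types (w : A).

Lemma rhoD_star : star rD = rD.
Proof. by rewrite -[rD]/(mx2 1 0 0 (- 1)) mx2_star star0 starN star1. Qed.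

Lemma rhoD_sq : rD * rD = 1.
Proof.
by rewrite -[rD]/(mx2 1 0 0 (- 1)) mx2M mx2_1; congr mx2; ncring.
Qed.

Lemma gramD w : gram rD w = 1 - star w * w.
Proof.
rewrite gramE -[rD]/(mx2 1 0 0 (- 1)) !entry_mx2 mul0r addr0 add0r mulN1r star1 starN mulNr.
by [].
Qed.

Lemma disk_gram w : disk w <-> ppos (gram rD w).
Proof. by rewrite gramD diskP. Qed.

(* The dual point is the positive matrix x x* + y y*, where y spans the
   orthogonal of (1, w) for the form of rho, the line of (w*, 1). *)
Lemma ppos_pointD w : disk w -> ppos (point rD w).
Proof.
move=> wd; have gp := iffLR (disk_gram w) wd.
have [x rx] := ex_represents gp; rewrite (point_dual rhoD_sq rx).
have rr : rD * star rD = 1 by rewrite rhoD_star rhoD_sq.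
have rr' : star rD * rD = 1 by rewrite rhoD_star rhoD_sq.
rewrite -[X in _ * X]rhoD_star; apply: ppos_unitary => //.
split; last exact: (invertible_dual_point rhoD_star rhoD_sq rx.1).
have [gi ig] := inverseP gp.2; have := outerE rx; set k := inverse _ in gi ig * => /= oE.
rewrite gramD in gi ig.
have kp : npos k by apply: npos_inverse.
have sk := npos_star kp.
(* This element is the inverse of [1 - w * star w]; its square root [s] normalises the column (w*,
   1). *)
have lp : npos (1 + w * k * star w).
  apply: nposD; first exact: npos1.
  by have := npos_conj (star w) kp; rewrite starK.
have [s [/npos_star ss sl _]] := npos_sqrt lp.
have kw : star w * w * k = k - 1 by rewrite -gi; ncring.
have wk : k * (star w * w) = k - 1 by rewrite -ig; ncring.
have e1 : star w * (1 + w * k * star w) = k * star w.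
  by rewrite mulrDr mulr1 !mulrA kw mulrBl mul1r addrCA subrr addr0.
have e2 : star w * (1 + w * k * star w) * w = k - 1 by rewrite e1 -mulrA wk.
have e3 : (1 + w * k * star w) * w = w * k.
  by rewrite mulrDl mul1r -!mulrA wk mulrBr mulr1 addrCA subrr addr0.
rewrite (_ : dual_point _ _ = outer x +
    (mx2 0 (star w * s) 0 s) * star (mx2 0 (star w * s) 0 s)).
  apply: nposD; last exact: npos_Mstar.
  rewrite (_ : outer x = (mx2 (x 0 0) 0 (x 1 0) 0) * star (mx2 (x 0 0) 0 (x 1 0) 0)).
    exact: npos_Mstar.
  rewrite mx2_star mx2M star0 !mulr0 !addr0; apply: mx2P; rewrite entry_mx2;
    by rewrite /entry /outer mxE big_ord1 mxstarE.
rewrite /dual_point -addrA; congr (_ + _).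
rewrite oE mx2_star mx2M star0 !mul0r !add0r starM starK ss.
rewrite -[rD]/(mx2 1 0 0 (- 1)) mx2N mx2D.
have -> : star w * s * (s * w) = k - 1 by rewrite -e2 -sl !mulrA.
have -> : star w * s * s = k * star w by rewrite -e1 -sl mulrA.
have -> : s * (s * w) = w * k by rewrite -e3 -sl mulrA.
by rewrite sl oppr0 opprK !addr0 [1 + _]addrC.
Qed.

(** The preimage is forced: with Q = rho P rho, the matrix x x* must be (Q + rho) / 2, whose first
    column has entries (a + 1) / 2 and [star b] / 2; hence w = [star b * d] with d = (a + 1)^-1. The
    relation Q rho Q = rho then gives 1 - w* w = 2 d and the entry c. *)
Lemma pointD_surj (P : B) : ppos P -> rD * P * rD * P = 1 ->
  exists2 w, disk w & point rD w = P.
Proof.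
move=> Pp sP; pose Q := rD * P * rD.
have rr : rD * star rD = 1 by rewrite rhoD_star rhoD_sq.
have rr' : star rD * rD = 1 by rewrite rhoD_star rhoD_sq.
have Qp : ppos Q by rewrite /Q -{2}rhoD_star; exact: ppos_unitary.
have QQ : Q * rD * Q = rD.
  rewrite /Q; have -> : rD * P * rD * rD * (rD * P * rD) = rD * P * (rD * rD) * rD * P * rD by ncring.
  by rewrite rhoD_sq mulr1 sP mul1r.
pose a := entry Q 0 0; pose b := entry Q 0 1; pose c := entry Q 1 1.
have QE : Q = mx2 a b (star b) c.
  by rewrite [LHS]mx2_eta /b -entry_star (npos_star Qp.1).
have ap : npos a := entry_npos 0 Qp.1; have cp : npos c := entry_npos 1 Qp.1.
have [h1 h2 _ h3] : [/\ a * a - b * star b = 1, a * b - b * c = 0,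
    star b * a - c * star b = 0 & star b * b - c * c = - 1].
  move: QQ; rewrite QE -[rD]/(mx2 1 0 0 (- 1)) !mx2M; clearbody a b c; move: (star b) => b' /mx2_inj[q1 q2 q3 q4].
  by split; [rewrite -q1|rewrite -q2|rewrite -q3|rewrite -q4]; ncring.
have ia : invertible (a + 1) by rewrite -(sc1 A); exact: npos_invertible.
have ic : invertible (c + 1) by rewrite -(sc1 A); exact: npos_invertible.
have [ai iaa] := inverseP ia; have [ci' icc] := inverseP ic.
set d := inverse (a + 1) in ai iaa; set f := inverse (c + 1) in ci' icc.
have a1p : ppos (a + 1) by split=> //; apply: nposD => //; exact: npos1.
have sd : star d = d by rewrite -inverse_star// starD star1 npos_star.
pose w := star b * d.
have sw : star w = d * b by rewrite /w starM starK sd.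
have gw : 1 - star w * w = d + d.
  have bb : b * star b = (a + 1) * (a - 1) by rewrite mulr_commD ?mulr1 ?mul1r// -h1; ncring.
  have -> : star w * w = d * (b * star b) * d by rewrite sw /w !mulrA.
  rewrite bb mulrA iaa mul1r.
  have -> : (a - 1) * d = (a + 1) * d - (d + d) by ncring.
  by rewrite ai; ncring.
have dp : ppos d by split; [exact: npos_inverse|exact: invertible_inverse].
have wd : disk w.
  apply/diskP; rewrite gw; have -> : d + d = sc A 2 * d by rewrite sc2 mulrDl mul1r.
  split; first by apply: npos_scM => //; case: dp.
  by apply: invertibleM; [exact: invertible_sc|case: dp].
exists w => //; have [x rx] := ex_represents (iffLR (disk_gram w) wd).
rewrite (point_dual rhoD_sq rx); have := outerE rx; rewrite gramD gw.
have -> : inverse (d + d) = sc A 2^-1 * (a + 1).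
  have e : d + d = sc A 2 * d by rewrite sc2 mulrDl mul1r.
  apply: inverse_unique; rewrite e scMM ?divff ?mulVf// sc1 mul1r//.
set k := sc A 2^-1 * (a + 1); have kk : k + k = a + 1 by rewrite half_add.
move=> /= oE; have DQ : dual_point rD x = Q.
  rewrite /dual_point oE QE -[rD]/(mx2 1 0 0 (- 1)) mx2N !mx2D !oppr0 opprK !addr0.
  have e1 : w * k + w * k = star b by rewrite -mulrDr kk /w -mulrA iaa mulr1.
  have e2 : k * star w + k * star w = b by rewrite -mulrDl kk sw mulrA ai mul1r.
  have e3 : w * k * star w + w * k * star w + 1 = c.
    rewrite -mulrDl e1 sw.
    (* The off-diagonal relation a b = b c lets the inverse of a + 1 cross b and become that of c +
       1. *)
    have db : d * b = b * f.
      apply: (invertible_mulrI ia); rewrite mulrA ai mul1r mulrA.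
      apply: (invertible_mulIr ic); rewrite -mulrA icc mulr1.
      move/eqP: h2; rewrite subr_eq0 => /eqP h2.
      by rewrite mulrDl mulrDr h2 mul1r mulr1.
    have bb : star b * b = (c - 1) * (c + 1).
      rewrite mulr_commB ?mulr1 ?mul1r//.
      by apply: (addIr (- (c * c))); rewrite h3 addrAC subrr add0r.
    by rewrite db mulrA bb -mulrA ci' mulr1 subrK.
  by rewrite kk e1 e2 e3 addrK.
rewrite DQ /Q; have -> : rD * (rD * P * rD) * rD = (rD * rD) * P * (rD * rD) by ncring.
by rewrite rhoD_sq mulr1 mul1r.
Qed.

(** The first column of x x* consists of k and w k with k = gram(w)^-1 invertible, from which w is
    read off. *)
Lemma pointD_inj w w' : disk w -> disk w' -> point rD w = point rD w' -> w = w'.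
Proof.
move=> wd wd'; have gp := iffLR (disk_gram w) wd; have gp' := iffLR (disk_gram w') wd'.
have [x rx] := ex_represents gp; have [x' rx'] := ex_represents gp'.
rewrite (point_dual rhoD_sq rx) (point_dual rhoD_sq rx') => h.
have ir : invertible rD by exists rD; rewrite rhoD_sq.
have {h} h : dual_point rD x = dual_point rD x'.
  by apply: (invertible_mulrI ir); apply: (invertible_mulIr ir).
have : outer x = outer x'.
  rewrite -(half_add (outer x)) -(half_add (outer x')) -!mulrDr; congr (_ * _).
  by move: h; rewrite /dual_point => /addIr.
rewrite (outerE rx) (outerE rx') => /mx2_inj[kk _ wk _].
by apply: (invertible_mulIr (invertible_inverse gp.2)); rewrite wk kk.
Qed.

End Disk.

(** * Transfer from the disk to the half-space *)

Section Transfer.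
Variables (R : realType) (A : cstarAlgType R).
Notation B := (matrix2 A).
Notation rD := (rhoD A : B).
Notation rH := (rhoH A : B).
Notation ci := (ci A).
Implicit Types (h : A).

(* The unitary (1 / sqrt 2) ((1, -i), (1, i)) carries the form of the half-space
   to the form of the disk and induces the Cayley transform on the ratios. *)
Definition cayley_mx : B :=
  let r := sc A (Num.sqrt 2)^-1 in mx2 r (- (r * ci)) r (r * ci).

Lemma cayley_mx_half : sc A (Num.sqrt 2)^-1 * sc A (Num.sqrt 2)^-1 +
  sc A (Num.sqrt 2)^-1 * sc A (Num.sqrt 2)^-1 = 1.
Proof.
by rewrite -scM -scD -expr2 exprVn sqr_sqrtr// -(sc1 A); congr sc; lra.
Qed.

Lemma cayley_mx_unitary : cayley_mx * star cayley_mx = 1.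
Proof.
have hf := cayley_mx_half; rewrite /cayley_mx /=; set r := sc A _ in hf *.
have sr : star r = r := star_sc _ _; have rC : r * ci = ci * r by rewrite ciC.
have cc : r * ci * (r * ci) = - (r * r).
  by rewrite {2}rC mulrA -(mulrA r) ci2 mulrN1 mulNr.
rewrite mx2_star mx2M !starN !starM sr star_ci !mulNr !mulrN !opprK -rC cc mx2_1.
by congr mx2; rewrite -?hf ?subrr ?addNr ?opprK.
Qed.

Lemma cayley_mx_unitary' : star cayley_mx * cayley_mx = 1.
Proof.
have hf := cayley_mx_half; rewrite /cayley_mx /=; set r := sc A _ in hf *.
have sr : star r = r := star_sc _ _; have rC : r * ci = ci * r by rewrite ciC.
have cc : r * ci * (r * ci) = - (r * r).
  by rewrite {2}rC mulrA -(mulrA r) ci2 mulrN1 mulNr.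
rewrite mx2_star mx2M !starN !starM sr star_ci !mulNr !mulrN !opprK -rC.
rewrite cc mx2_1.
by congr mx2; rewrite -?hf ?subrr ?addNr ?opprK.
Qed.

Lemma rhoHE : rH = mx2 0 (- ci) ci 0.
Proof. by []. Qed.

Lemma rhoH_star : star rH = rH.
Proof. by rewrite rhoHE mx2_star star0 starN star_ci opprK. Qed.

Lemma rhoH_sq : rH * rH = 1.
Proof.
by rewrite rhoHE mx2M !mulr0 !mul0r !addr0 !add0r mulNr mulrN ci2 opprK mx2_1.
Qed.

Lemma cayley_mx_rho : cayley_mx * rH = rD * cayley_mx.
Proof.
rewrite /cayley_mx rhoHE -[rD]/(mx2 1 0 0 (- 1)) !mx2M.
by congr mx2; rewrite !mulr0 ?mul0r ?addr0 ?add0r ?mul1r ?mulN1r ?mulNr ?mulrN -?mulrA ?ci2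
  ?mulrN1 ?opprK.
Qed.

Lemma gramH h : gram rH h = imag h + imag h.
Proof.
rewrite imag2 gramE rhoHE !entry_mx2 mul0r addr0 add0r mulNr starN starM star_ci.
by rewrite mulrN opprK -ciC; ncring.
Qed.

Lemma half_space_gram h : half_space h <-> ppos (gram rH h).
Proof.
rewrite half_spaceP gramH; have -> : imag h + imag h = sc A 2 * imag h.
  by rewrite sc2 mulrDl mul1r.
split=> -[hp hi]; split.
- exact: npos_scM.
- by apply: invertibleM => //; exact: invertible_sc.
- have -> : imag h = sc A 2^-1 * (sc A 2 * imag h).
    by rewrite mulrA [sc A 2^-1 * _]scC scV// mul1r.
  by apply: npos_scM => //; rewrite invr_ge0.
- have -> : imag h = sc A 2^-1 * (sc A 2 * imag h).
    by rewrite mulrA [sc A 2^-1 * _]scC scV// mul1r.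
  by apply: invertibleM => //; apply: invertible_sc; rewrite invr_eq0.
Qed.

(** The matrix sends (x_1, x_2) to r (x_1 - i x_2, x_1 + i x_2), that is r (1 - i h) x_1 and r (1 +
    i h) x_1 when x_2 = h x_1. Being unitary and intertwining the two rho, it preserves theta. *)
Lemma represents_cayley h (x : 'cV[A]_2) : half_space h -> represents rH h x ->
  represents rD (cayley h) ((cayley_mx : 'M[A]_2) *m x).
Proof.
move=> hh rx; have x1 := represents_snd rx; case: rx => -[th ix] _.
set y := _ *m x; pose r := sc A (Num.sqrt 2)^-1.
have ir : invertible r by apply: invertible_sc; rewrite invr_eq0 gt_eqF// sqrtr_gt0.
have ia := half_space_invertible hh.
have y0 : y 0 0 = r * (1 - ci * h) * x 0 0.
  rewrite /y mul_mxE -!/(entry cayley_mx _ _) !entry_mx2 x1 -/r; ncring.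
have y1 : y 1 0 = r * (1 + ci * h) * x 0 0.
  rewrite /y mul_mxE -!/(entry cayley_mx _ _) !entry_mx2 x1 -/r; ncring.
have iy : invertible (y 0 0).
  by rewrite y0; apply: invertibleM => //; exact: invertibleM.
split; last first.
  rewrite cayleyE; have [yi _] := inverseP iy; have [_ iaa] := inverseP ia.
  have -> : y 1 0 = (1 + ci * h) * inverse (1 - ci * h) * y 0 0.
    rewrite y0 y1 !mulrA; congr (_ * _).
    by rewrite -(mulrA _ r) -/r [r * (1 - _)]scC mulrA -(mulrA _ (inverse _)) iaa mulr1 scC.
  by rewrite -mulrA yi mulr1.
split=> //; rewrite -th /theta.
have e : mxstar ((rD : 'M[A]_2) *m y) *m y = mxstar ((rH : 'M[A]_2) *m x) *m x.
  have -> : (rD : 'M[A]_2) *m y = (cayley_mx : 'M[A]_2) *m ((rH : 'M[A]_2) *m x).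
    by rewrite /y !mulmxA; congr (_ *m _); exact: (esym cayley_mx_rho).
  rewrite mxstar_mul /y -mulmxA (mulmxA (mxstar cayley_mx)).
  by rewrite -[mxstar cayley_mx *m _]/(star cayley_mx * cayley_mx) cayley_mx_unitary' mul1mx.
by rewrite e.
Qed.

(** Both x x* and rho transform by conjugation with the unitary, hence so does the point built from
    them. *)
Lemma point_cayley h : half_space h ->
  point rD (cayley h) = cayley_mx * point rH h * star cayley_mx.
Proof.
move=> hh; have [x rx] := ex_represents (iffLR (half_space_gram h) hh).
have ry := represents_cayley hh rx.
rewrite (point_dual (rhoD_sq A) ry) (point_dual rhoH_sq rx).
set u := cayley_mx; have uu := cayley_mx_unitary.
have e1 : rD * u = u * rH by rewrite cayley_mx_rho.
have e2 : star u * rD = rH * star u by rewrite -{1}(rhoD_star A) -starM e1 starM rhoH_star.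
have -> : dual_point rD ((u : 'M[A]_2) *m x) = u * dual_point rH x * star u.
  have oE : outer ((u : 'M[A]_2) *m x) = u * outer x * star u.
    by rewrite /outer mxstar_mul mulmxA -(mulmxA _ x).
  have -> : rD = u * rH * star u by rewrite -e1 -mulrA uu mulr1.
  by rewrite /dual_point oE; ncring.
have -> : rD * (u * dual_point rH x * star u) * rD = (rD * u) * dual_point rH x * (star u * rD).
  by rewrite !mulrA.
by rewrite e1 e2 !mulrA.
Qed.

Lemma ppos_pointH h : half_space h -> ppos (point rH h).
Proof.
move=> hh; have := ppos_pointD (cayley_disk hh); rewrite point_cayley//.
move=> /(@ppos_unitary _ _ (star cayley_mx)); rewrite starK.
move=> /(_ cayley_mx_unitary' cayley_mx_unitary).
by rewrite !mulrA cayley_mx_unitary' mul1r -mulrA cayley_mx_unitary' mulr1.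
Qed.

Lemma pointD_geo z z' t : disk z -> disk z' ->
  exists2 v, disk v & point rD v = cgeo (point rD z) (point rD z') t.
Proof.
move=> zd zd'; have zp := ppos_pointD zd; have zp' := ppos_pointD zd'.
apply: pointD_surj; first exact: ppos_cgeo.
have sym v : disk v -> rD * point rD v * rD * point rD v = 1.
  move=> vd; have [x rx] := ex_represents (iffLR (disk_gram v) vd).
  exact: (point_symmetric (rhoD_star A) (rhoD_sq A) rx).
by apply: cgeo_symmetric => //; [exact: rhoD_star|exact: rhoD_sq|exact: sym|exact: sym].
Qed.

Lemma pointH_geo h h' t : half_space h -> half_space h' ->
  exists2 v, half_space v & point rH v = cgeo (point rH h) (point rH h') t.
Proof.
move=> hh hh'; have [z zd] := pointD_geo t (cayley_disk hh) (cayley_disk hh').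
have vh := cayley_inv_half_space zd; rewrite -(cayley_invK zd) !point_cayley//.
rewrite cgeo_unitary ?cayley_mx_unitary ?cayley_mx_unitary'//; try exact: ppos_pointH.
move=> e; exists (cayley_inv z) => //.
have iu : invertible cayley_mx.
  by exists (star cayley_mx); rewrite cayley_mx_unitary cayley_mx_unitary'.
by apply: (invertible_mulrI iu); apply: (invertible_mulIr (invertible_star iu)).
Qed.

Lemma pointH_inj h h' : half_space h -> half_space h' -> point rH h = point rH h' -> h = h'.
Proof.
move=> hh hh' e; rewrite -(cayleyK hh) -(cayleyK hh'); congr cayley_inv.
by apply: pointD_inj; rewrite ?point_cayley ?e//; exact: cayley_disk.
Qed.

Lemma distDE z z' : disk z -> disk z' ->
  distD z z' = thompson (point rD z) (point rD z').
Proof. by move=> zd zd'; apply: dist_gE; apply/glposP; exact: ppos_pointD. Qed.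

Lemma distHE h h' : half_space h -> half_space h' ->
  distH h h' = thompson (point rH h) (point rH h').
Proof. by move=> hh hh'; apply: dist_gE; apply/glposP; exact: ppos_pointH. Qed.

Lemma geodesicP (rho : B) (U : set A) I c : geodesic (rho : 'M[A]_2) U I c <->
  (forall t, t \in I -> U (c t)) /\ exists M N : B,
    [/\ ppos M, ppos N & forall t, t \in I -> point rho (c t) = cgeo M N t].
Proof.
rewrite /geodesic /point; split=> -[cU [M [N [/glposP Mp /glposP Np h]]]]; split; first exact: cU.
- by exists M, N; split; [exact: Mp|exact: Np|move=> t /h ->; rewrite geodesic_gE].
- exact: cU.
- by exists M, N; split; [exact: Mp|exact: Np|move=> t /h ->; rewrite geodesic_gE].
Qed.

End Transfer.

Theorem corollary8p6 (R : realType) (A : cstarAlgType R) :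
  [/\ metric_length_space (@half_space R A) (@distH R A) (@geodesicH R A)
        /\ nonpositively_curved (@distH R A) (@geodesicH R A),
      metric_length_space (@disk R A) (@distD R A) (@geodesicD R A)
        /\ nonpositively_curved (@distD R A) (@geodesicD R A),
      diffeomorphism (@half_space R A) (@disk R A) (@cayley R A)
    & forall h1 h2 : A, half_space h1 -> half_space h2 ->
        distD (cayley h1) (cayley h2) = distH h1 h2].
Proof.
split.
- apply: (@model_npc _ _ _ _ (point (rhoH A : matrix2 A))).
  + exact: ppos_pointH.
  + exact: pointH_inj.
  + by move=> h h' t; exact: pointH_geo.
  + exact: distHE.
  + by move=> I c; exact: geodesicP.
- apply: (@model_npc _ _ _ _ (point (rhoD A : matrix2 A))).
  + exact: ppos_pointD.
  + exact: pointD_inj.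
  + by move=> z z' t; exact: pointD_geo.
  + exact: distDE.
  + by move=> I c; exact: geodesicP.
- exact: cayley_diffeomorphism.
- move=> h1 h2 hh1 hh2.
  rewrite (distDE (cayley_disk hh1) (cayley_disk hh2)) (distHE hh1 hh2).
  rewrite (point_cayley hh1) (point_cayley hh2).
  apply: thompson_unitary; [exact: cayley_mx_unitary|exact: cayley_mx_unitary'].
Qed.
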